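(* Fix $\lambda\in(0,1)$ and let $\alpha,\epsilon$ be the constants of the Lyapunov theorem (see context). There is a constant $c=c(\lambda)>0$ such that for every lattice polygon, every boundary condition $\xi$, every $g\in\mathbb{G}^\xi$, every initial $\sigma\in\Omega^\xi$, every $t\ge1$ and every $\ell\ge0$, with $\sigma^t$ the state at time $t$ of $\mathcal{M}^\lambda(\Omega^\xi)$ started at $\sigma$, $$\mathbb{P}_\sigma\Big(\exists y\in\Lambda:\ \sigma^t_y\cap g\ne\emptyset,\ |\sigma^t_y|\ge|g|+\ell\Big)\le\max\Big\{\Psi^\xi_g(\sigma)\Big(1-\frac{\epsilon}{|\Lambda|}\Big)^t,\ c\Big\}\alpha^{-\ell}.$$ In particular, if $x$ is the midpoint of $g$ and $\sigma\sim\pi^\xi$, then $\pi^\xi(|\sigma_x|\ge|g|+\ell)\le c\,\alpha^{-\ell}$ for all $\ell\ge0$.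
   Context: Let $P$ be a lattice polygon (a simple polygon whose vertices lie in $\mathbb{Z}^2$ and whose sides contain no points of $\mathbb{Z}^2$ other than their endpoints) and let $\Lambda^0$ be the set of points of $\mathbb{Z}^2$ in $P$ (including its boundary). Edges are open straight line segments with endpoints in $\Lambda^0$; $|e|$ denotes the $\ell_1$ length of an edge $e$. A triangulation of $\Lambda^0$ is a maximal collection of pairwise disjoint edges none of which contains a point of $\Lambda^0$; all its triangles have area $1/2$, and the set $\Lambda$ of midpoints of its edges does not depend on the triangulation, so a triangulation $\sigma$ is written $\sigma=\{\sigma_x\}_{x\in\Lambda}$ with $\sigma_x$ the edge of midpoint $x$. A boundary condition $\xi$ is a set of pairwise disjoint edges containing no point of $\Lambda^0$ and containing all sides of $P$; $\Omega^\xi$ is the set of triangulations containing every edge of $\xi$. An edge $\sigma_x$ of $\sigma\in\Omega^\xi$ is flippable if $\sigma_x\notin\xi$ and the two triangles of $\sigma$ containing it form a strictly convex quadrilateral; flipping it replaces $\sigma_x$ by the other diagonal, giving $\sigma^x\in\Omega^\xi$. For $x\in\Lambda$, $E_x^\xi=\{\sigma_x:\sigma\in\Omega^\xi\}$; the ground state edges of $x$ are the elements of $E^\xi_x$ of minimal length; $\mathbb{G}^\xi$ is the set of all ground state edges of all midpoints. For each non-ground-state $f\in E_x^\xi$ there is a unique $e\in E_x^\xi$ (its parent) with $|e|<|f|$ obtainable from $f$ by a single flip in some triangulation of $\Omega^\xi$; $\prec$ is the transitive closure of ''is the parent of'', and $e\preceq f$ means $e=f$ or $e\prec f$. Glauber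 dynamics $\mathcal{M}^\lambda(\Omega^\xi)$: from the current $\sigma$, pick $x\in\Lambda$ uniformly; if $\sigma_x$ is not flippable do nothing; otherwise move to $\sigma^x$ with probability $\lambda^{|\sigma^x_x|}/(\lambda^{|\sigma^x_x|}+\lambda^{|\sigma_x|})$. Its stationary distribution is $\pi^\xi(\sigma)\propto\lambda^{\sum_{x\in\Lambda}|\sigma_x|}$. $\mathbb{P}_\sigma$ refers to the chain started at $\sigma$. Height function: $E_x^\xi(\sigma,g)=\{e\in E_x^\xi: e\cap g\ne\emptyset,\ e\preceq\sigma_x\}$, $\Psi_g^\xi(\sigma)=\sum_{x\in\Lambda}\sum_{e\in E_x^\xi(\sigma,g)}\alpha^{|e|-|g|}$. Lyapunov theorem: for each $\lambda\in(0,1)$ there are $\alpha\in(1,\lambda^{-1/2})$, $\psi_0>1$, $\epsilon>0$ depending only on $\lambda$ such that for every lattice polygon, boundary condition $\xi$, $\sigma\in\Omega^\xi$ and $g\in\mathbb{G}^\xi$ with $\Psi_g^\xi(\sigma)\ge\psi_0$, one step $\sigma'$ of $\mathcal{M}^\lambda(\Omega^\xi)$ from $\sigma$ satisfies $\mathbb{E}_\sigma\Psi_g^\xi(\sigma')\le(1-\epsilon/|\Lambda|)\Psi_g^\xi(\sigma)$. These $\alpha,\psi_0,\epsilon$ are fixed throughout. *)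

(* Defs.v *)
From Stdlib Require Import Reals ZArith Relations ClassicalDescription.
From mathcomp Require Import all_boot.
Set Implicit Arguments. Unset Strict Implicit. Unset Printing Implicit Defensive.

Local Open Scope R_scope.

Definition pb (P : Prop) : bool := if excluded_middle_informative P then true else false.

Definition Rltb (x y : R) : bool := if Rlt_dec x y then true else false.

Definition cseg (a b p : R * R) : Prop :=
  exists t : R, (0 <= t <= 1) /\
    p = (a.1 + t * (b.1 - a.1), a.2 + t * (b.2 - a.2)).
Definition oseg (a b p : R * R) : Prop :=
  exists t : R, (0 < t < 1) /\
    p = (a.1 + t * (b.1 - a.1), a.2 + t * (b.2 - a.2)).

Section Lattice.
(* All lattice points are taken in the box [-n,n]^2 (every lattice polygon lies
   in such a box for some n; the box size n is quantified in the theorem). *)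
Variable n : nat.

Definition pt := ('I_(2 * n).+1 * 'I_(2 * n).+1)%type.
Definition pt0 : pt := (ord0, ord0).
Definition px (p : pt) : Z := (Z.of_nat p.1 - Z.of_nat n)%Z.
Definition py (p : pt) : Z := (Z.of_nat p.2 - Z.of_nat n)%Z.
Definition rp (p : pt) : R * R := (IZR (px p), IZR (py p)).

(* a polygon is the cyclic list of its vertices; sides are [v_i, v_{i+1 mod k}] *)
Definition sides (V : seq pt) : seq (pt * pt) := zip V (rot 1 V).
Definition side (V : seq pt) (i : nat) : pt * pt := nth (pt0, pt0) (sides V) i.

Definition simple_polygon (V : seq pt) : Prop :=
  (3 <= size V)%N /\ uniq V /\
  forall (i j : nat) (p : R * R), (i < size V)%N -> (j < size V)%N -> i <> j ->
    cseg (rp (side V i).1) (rp (side V i).2) p ->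
    cseg (rp (side V j).1) (rp (side V j).2) p ->
    (j = (i.+1 %% size V)%N /\ p = rp (nth pt0 V j)) \/
    (i = (j.+1 %% size V)%N /\ p = rp (nth pt0 V i)).

Definition lattice_polygon (V : seq pt) : Prop :=
  simple_polygon V /\
  forall s, s \in sides V -> forall z1 z2 : Z,
    cseg (rp s.1) (rp s.2) (IZR z1, IZR z2) ->
    (z1, z2) = (px s.1, py s.1) \/ (z1, z2) = (px s.2, py s.2).

Definition on_boundary (V : seq pt) (p : R * R) : Prop :=
  exists s, s \in sides V /\ cseg (rp s.1) (rp s.2) p.

(* crossing test of the horizontal ray {(x',y) : x' > x} with side s
   (half-open convention at vertices) *)
Definition crosses (p : R * R) (s : pt * pt) : bool :=
  let: (a, b) := (rp s.1, rp s.2) in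
  (Rltb p.2 a.2 != Rltb p.2 b.2) &&
  Rltb p.1 (a.1 + (p.2 - a.2) * (b.1 - a.1) / (b.2 - a.2)).

(* the closed region P bounded by the simple polygon: boundary, or interior
   (odd crossing number) *)
Definition inP (V : seq pt) (p : R * R) : Prop :=
  on_boundary V p \/ odd (count (crosses p) (sides V)).

Definition Lam0 (V : seq pt) (z : pt) : Prop := inP V (rp z).

Definition edge := {set pt}.

Definition segpt (e : edge) (p : R * R) : Prop :=
  exists a b, e = [set a; b] /\ a != b /\ oseg (rp a) (rp b) p.

Definition is_edge (V : seq pt) (e : edge) : Prop :=
  exists a b, e = [set a; b] /\ a != b /\ Lam0 V a /\ Lam0 V b /\
    (forall p, oseg (rp a) (rp b) p -> inP V p).

Definition admissible (V : seq pt) (e : edge) : Prop :=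
  is_edge V e /\ forall z, Lam0 V z -> ~ segpt e (rp z).

Definition meet (e f : edge) : Prop := exists p, segpt e p /\ segpt f p.

Definition dist1 (a b : pt) : nat :=
  (Z.abs_nat (px a - px b) + Z.abs_nat (py a - py b))%N.
Definition elen (e : edge) : nat := (\max_(a in e) \max_(b in e) dist1 a b)%N.

Definition triangulation (V : seq pt) (T : {set edge}) : Prop :=
  (forall e, e \in T -> admissible V e) /\
  (forall e f, e \in T -> f \in T -> e != f -> ~ meet e f) /\
  (forall f, admissible V f -> f \notin T -> exists e, e \in T /\ meet e f).

Definition boundary_cond (V : seq pt) (xi : {set edge}) : Prop :=
  (forall e, e \in xi -> admissible V e) /\
  (forall e f, e \in xi -> f \in xi -> e != f -> ~ meet e f) /\
  (forall s, s \in sides V -> [set s.1; s.2] \in xi).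

Definition Omega (V : seq pt) (xi : {set edge}) (T : {set edge}) : Prop :=
  triangulation V T /\ xi \subset T.

(* ---------- midpoints (in doubled coordinates) ---------- *)
Definition mpt := ('I_(4 * n).+1 * 'I_(4 * n).+1)%type.
Definition emid (e : edge) : mpt :=
  (inord (\sum_(a in e) (a.1 : nat))%N, inord (\sum_(a in e) (a.2 : nat))%N).

Definition Lambda (V : seq pt) : {set mpt} :=
  [set x | pb (exists T, triangulation V T /\ exists e, e \in T /\ emid e = x)].

Definition Ex (V : seq pt) (xi : {set edge}) (x : mpt) (e : edge) : Prop :=
  exists T, Omega V xi T /\ e \in T /\ emid e = x.

Definition ground (V : seq pt) (xi : {set edge}) (x : mpt) (g : edge) : Prop :=
  Ex V xi x g /\ forall e, Ex V xi x e -> (elen g <= elen e)%N.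

Definition Gset (V : seq pt) (xi : {set edge}) (g : edge) : Prop :=
  exists x, ground V xi x g.

Definition orient (a b c : pt) : Z :=
  ((px b - px a) * (py c - py a) - (py b - py a) * (px c - px a))%Z.

Definition in_ctri (a b c z : pt) : Prop :=
  (0 <= orient a b z /\ 0 <= orient b c z /\ 0 <= orient c a z)%Z \/
  (orient a b z <= 0 /\ orient b c z <= 0 /\ orient c a z <= 0)%Z.

Definition tri (V : seq pt) (T : {set edge}) (a b c : pt) : Prop :=
  [set a; b] \in T /\ [set b; c] \in T /\ [set a; c] \in T /\
  orient a b c <> 0%Z /\
  forall z, Lam0 V z -> in_ctri a b c z -> z = a \/ z = b \/ z = c.

Definition sconvex4 (a c b d : pt) : Prop :=
  (0 < orient a c b /\ 0 < orient c b d /\ 0 < orient b d a /\ 0 < orient d a c)%Z \/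
  (orient a c b < 0 /\ orient c b d < 0 /\ orient b d a < 0 /\ orient d a c < 0)%Z.

Definition flip (V : seq pt) (xi : {set edge}) (T : {set edge}) (e : edge)
    (T' : {set edge}) : Prop :=
  e \in T /\ e \notin xi /\
  exists a b c d, e = [set a; b] /\ a != b /\ tri V T a b c /\ tri V T a b d /\
    sconvex4 a c b d /\ T' = (T :\ e) :|: [set [set c; d]].

Definition parent (V : seq pt) (xi : {set edge}) (e f : edge) : Prop :=
  exists x, Ex V xi x e /\ Ex V xi x f /\ ~ ground V xi x f /\ (elen e < elen f)%N /\
    exists T, Omega V xi T /\ f \in T /\ flip V xi T f ((T :\ f) :|: [set e]).

Definition preceq (V : seq pt) (xi : {set edge}) : relation edge :=
  clos_refl_trans edge (parent V xi).

Definition Psi (V : seq pt) (xi : {set edge}) (g : edge) (alpha : R)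
    (T : {set edge}) : R :=
  \big[Rplus/R0]_(x in Lambda V)
    \big[Rplus/R0]_(e : edge | pb (Ex V xi x e /\ meet e g /\
                          exists f, f \in T /\ emid f = x /\ preceq V xi e f))
      powerRZ alpha (Z.of_nat (elen e) - Z.of_nat (elen g)).

Definition qflip (lam : R) (T : {set edge}) (e : edge) (T' : {set edge}) : R :=
  let lf := (\sum_(f in T' :\: T) elen f)%N in
  (lam ^ lf / (lam ^ lf + lam ^ elen e)).

Definition kernel (V : seq pt) (xi : {set edge}) (lam : R)
    (T T' : {set edge}) : R :=
  (/ INR #|Lambda V| *
   \big[Rplus/R0]_(x in Lambda V) \big[Rplus/R0]_(e in T | emid e == x)
     ((if pb (flip V xi T e T') then qflip lam T e T' else 0) +
      (if T' == T then
         1 - \big[Rplus/R0]_(U : {set edge} | pb (flip V xi T e U)) qflip lam T e U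
       else 0))).

Fixpoint law (V : seq pt) (xi : {set edge}) (lam : R) (s : {set edge}) (t : nat)
    (T : {set edge}) : R :=
  match t with
  | 0 => if T == s then R1 else R0
  | t'.+1 => \big[Rplus/R0]_(U : {set edge}) (law V xi lam s t' U * kernel V xi lam U T)
  end.

Definition Prob (V : seq pt) (xi : {set edge}) (lam : R) (s : {set edge}) (t : nat)
    (A : {set edge} -> Prop) : R :=
  \big[Rplus/R0]_(T : {set edge} | pb (A T)) law V xi lam s t T.

Definition Exp1 (V : seq pt) (xi : {set edge}) (lam : R) (s : {set edge})
    (F : {set edge} -> R) : R :=
  \big[Rplus/R0]_(T : {set edge}) (law V xi lam s 1 T * F T).

Definition weight (V : seq pt) (lam : R) (T : {set edge}) : R :=
  (lam ^ (\sum_(x in Lambda V) \sum_(e in T | emid e == x) elen e)%N).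

Definition piProb (V : seq pt) (xi : {set edge}) (lam : R)
    (A : {set edge} -> Prop) : R :=
  (\big[Rplus/R0]_(T : {set edge} | pb (Omega V xi T /\ A T)) weight V lam T /
   \big[Rplus/R0]_(T : {set edge} | pb (Omega V xi T)) weight V lam T).

End Lattice.

Definition lyapunov_property (lam alpha psi0 eps : R) : Prop :=
  forall (n : nat) (V : seq (pt n)) (xi : {set edge n}) (s : {set edge n}) (g : edge n),
    lattice_polygon V -> boundary_cond V xi -> Omega V xi s -> Gset V xi g ->
    (psi0 <= Psi V xi g alpha s) ->
    (Exp1 V xi lam s (Psi V xi g alpha) <=
       (1 - eps / INR #|Lambda V|) * Psi V xi g alpha s).

(* Main.v *)
From HB Require Import structures.
Require Import Defs.
From Stdlib Require Import Reals ZArith Relations ClassicalDescription Classical Lra Lia.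
From mathcomp Require Import all_boot zify.
Set Implicit Arguments. Unset Strict Implicit. Unset Printing Implicit Defensive.
Local Open Scope R_scope.

(* Write N = |Lambda|, D = 1 - eps/N, let M(T) be the largest weight alpha^(|e|-|g|) of an edge e of T
   meeting g, and let Z = Psi - M. The event of the theorem is contained in {M >= alpha^l}, so it is
   enough to bound E M(sigma^t). Iterating the Lyapunov inequality on Psi would only give the sum
   D^t Psi + c0 (1 - D^t); the maximum is gained by iterating instead on
     V_j = rho^j M + (1 - rho^j)(1 - theta) Psi,   rho = 1 - 3/N,
   for which E V_j(sigma') <= D V_(j+1) + C/N and V_0 = M. This uses that Z decreases at relative rate
   at most 2/N (only the flip of the heaviest edge can lose more than its own contribution), which
   leaves a surplus when Z >= delta Psi. If Z < delta Psi with Psi large, then Psi is carried by one long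
   edge far longer than the other edges meeting g; the Lyapunov inequality forces it to be
   flippable to a shorter edge, the sides of its parallelogram are long, so it is flipped at a rate close to
   1/N and Psi drops strictly faster than the factor D. This needs eps < 1, which follows from the
   Lyapunov inequality on a thin parallelogram. For small Psi a constant bound on the drift is needed: the
   increase of Psi caused by flipping e to a longer edge is charged to e, to a side of a triangle of e meeting g,
   or to the lattice vector of e starting at an endpoint of g.
   The equilibrium bound follows from reversibility: pi(Psi) <= C/eps. *)

(** The maximum comes out because rho <= D. At the initial state V_t is at most (1 - theta (1 -
    D^t)) Psi, so after t steps the bound is a convex combination, with weights 1 - theta (1 - D^t)
    and theta (1 - D^t), of D^t Psi and C/(eps theta); the last number is the constant c. The 3 in
    rho exceeds by one the relative rate 2 at which Z can fall, and this unit of Z/N pays for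
    lowering the coefficient of Psi. The condition alpha^2 lam <= 1 bounds the rate of a lengthening
    flip from e to f by alpha^(-2(|f|-|e|)), so that rate times new weight is at most
    alpha^(2|e|-|f|-|g|); this makes the charging possible. The planar facts are derived from the
    definitions: areas 1/2, flips inside parallelograms, unique parents, and midpoints independent
    of the triangulation. For the last one, an uncovered midpoint is located in the interior of a
    triangle of the given triangulation; in the integer coordinates of that triangle no interior
    point is half-integral. *)

Lemma pbP (P : Prop) : reflect P (pb P).
Proof. by rewrite /pb; case: excluded_middle_informative => h; constructor. Qed.

Lemma RltbP (x y : R) : reflect (x < y) (Rltb x y).
Proof. by rewrite /Rltb; case: Rlt_dec => h; constructor. Qed.

Lemma finite_argmin (T : finType) (P : T -> Prop) (f : T -> R) :
  (exists x, P x) -> exists x, P x /\ forall y, P y -> f x <= f y.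
Proof.
move=> [x0 Px0].
suff H : forall s : seq T, (exists x, x \in s /\ P x) ->
    exists x, P x /\ forall y, y \in s -> P y -> f x <= f y.
  have [|x [Px Hx]] := H (enum T); first by exists x0; rewrite mem_enum.
  by exists x; split=> // y Py; apply: Hx => //; rewrite mem_enum.
elim=> [[x []] //|a s IH] [x [xs Px]].
have [[x1 [x1s Px1]]|nex] := classic (exists x, x \in s /\ P x).
  have [|m [Pm Hm]] := IH; first by exists x1.
  have [Pa|nPa] := classic (P a); last first.
    exists m; split=> // y; rewrite inE => /orP[/eqP->|] //.
    exact: Hm.
  have [le|lt] := Rle_lt_dec (f m) (f a).
    by exists m; split=> // y; rewrite inE => /orP[/eqP->|ys Py] //; apply: Hm.
  exists a; split=> // y; rewrite inE => /orP[/eqP->|ys Py]; first by lra.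
  by have := Hm _ ys Py; lra.
exists x; split=> // y; move: xs; rewrite !inE.
case/orP=> [/eqP xa|xs]; last by case: nex; exists x.
case/orP=> [/eqP ya|ys Py]; last by case: nex; exists y.
by rewrite xa ya; lra.
Qed.

Definition det (A B C : R * R) : R :=
  (B.1 - A.1) * (C.2 - A.2) - (B.2 - A.2) * (C.1 - A.1).
Definition aff (A B C : R * R) (s t : R) : R * R :=
  (A.1 + s * (B.1 - A.1) + t * (C.1 - A.1),
   A.2 + s * (B.2 - A.2) + t * (C.2 - A.2)).

(** * Affine coordinates with respect to a triangle *)

Section Affine.
Implicit Types A B C p q : R * R.

Lemma aff00 A B C : A = aff A B C 0 0.
Proof. by case: A B C => [a a'] [b b'] [c c']; rewrite /aff /=; f_equal; ring. Qed.
Lemma aff10 A B C : B = aff A B C 1 0.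
Proof. by case: A B C => [a a'] [b b'] [c c']; rewrite /aff /=; f_equal; ring. Qed.
Lemma aff01 A B C : C = aff A B C 0 1.
Proof. by case: A B C => [a a'] [b b'] [c c']; rewrite /aff /=; f_equal; ring. Qed.

Lemma aff_surj A B C p : det A B C <> 0 -> exists s t, p = aff A B C s t.
Proof.
case: A B C p => [a a'] [b b'] [c c'] [x y]; rewrite /det /aff /= => D0.
exists (((x - a) * (c' - a') - (y - a') * (c - a)) /
        ((b - a) * (c' - a') - (b' - a') * (c - a))).
exists (((b - a) * (y - a') - (b' - a') * (x - a)) /
        ((b - a) * (c' - a') - (b' - a') * (c - a))).
by f_equal; field.
Qed.

Lemma aff_inj A B C s t s' t' : det A B C <> 0 ->
  aff A B C s t = aff A B C s' t' -> s = s' /\ t = t'.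
Proof.
move=> D0 e.
have e1 : det A (aff A B C s t) C = s * det A B C by rewrite /det /aff /=; ring.
have e2 : det A (aff A B C s' t') C = s' * det A B C by rewrite /det /aff /=; ring.
have e3 : det A B (aff A B C s t) = t * det A B C by rewrite /det /aff /=; ring.
have e4 : det A B (aff A B C s' t') = t' * det A B C by rewrite /det /aff /=; ring.
rewrite e in e1 e3; split; apply: (Rmult_eq_reg_r (det A B C)) => //; congruence.
Qed.

Lemma oseg_sym A B p : oseg A B p -> oseg B A p.
Proof.
by move=> [t [ht ->]]; exists (1 - t); split; [lra|f_equal; ring].
Qed.
Lemma cseg_sym A B p : cseg A B p -> cseg B A p.
Proof.
by move=> [t [ht ->]]; exists (1 - t); split; [lra|f_equal; ring].
Qed.
Lemma cseg_cases A B p : cseg A B p -> [\/ p = A, p = B | oseg A B p].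
Proof.
case: A B => [a a'] [b b'] [t [ht ->]] /=.
have [->|t0] := Req_dec t 0; first by constructor 1; f_equal; ring.
have [->|t1] := Req_dec t 1; first by constructor 2; f_equal; ring.
by constructor 3; exists t; split=> //; lra.
Qed.

Lemma aff_mix A B C s t s' t' k :
  ((aff A B C s t).1 + k * ((aff A B C s' t').1 - (aff A B C s t).1),
   (aff A B C s t).2 + k * ((aff A B C s' t').2 - (aff A B C s t).2)) =
  aff A B C (s + k * (s' - s)) (t + k * (t' - t)).
Proof. by rewrite /aff /=; f_equal; ring. Qed.

Lemma oseg_aff A B C s t s' t' k : 0 < k < 1 ->
  oseg (aff A B C s t) (aff A B C s' t') (aff A B C (s + k * (s' - s)) (t + k * (t' - t))).
Proof. by move=> hk; exists k; rewrite aff_mix. Qed.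

Lemma oseg_affE A B C s t s' t' x y : det A B C <> 0 ->
  oseg (aff A B C s t) (aff A B C s' t') (aff A B C x y) ->
  exists k, 0 < k < 1 /\ x = s + k * (s' - s) /\ y = t + k * (t' - t).
Proof.
by move=> D0 [k [hk]]; rewrite aff_mix => /(aff_inj D0)[-> ->]; exists k.
Qed.

End Affine.

(** * Lattice points, orientation and edge lengths *)

Section Points.
Variable n : nat.
Implicit Types a b c d z : pt n.

Lemma px_bd a : (- Z.of_nat n <= px a <= Z.of_nat n)%Z.
Proof. by rewrite /px; have := ltn_ord a.1; lia. Qed.
Lemma py_bd a : (- Z.of_nat n <= py a <= Z.of_nat n)%Z.
Proof. by rewrite /py; have := ltn_ord a.2; lia. Qed.

Lemma pt_eq a b : px a = px b -> py a = py b -> a = b.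
Proof.
case: a b => [a a'] [b b']; rewrite /px /py /= => e e'.
by f_equal; apply: val_inj => /=; lia.
Qed.

Lemma pt_ex (x y : Z) : (- Z.of_nat n <= x <= Z.of_nat n)%Z ->
  (- Z.of_nat n <= y <= Z.of_nat n)%Z -> exists a : pt n, px a = x /\ py a = y.
Proof.
move=> hx hy.
exists (inord (Z.to_nat (x + Z.of_nat n)), inord (Z.to_nat (y + Z.of_nat n))).
rewrite /px /py /= !inordK; first by lia.
  lia.
lia.
Qed.

Lemma rp_inj a b : rp a = rp b -> a = b.
Proof. by rewrite /rp => [] [/eq_IZR e /eq_IZR e']; apply: pt_eq. Qed.

Lemma IZR_orient a b c : IZR (orient a b c) = det (rp a) (rp b) (rp c).
Proof. by rewrite /orient /det /= minus_IZR !mult_IZR !minus_IZR. Qed.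

Lemma orient_swap a b c : orient b a c = (- orient a b c)%Z.
Proof. by rewrite /orient; ring. Qed.
Lemma orient_rot a b c : orient b c a = orient a b c.
Proof. by rewrite /orient; ring. Qed.

Lemma orient_neq0 a b c : orient a b c <> 0%Z ->
  [/\ a != b, b != c, a != c & det (rp a) (rp b) (rp c) <> 0].
Proof.
move=> h; split; try (apply/eqP => e; apply: h; rewrite e /orient; ring).
by rewrite -IZR_orient => /eq_IZR.
Qed.

Lemma set2_eq (T : finType) (a b c d : T) : [set a; b] = [set c; d] ->
  (a = c /\ b = d) \/ (a = d /\ b = c).
Proof.
move=> e.
have ha : a \in [set c; d] by rewrite -e set21.
have hb : b \in [set c; d] by rewrite -e set22.
have hc : c \in [set a; b] by rewrite e set21.
have hd : d \in [set a; b] by rewrite e set22.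
move: ha hb hc hd; rewrite !inE.
do 4!(move=> /orP[/eqP ?|/eqP ?]); subst; auto.
Qed.

Lemma segpt_set2 a b p : segpt [set a; b] p <-> a != b /\ oseg (rp a) (rp b) p.
Proof.
split=> [[c [d [e [cd h]]]]|[ab h]]; last by exists a, b.
have [[-> ->]|[-> ->]] := set2_eq e => //.
by rewrite eq_sym; split=> //; apply: oseg_sym.
Qed.

Lemma dist1_sym a b : dist1 a b = dist1 b a.
Proof. by rewrite /dist1; congr addn; lia. Qed.

Lemma dist1Z a b : Z.of_nat (dist1 a b) = (Z.abs (px a - px b) + Z.abs (py a - py b))%Z.
Proof. by rewrite /dist1 Nat2Z.inj_add !Zabs2Nat.id_abs. Qed.

Lemma elen_set2 a b : elen [set a; b] = dist1 a b.
Proof.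
have d0 : forall z, dist1 z z = 0%N by move=> z; rewrite /dist1 !Z.sub_diag.
apply/eqP; rewrite eqn_leq; apply/andP; split.
  apply/bigmax_leqP => x; rewrite !inE => hx.
  apply/bigmax_leqP => y; rewrite !inE => hy.
  by case/orP: hx => /eqP->; case/orP: hy => /eqP->; rewrite ?d0 // dist1_sym.
apply: (bigmax_sup a); first exact: set21.
by apply: (bigmax_sup b); first exact: set22.
Qed.

Lemma elenZ a b :
  Z.of_nat (elen [set a; b]) = (Z.abs (px a - px b) + Z.abs (py a - py b))%Z.
Proof. by rewrite elen_set2 dist1Z. Qed.

Lemma set2C a b : [set a; b] = [set b; a].
Proof. exact: setUC. Qed.

End Points.

(** * Parity of boundary crossings *)

Lemma Rltb_iff (a b c d : R) : (a < b <-> c < d) -> Rltb a b = Rltb c d.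
Proof. by move=> [h h']; apply/RltbP/RltbP. Qed.

Section CrossSide.
Variables p q A B : R * R.
Hypothesis pq : p.2 < q.2.
Hypothesis disj : forall r, cseg p q r -> cseg A B r -> False.

Let sx t := A.1 + t * (B.1 - A.1).
Let sy t := A.2 + t * (B.2 - A.2).
Let E t := (sx t - p.1) * (q.2 - p.2) - (sy t - p.2) * (q.1 - p.1).

(** [E t] is the cross product locating the point of AB at parameter t relative to the line pq. A
    sign change within the strip would, by interpolation, give a zero of [E] inside the strip, which
    is a common point of the two segments. *)
Lemma side_sign_lt t1 t2 : 0 <= t1 <= 1 -> 0 <= t2 <= 1 ->
  p.2 <= sy t1 <= q.2 -> p.2 <= sy t2 <= q.2 -> 0 < E t1 -> 0 < E t2.
Proof.
move=> h1 h2 b1 b2 e1; have [//|e2] := Rlt_le_dec 0 (E t2); exfalso.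
pose k := E t1 / (E t1 - E t2).
have hk : 0 <= k <= 1.
  split; first by apply: Rle_mult_inv_pos; lra.
  by apply: (Rmult_le_reg_r (E t1 - E t2)); rewrite /k; [lra|field_simplify; lra].
pose t3 := t1 + k * (t2 - t1).
have h3 : 0 <= t3 <= 1 by rewrite /t3; nra.
have E3 : E t3 = 0.
  have -> : E t3 = E t1 + k * (E t2 - E t1) by rewrite /E /t3 /sx /sy; ring.
  by rewrite /k; field; lra.
have b3 : p.2 <= sy t3 <= q.2.
  have -> : sy t3 = sy t1 + k * (sy t2 - sy t1) by rewrite /t3 /sy; ring.
  by nra.
apply: (disj (r := (sx t3, sy t3))); last by exists t3.
exists ((sy t3 - p.2) / (q.2 - p.2)); split.
  split; first by apply: Rle_mult_inv_pos; lra.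
  by apply: (Rmult_le_reg_r (q.2 - p.2)); [lra|field_simplify; lra].
have hx : sx t3 = p.1 + (sy t3 - p.2) * (q.1 - p.1) / (q.2 - p.2).
  by apply: (Rmult_eq_reg_r (q.2 - p.2)); [field_simplify; [rewrite /E in E3; lra|lra]|lra].
by rewrite {1}hx; f_equal; field; lra.
Qed.

Lemma side_sign t1 t2 : 0 <= t1 <= 1 -> 0 <= t2 <= 1 ->
  p.2 <= sy t1 <= q.2 -> p.2 <= sy t2 <= q.2 -> Rltb 0 (E t1) = Rltb 0 (E t2).
Proof. by move=> *; apply: Rltb_iff; split; apply: side_sign_lt. Qed.

Definition crR (r : R * R) : bool :=
  (Rltb r.2 A.2 != Rltb r.2 B.2) &&
  Rltb r.1 (A.1 + (r.2 - A.2) * (B.1 - A.1) / (B.2 - A.2)).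

(** A vertex in the half-open strip p.2 < y <= q.2, to the right of the line pq. The convention
    matches that of [crosses], so that the change of the crossing of a side between p and q is the
    difference of this function at its two ends, and these differences cancel around the polygon. *)
Definition cross_corner (v : R * R) : bool :=
  [&& Rltb p.2 v.2, ~~ Rltb q.2 v.2 &
   Rltb (p.1 * (q.2 - p.2) + (v.2 - p.2) * (q.1 - p.1)) (v.1 * (q.2 - p.2))].

Lemma cross_level y : Rltb y A.2 != Rltb y B.2 ->
  exists t, [/\ 0 <= t <= 1, sy t = y & A.1 + (y - A.2) * (B.1 - A.1) / (B.2 - A.2) = sx t].
Proof.
move=> h.
have hAB : (A.2 <= y < B.2) \/ (B.2 <= y < A.2).
  by move: h; case: RltbP; case: RltbP => // *; [right|left]; lra.
exists ((y - A.2) / (B.2 - A.2)); split; last 2 first.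
- by rewrite /sy; field; lra.
- by rewrite /sx; field; lra.
case: hAB => hAB.
  split; first by apply: Rle_mult_inv_pos; lra.
  by apply: (Rmult_le_reg_r (B.2 - A.2)); [lra|field_simplify; lra].
have -> : (y - A.2) / (B.2 - A.2) = (A.2 - y) / (A.2 - B.2) by field; lra.
split; first by apply: Rle_mult_inv_pos; lra.
by apply: (Rmult_le_reg_r (A.2 - B.2)); [lra|field_simplify; lra].
Qed.

Lemma cross_p : Rltb p.2 A.2 != Rltb p.2 B.2 ->
  exists t, [/\ 0 <= t <= 1, sy t = p.2 & crR p = Rltb 0 (E t)].
Proof.
move=> h; have [t [ht e1 e2]] := cross_level h.
exists t; split=> //; rewrite /crR h e2 /= /E e1; apply: Rltb_iff; split; nra.
Qed.

Lemma cross_q : Rltb q.2 A.2 != Rltb q.2 B.2 ->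
  exists t, [/\ 0 <= t <= 1, sy t = q.2 & crR q = Rltb 0 (E t)].
Proof.
move=> h; have [t [ht e1 e2]] := cross_level h.
exists t; split=> //; rewrite /crR h e2 /= /E e1; apply: Rltb_iff; split; nra.
Qed.

(** For given heights of A and B, either none or exactly two of the four indicators are active. The
    active ones read off the sign of [E] at points of the side within the strip, so they agree by
    [side_sign] and cancel. *)
Lemma cross_side : crR p (+) crR q = cross_corner A (+) cross_corner B.
Proof.
have cA : Rltb p.2 A.2 -> ~~ Rltb q.2 A.2 ->
  [/\ p.2 <= sy 0 <= q.2 & cross_corner A = Rltb 0 (E 0)].
  move=> h1 h2; rewrite /cross_corner h1 h2 /=; move/RltbP: h1; move/RltbP: h2.
  by rewrite /E /sx /sy => h2 h1; split; first lra; apply: Rltb_iff; lra.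
have cB : Rltb p.2 B.2 -> ~~ Rltb q.2 B.2 ->
  [/\ p.2 <= sy 1 <= q.2 & cross_corner B = Rltb 0 (E 1)].
  move=> h1 h2; rewrite /cross_corner h1 h2 /=; move/RltbP: h1; move/RltbP: h2.
  by rewrite /E /sx /sy => h2 h1; split; first lra; apply: Rltb_iff; lra.
have mono v : Rltb q.2 v -> Rltb p.2 v by move=> /RltbP h; apply/RltbP; lra.
have {mono} [mA mB] := (mono A.2, mono B.2).
have P0 : Rltb p.2 A.2 = Rltb p.2 B.2 -> crR p = false by rewrite /crR => ->; rewrite eqxx.
have Q0 : Rltb q.2 A.2 = Rltb q.2 B.2 -> crR q = false by rewrite /crR => ->; rewrite eqxx.
have A0 : Rltb p.2 A.2 = Rltb q.2 A.2 -> cross_corner A = false.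
  by rewrite /cross_corner => ->; case: (Rltb q.2 A.2).
have B0 : Rltb p.2 B.2 = Rltb q.2 B.2 -> cross_corner B = false.
  by rewrite /cross_corner => ->; case: (Rltb q.2 B.2).
have I0 : 0 <= 0 <= 1 by lra.
have I1 : 0 <= 1 <= 1 by lra.
have S := side_sign; have pq' := Rlt_le _ _ pq.
have Ip y : y = p.2 -> p.2 <= y <= q.2 by lra.
have Iq y : y = q.2 -> p.2 <= y <= q.2 by lra.
move: cross_p cross_q P0 Q0 A0 B0 cA cB mA mB.
case: (Rltb p.2 A.2); case: (Rltb p.2 B.2); case: (Rltb q.2 A.2); case: (Rltb q.2 B.2) => //=;
  move=> Cp Cq P0 Q0 A0 B0 cA cB mA mB;
  try (by have := mA isT); try (by have := mB isT);
  (try have [tp [Ip0 /Ip Ipp ->]] := Cp isT);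
  (try have [tq [Iq0 /Iq Iqq ->]] := Cq isT);
  (try have {P0}-> := P0 erefl); (try have {Q0}-> := Q0 erefl);
  (try have {A0}-> := A0 erefl); (try have {B0}-> := B0 erefl);
  (try have [bA ->] := cA isT isT); (try have [bB ->] := cB isT isT).
all: rewrite ?addbF ?addFb //.
all: try (by apply: S).
all: by match goal with |- context [Rltb 0 (E ?a) (+) Rltb 0 (E ?b)] =>
  rewrite (S a b) ?addbb end.
Qed.

End CrossSide.

Section Parity.
Variable n : nat.
Variable V : seq (pt n).

Lemma crossesE (p : R * R) (s : pt n * pt n) : crosses p s = crR (rp s.1) (rp s.2) p.
Proof. by []. Qed.

Lemma odd_countE (T : Type) (f : pred T) (s : seq T) :
  odd (count f s) = \big[addb/false]_(x <- s) f x.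
Proof.
elim: s => [|x s IH]; first by rewrite big_nil.
by rewrite big_cons /= oddD IH oddb.
Qed.

(** Each vertex starts exactly one side and ends exactly one, so its value is added twice. *)
Lemma sides_telescope (f : pt n -> bool) :
  \big[addb/false]_(s <- sides V) (f s.1 (+) f s.2) = false.
Proof.
rewrite big_split /=.
have -> : \big[addb/false]_(s <- sides V) f s.1 = \big[addb/false]_(v <- V) f v.
  by rewrite -(big_map fst xpredT f) -/unzip1 unzip1_zip // size_rot.
have -> : \big[addb/false]_(s <- sides V) f s.2 = \big[addb/false]_(v <- V) f v.
  rewrite -(big_map snd xpredT f) -/unzip2 unzip2_zip ?size_rot //.
  by apply: perm_big; rewrite perm_rot.
by rewrite addbb.
Qed.

Lemma parity_lt p q : p.2 < q.2 -> (forall r, cseg p q r -> ~ on_boundary V r) ->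
  odd (count (crosses p) (sides V)) = odd (count (crosses q) (sides V)).
Proof.
move=> pq h.
suff : odd (count (crosses p) (sides V)) (+) odd (count (crosses q) (sides V)) = false.
  by case: odd; case: odd.
rewrite !odd_countE -big_split /=.
rewrite -[RHS](sides_telescope (fun v => cross_corner p q (rp v))).
apply: eq_big_seq => s hs /=.
rewrite !crossesE; apply: cross_side => // r h1 h2.
by apply: (h r) => //; exists s.
Qed.

Lemma parity_eq p q : p.2 = q.2 -> (forall r, cseg p q r -> ~ on_boundary V r) ->
  odd (count (crosses p) (sides V)) = odd (count (crosses q) (sides V)).
Proof.
move=> pq h; congr odd; apply: eq_in_count => s hs.
rewrite !crossesE /crR -pq.
case E : (Rltb p.2 (rp s.1).2 != Rltb p.2 (rp s.2).2); rewrite ?andFb ?andTb //.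
have [t [ht e1 e2]] := cross_level (A := rp s.1) (B := rp s.2) E.
set x := (rp s.1).1 + _ in e2 *.
have hb : on_boundary V (x, p.2).
  by exists s; split=> //; exists t; split=> //; rewrite e2 e1.
have hc : ~ cseg p q (x, p.2) by move=> hc; apply: (h _ hc).
apply: Rltb_iff; split=> hx; apply: NNPP => hn; apply: hc.
  exists ((x - p.1) / (q.1 - p.1)); split.
    split; first by apply: Rle_mult_inv_pos; lra.
    by apply: (Rmult_le_reg_r (q.1 - p.1)); [lra|field_simplify; lra].
  by f_equal; rewrite -?pq; field; lra.
exists ((p.1 - x) / (p.1 - q.1)); split.
  split; first by apply: Rle_mult_inv_pos; lra.
  by apply: (Rmult_le_reg_r (p.1 - q.1)); [lra|field_simplify; lra].
by f_equal; rewrite -?pq; field; lra.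
Qed.

Lemma parity p q : (forall r, cseg p q r -> ~ on_boundary V r) ->
  odd (count (crosses p) (sides V)) = odd (count (crosses q) (sides V)).
Proof.
move=> h; have [lt|[eq|gt]] := Rtotal_order p.2 q.2.
- exact: parity_lt.
- exact: parity_eq.
- by symmetry; apply: parity_lt => // r /cseg_sym; apply: h.
Qed.

(** Crossing parity enters the planar arguments through this transport of membership along a segment
    that avoids the boundary. *)
Lemma inP_cseg p q : inP V p -> (forall r, cseg p q r -> ~ on_boundary V r) -> inP V q.
Proof.
move=> hp h; right; rewrite -(parity h); case: hp => // hb.
case: (h p) => //; exists 0; split; first by lra.
by case: p {h} hb => x y _ /=; f_equal; ring.
Qed.

End Parity.

(** * Segments and empty lattice triangles *)

(** The x and y are barycentric coordinates of the start and the end of a segment leaving a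
    triangle; k is the earliest time at which a coordinate that turns negative vanishes. *)
Lemma exit3 x1 x2 x3 y1 y2 y3 : 0 <= x1 -> 0 <= x2 -> 0 <= x3 ->
  ~ (0 <= y1 /\ 0 <= y2 /\ 0 <= y3) ->
  exists k, 0 <= k < 1 /\
    [/\ 0 <= x1 + k * (y1 - x1), 0 <= x2 + k * (y2 - x2) & 0 <= x3 + k * (y3 - x3)] /\
    [\/ y1 < 0 /\ x1 + k * (y1 - x1) = 0, y2 < 0 /\ x2 + k * (y2 - x2) = 0 |
        y3 < 0 /\ x3 + k * (y3 - x3) = 0].
Proof.
move=> h1 h2 h3 hn.
have K x y : 0 <= x -> exists k, [/\ 0 <= k <= 1,
    forall k', 0 <= k' <= k -> 0 <= x + k' * (y - x),
    (0 <= y -> k = 1) & (y < 0 -> k < 1 /\ x + k * (y - x) = 0)].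
  move=> hx; have [hy|hy] := Rle_lt_dec 0 y.
    by exists 1; split=> [|k' hk'|_|hy']; [lra|nra|lra|lra].
  exists (x / (x - y)).
  have e : x / (x - y) * (x - y) = x by field; lra.
  have b1 : 0 <= x / (x - y) by apply: Rle_mult_inv_pos; lra.
  have b2 : x / (x - y) < 1 by apply: (Rmult_lt_reg_r (x - y)); lra.
  split=> [|k' hk'|hy'|_]; [lra|nra|lra|split; [lra|nra]].
have [k1 [a1 b1 c1 d1]] := K _ y1 h1.
have [k2 [a2 b2 c2 d2]] := K _ y2 h2.
have [k3 [a3 b3 c3 d3]] := K _ y3 h3.
have [n1|n1] := Rlt_le_dec y1 0; have [n2|n2] := Rlt_le_dec y2 0;
  have [n3|n3] := Rlt_le_dec y3 0; try (by case: hn);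
  (try have [? ?] := d1 n1); (try have [? ?] := d2 n2); (try have [? ?] := d3 n3);
  (try have ? := c1 n1); (try have ? := c2 n2); (try have ? := c3 n3);
  have [l12|l12] := Rle_lt_dec k1 k2; have [l13|l13] := Rle_lt_dec k1 k3;
  have [l23|l23] := Rle_lt_dec k2 k3; try lra;
  solve [exists k1; split; [lra|split; [split; [apply: b1|apply: b2|apply: b3]; lra|by constructor 1]]
   | exists k2; split; [lra|split; [split; [apply: b1|apply: b2|apply: b3]; lra|by constructor 2]]
   | exists k3; split; [lra|split; [split; [apply: b1|apply: b2|apply: b3]; lra|by constructor 3]]].
Qed.

Lemma collinear_param (A B C : R * R) : A <> B -> det A B C = 0 ->
  exists s, C = (A.1 + s * (B.1 - A.1), A.2 + s * (B.2 - A.2)).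
Proof.
case: A B C => [a a'] [b b'] [c c']; rewrite /det /= => ne h.
have [e|d] := Req_dec a b.
  have d' : b' - a' <> 0 by move=> e'; apply: ne; f_equal; lra.
  exists ((c' - a') / (b' - a')); f_equal; last by field.
  apply: (Rmult_eq_reg_r (b' - a')) => //.
  by rewrite -e; rewrite -e in h; nra.
have d' : b - a <> 0 by lra.
exists ((c - a) / (b - a)); f_equal; first by field.
by apply: (Rmult_eq_reg_r (b - a)) => //; field_simplify; [nra|].
Qed.

Section Edges.
Variable n : nat.
Variable V : seq (pt n).
Implicit Types (a b c d z : pt n) (e f g h : edge n) (T : {set edge n}).

Definition prim a b := forall z, Lam0 V z -> ~ oseg (rp a) (rp b) (rp z).

Lemma prim_sym a b : prim a b -> prim b a.
Proof. by move=> h z hz /oseg_sym; apply: h. Qed.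

Lemma adm_set2 a b : admissible V [set a; b] <->
  [/\ a != b, Lam0 V a, Lam0 V b & (forall p, oseg (rp a) (rp b) p -> inP V p)] /\ prim a b.
Proof.
split.
  move=> [[c [d [e [cd [hc [hd hin]]]]]] hz].
  have hp : prim c d by move=> z lz hs; apply: (hz z) => //; exists c, d.
  have [[-> ->]|[-> ->]] := set2_eq e; split=> //.
    by rewrite eq_sym; split=> // p /oseg_sym; apply: hin.
  exact: prim_sym.
move=> [[ab la lb hin] hp]; split; first by exists a, b.
by move=> z lz /segpt_set2 [_]; apply: hp.
Qed.

Lemma adm_ex e : admissible V e -> exists a b, e = [set a; b] /\ a != b.
Proof. by move=> [[a [b [-> [ab _]]]] _]; exists a, b. Qed.

Lemma rp_neq a b : a != b -> rp a <> rp b.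
Proof. by move=> /eqP ab /rp_inj. Qed.

(** If c is off the line ab, the common point puts d strictly on the other side. If all four points
    are collinear, neither segment contains an endpoint of the other in its interior, and
    overlapping segments of this kind coincide. *)
Lemma segs_straddle a b c d p : a != b -> c != d -> Lam0 V a -> Lam0 V b ->
  Lam0 V c -> Lam0 V d -> prim a b -> prim c d ->
  oseg (rp a) (rp b) p -> oseg (rp c) (rp d) p -> [set a; b] <> [set c; d] ->
  det (rp a) (rp b) (rp c) * det (rp a) (rp b) (rp d) < 0.
Proof.
move=> ab cd la lb lc ld pab pcd [tau [htau e1]] [t [ht e2]] ne.
have E : (1 - t) * det (rp a) (rp b) (rp c) + t * det (rp a) (rp b) (rp d) = 0.
  have -> : (1 - t) * det (rp a) (rp b) (rp c) + t * det (rp a) (rp b) (rp d) =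
    det (rp a) (rp b) p by rewrite e2 /det /=; ring.
  by rewrite e1 /det /=; ring.
have [C0|C0] := Req_dec (det (rp a) (rp b) (rp c)) 0; last first.
  have := Rsqr_pos_lt _ C0; rewrite /Rsqr; move: (det _ _ (rp c)) (det _ _ (rp d)) E C0 => C D E _ hC.
  have : C * ((1 - t) * C + t * D) = 0 by rewrite E; ring.
  by nra.
have D0 : det (rp a) (rp b) (rp d) = 0 by rewrite C0 in E; nra.
exfalso.
have [s es] := collinear_param (rp_neq ab) C0.
have [s' es'] := collinear_param (rp_neq ab) D0.
have hs : ~ 0 < s < 1 by move=> hs; apply: (pab c lc); exists s.
have hs' : ~ 0 < s' < 1 by move=> h'; apply: (pab d ld); exists s'.
have tE : tau = s + t * (s' - s).
  have : (rp a).1 <> (rp b).1 \/ (rp a).2 <> (rp b).2.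
    have := rp_neq ab; case: (rp a) (rp b) => [x y] [x' y'] /= ne'.
    have [ex|] := Req_dec x x'; last by left.
    by right=> ey; apply: ne'; rewrite ex ey.
  move: e2; rewrite e1 es es' /= => [] [q1 q2].
  case=> q.
    by apply: (Rmult_eq_reg_r (IZR (px b) - IZR (px a))); [lra|move=> ?; apply: q => /=; lra].
  by apply: (Rmult_eq_reg_r (IZR (py b) - IZR (py a))); [lra|move=> ?; apply: q => /=; lra].
have ka m : 0 < m < 1 -> s + m * (s' - s) <> 0.
  move=> hm em; apply: (pcd a la); exists m; split=> //; rewrite es es'.
  rewrite [LHS]surjective_pairing /=; f_equal.
    transitivity ((rp a).1 + (s + m * (s' - s)) * ((rp b).1 - (rp a).1)); [rewrite em /=; ring|rewrite /=; ring].
  transitivity ((rp a).2 + (s + m * (s' - s)) * ((rp b).2 - (rp a).2)); [rewrite em /=; ring|rewrite /=; ring].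
have kb m : 0 < m < 1 -> s + m * (s' - s) <> 1.
  move=> hm em; apply: (pcd b lb); exists m; split=> //; rewrite es es'.
  rewrite [LHS]surjective_pairing /=; f_equal.
    transitivity ((rp a).1 + (s + m * (s' - s)) * ((rp b).1 - (rp a).1)); [rewrite em /=; ring|rewrite /=; ring].
  transitivity ((rp a).2 + (s + m * (s' - s)) * ((rp b).2 - (rp a).2)); [rewrite em /=; ring|rewrite /=; ring].
have div x y : 0 < x < y -> 0 < x / y < 1 /\ x / y * y = x.
  move=> hxy; have e : x / y * y = x by field; lra.
  split=> //; split; first by apply: Rdiv_lt_0_compat; lra.
  by apply: (Rmult_lt_reg_r y); lra.
(* [s] and [s'] are the positions of c and d along ab. Both avoid the open interval from 0 to 1,
   neither 0 nor 1 lies strictly between them, but the common point does; so they are 0 and 1. *)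
have key : (s = 0 /\ s' = 1) \/ (s = 1 /\ s' = 0).
  have [l|l] := Rle_lt_dec s 0.
    have s1 : 1 <= s' by apply: Rnot_lt_le => l'; apply: hs'; nra.
    left; split.
      apply: Rle_antisym => //; apply: Rnot_lt_le => l'.
      have [//|m me] := div (- s) (s' - s); first by lra.
      by apply: (ka _ m); nra.
    apply: Rle_antisym => //; apply: Rnot_lt_le => l'.
    have [//|m me] := div (1 - s) (s' - s); first by lra.
    by apply: (kb _ m); nra.
  have l1 : 1 <= s by apply: Rnot_lt_le => l'; apply: hs; lra.
  have l2 : s' <= 0 by apply: Rnot_lt_le => l'; apply: hs'; nra.
  right; split.
    apply: Rle_antisym => //; apply: Rnot_lt_le => l'.
    have [//|m me] := div (s - 1) (s - s'); first by lra.
    by apply: (kb _ m); nra.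
  apply: Rle_antisym => //; apply: Rnot_lt_le => l'.
  have [//|m me] := div s (s - s'); first by lra.
  by apply: (ka _ m); nra.
have P0 : forall A B : R * R, (A.1 + 0 * (B.1 - A.1), A.2 + 0 * (B.2 - A.2)) = A.
  by move=> [x y] [x' y'] /=; f_equal; ring.
have P1 : forall A B : R * R, (A.1 + 1 * (B.1 - A.1), A.2 + 1 * (B.2 - A.2)) = B.
  by move=> [x y] [x' y'] /=; f_equal; ring.
apply: ne; case: key => [] [e e']; rewrite e ?P0 ?P1 in es; rewrite e' ?P0 ?P1 in es';
  rewrite (rp_inj es) (rp_inj es') //; exact: setUC.
Qed.

(** Emptiness refers to [Lam0] only, so such a triangle may a priori stick out of the polygon;
    containment is proved separately. *)
Definition etri a b c : Prop := [/\ orient a b c <> 0%Z, Lam0 V a, Lam0 V b, Lam0 V c &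
  forall z, Lam0 V z -> in_ctri a b c z -> z = a \/ z = b \/ z = c].

Lemma in_ctri_aff a b c z s t : orient a b c <> 0%Z -> rp z = aff (rp a) (rp b) (rp c) s t ->
  in_ctri a b c z <-> 0 <= s /\ 0 <= t /\ s + t <= 1.
Proof.
move=> D0 ez.
have D0' : IZR (orient a b c) <> 0 by move=> /eq_IZR.
have e1 : IZR (orient a b z) = t * IZR (orient a b c).
  by rewrite !IZR_orient ez /det /aff /=; ring.
have e2 : IZR (orient b c z) = (1 - s - t) * IZR (orient a b c).
  by rewrite !IZR_orient ez /det /aff /=; ring.
have e3 : IZR (orient c a z) = s * IZR (orient a b c).
  by rewrite !IZR_orient ez /det /aff /=; ring.
split.
  move=> [[/IZR_le h1 [/IZR_le h2 /IZR_le h3]]|[/IZR_le h1 [/IZR_le h2 /IZR_le h3]]];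
  rewrite e1 e2 e3 in h1 h2 h3; repeat split; nra.
move=> [hs [ht hst]].
have [pos|neg] := Rlt_le_dec 0 (IZR (orient a b c)).
  by left; split; [|split]; apply: le_IZR; rewrite ?e1 ?e2 ?e3; nra.
by right; split; [|split]; apply: le_IZR; rewrite ?e1 ?e2 ?e3; nra.
Qed.

Lemma rp_aff a b c z : orient a b c <> 0%Z -> exists s t, rp z = aff (rp a) (rp b) (rp c) s t.
Proof. by move=> /orient_neq0 [_ _ _ h]; apply: aff_surj. Qed.

Section Tri.
Variables a b c : pt n.
Hypothesis habc : etri a b c.
Let D0 : orient a b c <> 0%Z. Proof. by case: habc. Qed.
Let D0' : det (rp a) (rp b) (rp c) <> 0. Proof. by case: (orient_neq0 D0). Qed.
Local Notation af := (aff (rp a) (rp b) (rp c)).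

Lemma oseg_ab s t : oseg (rp a) (rp b) (af s t) <-> t = 0 /\ 0 < s < 1.
Proof.
rewrite {1}(aff00 (rp a) (rp b) (rp c)) {2}(aff10 (rp a) (rp b) (rp c)); split.
  by move=> /(oseg_affE D0') [k [hk [-> ->]]]; split; lra.
move=> [-> hs]; have := oseg_aff (rp a) (rp b) (rp c) 0 0 1 0 hs.
by rewrite !Rminus_0_r !Rplus_0_l Rmult_1_r Rmult_0_r.
Qed.

Lemma oseg_ac s t : oseg (rp a) (rp c) (af s t) <-> s = 0 /\ 0 < t < 1.
Proof.
rewrite {1}(aff00 (rp a) (rp b) (rp c)) {2}(aff01 (rp a) (rp b) (rp c)); split.
  by move=> /(oseg_affE D0') [k [hk [-> ->]]]; split; lra.
move=> [-> hs]; have := oseg_aff (rp a) (rp b) (rp c) 0 0 0 1 hs.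
by rewrite !Rminus_0_r !Rplus_0_l Rmult_1_r Rmult_0_r.
Qed.

Lemma oseg_bc s t : oseg (rp b) (rp c) (af s t) <-> s + t = 1 /\ 0 < t < 1.
Proof.
rewrite {1}(aff10 (rp a) (rp b) (rp c)) {2}(aff01 (rp a) (rp b) (rp c)); split.
  by move=> /(oseg_affE D0') [k [hk [-> ->]]]; split; lra.
move=> [e hs]; have := oseg_aff (rp a) (rp b) (rp c) 1 0 0 1 hs.
have -> : s = 1 + t * (0 - 1) by lra. by rewrite !Rminus_0_r !Rplus_0_l Rmult_1_r.
Qed.

(** An endpoint inside the closed triangle is a vertex by emptiness. Otherwise primitivity of z1 z2
    excludes leaving through a vertex, and the last inequality of each case says that z2 lies beyond
    the side that is crossed. *)
Lemma exit_tri z1 z2 s0 t0 s1 t1 : Lam0 V z2 -> prim z1 z2 ->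
  oseg (rp z1) (rp z2) (af s0 t0) -> 0 <= s0 -> 0 <= t0 -> s0 + t0 <= 1 ->
  rp z2 = af s1 t1 ->
  (z2 = a \/ z2 = b \/ z2 = c) \/
  exists k, 0 <= k < 1 /\ exists s t, s = s0 + k * (s1 - s0) /\ t = t0 + k * (t1 - t0) /\
    oseg (rp z1) (rp z2) (af s t) /\
    [\/ [/\ s = 0, 0 < t < 1 & s1 < 0], [/\ t = 0, 0 < s < 1 & t1 < 0] |
        [/\ s + t = 1, 0 < s < 1 & 1 < s1 + t1]].
Proof.
move=> lz2 pz op hs0 ht0 hst0 e2; have [_ la lb lc emp] := habc.
have [hin|hout] := classic (0 <= s1 /\ 0 <= t1 /\ 0 <= 1 - s1 - t1).
  by left; apply: emp => //; apply/(in_ctri_aff D0 e2); repeat split; lra.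
have h3 : 0 <= 1 - s0 - t0 by lra.
right; have [k [hk [[A1 A2 A3] B]]] := exit3 hs0 ht0 h3 hout.
exists k; split=> //; exists (s0 + k * (s1 - s0)), (t0 + k * (t1 - t0)).
have hos : oseg (rp z1) (rp z2) (af (s0 + k * (s1 - s0)) (t0 + k * (t1 - t0))).
  have [t [ht et]] := op.
  exists (t + k * (1 - t)); split; first by nra.
  by rewrite -aff_mix -e2 et /=; f_equal; ring.
do 3!(split=> //).
have na : ~ (s0 + k * (s1 - s0) = 0 /\ t0 + k * (t1 - t0) = 0).
  move=> [q1 q2]; apply: (pz a la); rewrite (aff00 (rp a) (rp b) (rp c)); by rewrite q1 q2 in hos.
have nb : ~ (s0 + k * (s1 - s0) = 1 /\ t0 + k * (t1 - t0) = 0).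
  move=> [q1 q2]; apply: (pz b lb); rewrite (aff10 (rp a) (rp b) (rp c)); by rewrite q1 q2 in hos.
have nc : ~ (s0 + k * (s1 - s0) = 0 /\ t0 + k * (t1 - t0) = 1).
  move=> [q1 q2]; apply: (pz c lc); rewrite (aff01 (rp a) (rp b) (rp c)); by rewrite q1 q2 in hos.
have A3' : s0 + k * (s1 - s0) + (t0 + k * (t1 - t0)) <= 1 by lra.
case: B => [] [B1 B2].
- constructor 1; split=> //; split.
    by case: A2 => // q; case: na.
  by case: (Rle_lt_or_eq_dec (t0 + k * (t1 - t0)) 1) => // [|q]; [lra|case: nc].
- constructor 2; split=> //; split.
    by case: A1 => // q; case: na.
  by case: (Rle_lt_or_eq_dec (s0 + k * (s1 - s0)) 1) => // [|q]; [lra|case: nb].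
- constructor 3; split; [lra| |lra]; split.
    by case: A1 => // q; case: nc; split; lra.
  by case: (Rle_lt_or_eq_dec (s0 + k * (s1 - s0)) 1) => // [|q]; [lra|case: nb; split; lra].
Qed.

End Tri.

End Edges.

(** * Triangles of a set of disjoint edges *)

Section Planar.
Variable n : nat.
Variable V : seq (pt n).
Implicit Types (a b c d z : pt n) (e f g h : edge n) (T : {set edge n}).

Definition planar T : Prop :=
  (forall e, e \in T -> admissible V e) /\
  (forall e f, e \in T -> f \in T -> e != f -> ~ meet e f).

Lemma tri_swap T a b c : tri V T a b c -> tri V T b a c.
Proof.
move=> [h1 [h2 [h3 [h4 h5]]]]; split; first by rewrite set2C.
do 2!split=> //; split; first by rewrite orient_swap; lia.
move=> z lz hz; case: (h5 z lz); last by tauto.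
  by move: hz; rewrite /in_ctri /orient; lia.
by tauto.
Qed.

Lemma tri_rot T a b c : tri V T a b c -> tri V T b c a.
Proof.
move=> [h1 [h2 [h3 [h4 h5]]]]; split=> //; split; first by rewrite set2C.
split; first by rewrite set2C.
split; first by rewrite orient_rot.
by move=> z lz hz; case: (h5 z lz); [move: hz; rewrite /in_ctri; tauto|tauto|tauto].
Qed.

Lemma tri_etri T a b c : planar T -> tri V T a b c -> etri V a b c.
Proof.
move=> [adm _] [h1 [h2 [h3 [h4 h5]]]].
have /adm_set2[[_ la lb _] _] := adm _ h1.
have /adm_set2[[_ _ lc _] _] := adm _ h2.
by split.
Qed.

Lemma meet_eq T e f p : planar T -> e \in T -> f \in T -> segpt e p -> segpt f p -> e = f.
Proof.
move=> [_ dis] he hf hep hfp; apply/eqP; apply: contraT => ne.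
by case: (dis _ _ he hf ne); exists p.
Qed.

Section Tri.
Variables (T : {set edge n}) (a b c : pt n).
Hypothesis pl : planar T.
Hypothesis tr : tri V T a b c.
Let et := tri_etri pl tr.
Let D0 : orient a b c <> 0%Z. Proof. by case: et. Qed.
Let D0' : det (rp a) (rp b) (rp c) <> 0. Proof. by case: (orient_neq0 D0). Qed.
Local Notation af := (aff (rp a) (rp b) (rp c)).

Let ab : a != b. Proof. by case: (orient_neq0 D0). Qed.
Let bc : b != c. Proof. by case: (orient_neq0 D0). Qed.
Let ac : a != c. Proof. by case: (orient_neq0 D0). Qed.

(** Followed in both directions, an edge through an interior point cannot cross the three sides,
    which belong to [T]. So it ends at a vertex both ways and would itself be a side. *)
Lemma tri_interior_free h s t : h \in T -> segpt h (af s t) ->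
  0 < s -> 0 < t -> s + t < 1 -> False.
Proof.
move=> hT hp s0 t0 st.
have [h1 [h2 [h3 _]]] := tr.
have nab : h <> [set a; b].
  by move=> eh; move: hp; rewrite eh => /segpt_set2 [_] /(oseg_ab et); lra.
have nbc : h <> [set b; c].
  by move=> eh; move: hp; rewrite eh => /segpt_set2 [_] /(oseg_bc et); lra.
have nac : h <> [set a; c].
  by move=> eh; move: hp; rewrite eh => /segpt_set2 [_] /(oseg_ac et); lra.
have adm := proj1 pl _ hT; have [z1 [z2 [eh z12]]] := adm_ex adm.
rewrite eh in adm hp hT nab nbc nac; have /adm_set2 [[_ l1 l2 _] pz] := adm.
have /segpt_set2 [_ op] := hp.
have key w1 w2 : w1 != w2 -> [set z1; z2] = [set w1; w2] -> Lam0 V w2 -> prim V w1 w2 -> oseg (rp w1) (rp w2) (af s t) ->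
    w2 = a \/ w2 = b \/ w2 = c.
  move=> w12 ew lw pw ow; have [s1 [t1 ew2]] := rp_aff w2 D0.
  have [//|[k [hk [s' [t' [e1 [e2 [ok cs]]]]]]]] :=
    exit_tri et lw pw ow (Rlt_le _ _ s0) (Rlt_le _ _ t0) (Rlt_le _ _ st) ew2.
  have sp : segpt [set z1; z2] (af s' t').
    by rewrite ew; apply/segpt_set2.
  exfalso; case: cs => [] [c1 c2 c3].
  - apply: nac; apply: (meet_eq pl hT h3 sp); apply/segpt_set2; split=> //.
    by apply/(oseg_ac et).
  - apply: nab; apply: (meet_eq pl hT h1 sp); apply/segpt_set2; split=> //.
    by apply/(oseg_ab et).
  - apply: nbc; apply: (meet_eq pl hT h2 sp); apply/segpt_set2; split=> //.
    by apply/(oseg_bc et); lra.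
have k2 := key z1 z2 z12 erefl l2 pz op.
rewrite eq_sym in z12.
have k1 := key z2 z1 z12 (set2C _ _) l1 (prim_sym pz) (oseg_sym op).
case: k1 => [|[|]] q1; case: k2 => [|[|]] q2; subst z1 z2; try (by rewrite eqxx in z12);
  first [by apply: nab | by apply: nbc | by apply: nac
        |by apply: nab; rewrite set2C|by apply: nbc; rewrite set2C|by apply: nac; rewrite set2C].
Qed.

End Tri.

(** Locate c' in the coordinates of abc. Inside the triangle it is c by emptiness. Otherwise ac'
    crosses bc, or bc' crosses ac, or c lies on one of these two segments or in the triangle abc';
    each is excluded by disjointness, primitivity or emptiness. *)
Lemma tri_unique T a b c c' : planar T -> tri V T a b c -> tri V T a b c' ->
  (0 < orient a b c * orient a b c')%Z -> c = c'.
Proof.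
move=> pl tr tr' same.
have et := tri_etri pl tr; have et' := tri_etri pl tr'.
have [D0 la lb lc emp] := et; have [D0x _ _ lc' emp'] := et'.
have [ab bc ac D0'] := orient_neq0 D0.
have [_ bc' ac' _] := orient_neq0 D0x.
have [s [t e]] := rp_aff c' D0.
have tpos : 0 < t.
  have : IZR (orient a b c') = t * IZR (orient a b c).
    by rewrite !IZR_orient e /det /aff /=; ring.
  move: same => /IZR_lt; rewrite mult_IZR => h q; rewrite q in h.
  by nra.
have [hin|hout] := classic (0 <= s /\ s + t <= 1).
  have : in_ctri a b c c' by apply/(in_ctri_aff D0 e); lra.
  move/(emp _ lc') => [q|[q|//]]; move: D0x; rewrite -?q /orient; lia.
have [h1 [h2 [h3 _]]] := tr; have [_ [h2' [h3' _]]] := tr'.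
have /adm_set2 [_ pbc'] := proj1 pl _ h2'.
have /adm_set2 [_ pac'] := proj1 pl _ h3'.
have [gt|le] := Rlt_le_dec 1 (s + t).
  have [k [hk ek]] : exists k, 0 < k < 1 /\ k * (s + t) = 1.
    exists (/ (s + t)); split; last by field; lra.
    split; first by apply: Rinv_0_lt_compat; lra.
    by rewrite -Rinv_1; apply: Rinv_lt_contravar; lra.
  have ok : oseg (rp a) (rp c') (aff (rp a) (rp b) (rp c) (k * s) (k * t)).
    by rewrite e; exists k; split=> //; rewrite /aff /=; f_equal; ring.
  have [spos|] := Rlt_le_dec 0 s.
    have q : [set b; c] = [set a; c'].
      apply: (meet_eq pl h2 h3' (p := aff (rp a) (rp b) (rp c) (k * s) (k * t)));
        apply/segpt_set2; split=> //.
      by apply/(oseg_bc et); nra.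
    by case: (set2_eq q) => [] [q1 q2]; [rewrite q1 eqxx in ab|rewrite q2 eqxx in ac].
  case=> [sneg|s0]; last first.
    exfalso; apply: (pac' c lc); rewrite {1}(aff01 (rp a) (rp b) (rp c)).
    by move: ok; rewrite s0 Rmult_0_r; have -> : k * t = 1 by rewrite s0 in ek; lra.
  have : in_ctri a b c' c.
    have D0y : orient a b c' <> 0%Z by case: et'.
    apply/(in_ctri_aff (s := - s / t) (t := 1 / t) D0y).
      rewrite e [LHS]surjective_pairing /aff /=; f_equal; field; lra.
    have pt' : 0 < / t by apply: Rinv_0_lt_compat.
    split; first by rewrite /Rdiv; nra.
    split; first by rewrite /Rdiv; nra.
    have -> : - s / t + 1 / t = (1 - s) / t by field; lra.
    by apply: (Rmult_le_reg_r t) => //; field_simplify; lra.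
  move/(emp' _ lc) => [q|[q|//]]; by [rewrite q eqxx in ac|rewrite q eqxx in bc].
have sneg : s < 0 by apply: Rnot_le_lt => q; apply: hout; lra.
have [k [hk ek]] : exists k, 0 < k < 1 /\ k * (1 - s) = 1.
  exists (/ (1 - s)); split; last by field; lra.
  split; first by apply: Rinv_0_lt_compat; lra.
  by rewrite -Rinv_1; apply: Rinv_lt_contravar; lra.
have ok : oseg (rp b) (rp c') (aff (rp a) (rp b) (rp c) 0 (k * t)).
  exists k; split=> //; rewrite e /aff /=; f_equal.
    transitivity ((rp a).1 + (1 - k * (1 - s)) * ((rp b).1 - (rp a).1) + k * t * ((rp c).1 - (rp a).1)); [rewrite ek /=; ring|rewrite /=; ring].
  transitivity ((rp a).2 + (1 - k * (1 - s)) * ((rp b).2 - (rp a).2) + k * t * ((rp c).2 - (rp a).2)); [rewrite ek /=; ring|rewrite /=; ring].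
have kt : k * t <= 1 by nra.
case: kt => [kt|kt].
  have q : [set a; c] = [set b; c'].
    apply: (meet_eq pl h3 h2' (p := aff (rp a) (rp b) (rp c) 0 (k * t)));
      apply/segpt_set2; split=> //.
    by apply/(oseg_ac et); nra.
  by case: (set2_eq q) => [] [q1 q2]; [rewrite q1 eqxx in ab|rewrite q2 eqxx in bc].
exfalso; apply: (pbc' c lc); rewrite {1}(aff01 (rp a) (rp b) (rp c)).
by move: ok; rewrite kt.
Qed.

Lemma aff_rpE a b c s t : aff (rp a) (rp b) (rp c) s t =
  (IZR (px a) + s * (IZR (px b) - IZR (px a)) + t * (IZR (px c) - IZR (px a)),
   IZR (py a) + s * (IZR (py b) - IZR (py a)) + t * (IZR (py c) - IZR (py a))).
Proof. by []. Qed.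

(* A basis of the lattice adapted to one side of a non-unimodular triangle produces a further
   lattice point [a + (i (b - a) + (c - a)) / m] in it. *)
Lemma unimodular a b c : etri V a b c ->
  (forall z, in_ctri a b c z -> Lam0 V z) -> Z.abs (orient a b c) = 1%Z.
Proof.
move=> et full; have [D0 la lb lc emp] := et.
apply: NNPP => D1.
have D2 : (2 <= Z.abs (orient a b c))%Z by lia.
have [ab bc ac D0'] := orient_neq0 D0.
have only z s t : rp z = aff (rp a) (rp b) (rp c) s t -> 0 <= s -> 0 <= t -> s + t <= 1 ->
    (s = 0 /\ t = 0) \/ (s = 1 /\ t = 0) \/ (s = 0 /\ t = 1).
  move=> e hs ht hst.
  have hz : in_ctri a b c z by apply/(in_ctri_aff D0 e).
  have := emp _ (full _ hz) hz; case=> [|[|]] q; rewrite q in e.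
  - by left; apply: (aff_inj D0'); rewrite -e -aff00.
  - by right; left; apply: (aff_inj D0'); rewrite -e -aff10.
  - by right; right; apply: (aff_inj D0'); rewrite -e -aff01.
set p1 := (px b - px a)%Z; set p2 := (py b - py a)%Z.
set q1 := (px c - px a)%Z; set q2 := (py c - py a)%Z.
have DE : orient a b c = (p1 * q2 - p2 * q1)%Z by [].
have bxa := px_bd a; have bxb := px_bd b; have bxc := px_bd c.
have bya := py_bd a; have byb := py_bd b; have byc := py_bd c.
have basis : exists w1 w2 x m : Z,
    [/\ (2 <= m)%Z, (q1 = x * p1 + m * w1)%Z & (q2 = x * p2 + m * w2)%Z].
  (* A common divisor g >= 2 of the coordinates of b - a would give the lattice point a + (b - a)/g
     inside a side. *)
  have g1 : Z.gcd p1 p2 = 1%Z.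
    apply: NNPP => g1; set g := Z.gcd p1 p2 in g1.
    have gpos : (0 <= g)%Z by apply: Z.gcd_nonneg.
    have g0 : g <> 0%Z by move=> /Z.gcd_eq_0 [e1 e2]; apply: D0; rewrite DE e1 e2; lia.
    have [k1 e1] : (g | p1)%Z by apply: Z.gcd_divide_l.
    have [k2 e2] : (g | p2)%Z by apply: Z.gcd_divide_r.
    have g2 : (2 <= g)%Z by lia.
    have K k p : (p = k * g)%Z -> (0 <= k <= p)%Z \/ (p <= k <= 0)%Z.
      by move=> ->; have [?|?] := Z_le_gt_dec 0 k; [left|right]; nia.
    have K1 := K _ _ e1; have K2 := K _ _ e2; rewrite /p1 /p2 in K1 K2.
    have [|| z [zx zy]] := @pt_ex n (px a + k1)%Z (py a + k2)%Z; [lia|lia|].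
    have g2R : 2 <= IZR g by apply: IZR_le.
    have := only z (1 / IZR g) 0; case.
    - rewrite aff_rpE /rp zx zy (plus_IZR (px a)) (plus_IZR (py a)); f_equal.
        have -> : IZR (px b) = IZR (px a) + IZR k1 * IZR g.
          by rewrite -mult_IZR -plus_IZR; f_equal; rewrite /p1 in e1; lia.
        by field; lra.
      have -> : IZR (py b) = IZR (py a) + IZR k2 * IZR g.
        by rewrite -mult_IZR -plus_IZR; f_equal; rewrite /p2 in e2; lia.
      by field; lra.
    - by apply: Rle_mult_inv_pos; lra.
    - lra.
    - by rewrite Rplus_0_r; apply: (Rmult_le_reg_r (IZR g)); [lra|field_simplify; lra].
    - move=> [q _]; have := Rinv_0_lt_compat (IZR g); lra.
    - case=> [] [q _].
        have : 1 / IZR g * IZR g = 1 by field; lra.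
        by rewrite q; lra.
      have := Rinv_0_lt_compat (IZR g); lra.
  have [u [v huv]] : Z.Bezout p1 p2 1 by rewrite -g1; apply: Z.gcd_bezout.
  have [pos|neg] := Z_lt_le_dec 0 (orient a b c).
    exists (- v)%Z, u, (u * q1 + v * q2)%Z, (orient a b c); rewrite DE; split; [lia| |].
      by transitivity (q1 * (u * p1 + v * p2))%Z; [rewrite huv; ring|ring].
    by transitivity (q2 * (u * p1 + v * p2))%Z; [rewrite huv; ring|ring].
  exists v, (- u)%Z, (u * q1 + v * q2)%Z, (- orient a b c)%Z; rewrite DE; split; [lia| |].
    by transitivity (q1 * (u * p1 + v * p2))%Z; [rewrite huv; ring|ring].
  by transitivity (q2 * (u * p1 + v * p2))%Z; [rewrite huv; ring|ring].
have [w1 [w2 [x [m [m2 e1 e2]]]]] := basis.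
set i := ((- x) mod m)%Z.
have [i0 im] : (0 <= i < m)%Z by apply: Z.mod_pos_bound; lia.
have [y ey] : exists y, (i + x = m * y)%Z.
  exists (- ((- x) / m))%Z; have := Z_div_mod_eq_full (- x) m; rewrite -/i; lia.
have ex1 : (m * (y * p1 + w1) = i * p1 + q1)%Z.
  by rewrite e1 Z.mul_add_distr_l Z.mul_assoc -ey; ring.
have ex2 : (m * (y * p2 + w2) = i * p2 + q2)%Z.
  by rewrite e2 Z.mul_add_distr_l Z.mul_assoc -ey; ring.
(* m times the new point is (m - i - 1) a + i b + c, with nonnegative coefficients of sum m; so the
   point stays in the box and is a [pt]. *)
have B (f1 f2 f3 r : Z) : (m * r = i * (f2 - f1) + (f3 - f1))%Z ->
    (- Z.of_nat n <= f1 <= Z.of_nat n)%Z -> (- Z.of_nat n <= f2 <= Z.of_nat n)%Z ->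
    (- Z.of_nat n <= f3 <= Z.of_nat n)%Z -> (- Z.of_nat n <= f1 + r <= Z.of_nat n)%Z.
  move=> er hf1 hf2 hf3.
  have E : (m * (f1 + r) = (m - i - 1) * f1 + i * f2 + f3)%Z by rewrite Z.mul_add_distr_l er; ring.
  split; apply: (Zmult_lt_0_le_reg_r _ _ m); [lia| |lia|]; rewrite ![(_ * m)%Z]Z.mul_comm ?E; nia.
have [|| z [zx zy]] := @pt_ex n (px a + (y * p1 + w1))%Z (py a + (y * p2 + w2))%Z.
- exact: (B _ _ _ _ ex1).
- exact: (B _ _ _ _ ex2).
have m2R : 2 <= IZR m by apply: IZR_le.
have i0R : 0 <= IZR i by apply: IZR_le.
have imR : IZR i + 1 <= IZR m by rewrite -plus_IZR; apply: IZR_le; lia.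
have mi : 0 < / IZR m by apply: Rinv_0_lt_compat; lra.
have mim : / IZR m * IZR m = 1 by field; lra.
have := only z (IZR i / IZR m) (1 / IZR m); case.
- rewrite aff_rpE /rp zx zy (plus_IZR (px a)) (plus_IZR (py a)); f_equal.
    have -> : IZR (y * p1 + w1) = (IZR i * (IZR (px b) - IZR (px a)) + (IZR (px c) - IZR (px a))) / IZR m.
      by rewrite -!minus_IZR -mult_IZR -plus_IZR -ex1 mult_IZR; field; lra.
    by field; lra.
  have -> : IZR (y * p2 + w2) = (IZR i * (IZR (py b) - IZR (py a)) + (IZR (py c) - IZR (py a))) / IZR m.
    by rewrite -!minus_IZR -mult_IZR -plus_IZR -ex2 mult_IZR; field; lra.
  by field; lra.
- by rewrite /Rdiv; nra.
- by lra.
- by rewrite /Rdiv; nra.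
- by move=> [_ q]; lra.
- by case=> [] [_ q]; [lra|rewrite /Rdiv Rmult_1_l in q; nra].
Qed.

End Planar.

(** * Triangles and the boundary of the polygon: area 1/2 *)

Section Boundary.
Variable n : nat.
Variable V : seq (pt n).
Implicit Types (a b c d z : pt n) (e f g h : edge n) (T : {set edge n}).

Definition free_at (p : R * R) : Prop :=
  (forall z, Lam0 V z -> p <> rp z) /\
  (forall s, s \in sides V -> ~ segpt [set s.1; s.2] p).

Lemma cseg_start (A B : R * R) : cseg A B A.
Proof. by exists 0; split; [lra|case: A => x y /=; f_equal; ring]. Qed.
Lemma cseg_end (A B : R * R) : cseg A B B.
Proof. by exists 1; split; [lra|case: B => x y /=; f_equal; ring]. Qed.

Lemma side_Lam0 s : s \in sides V -> Lam0 V s.1 /\ Lam0 V s.2.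
Proof. by move=> hs; split; left; exists s; split=> //; [apply: cseg_start|apply: cseg_end]. Qed.

Lemma free_not_boundary p : free_at p -> ~ on_boundary V p.
Proof.
move=> [h1 h2] [s [hs hp]].
have [l1 l2] := side_Lam0 hs.
case: (cseg_cases hp) => [e|e|o]; [exact: (h1 _ l1)|exact: (h1 _ l2)|].
apply: (h2 _ hs); apply/segpt_set2; split=> //; apply/eqP => e.
apply: (h1 _ l1); case: o => t [_ ->]; rewrite e.
by rewrite [RHS]surjective_pairing; f_equal; ring.
Qed.

Lemma inP_free p q : inP V p -> (forall r, cseg p q r -> free_at r) -> inP V q.
Proof. by move=> hp h; apply: (inP_cseg hp) => r hr; apply: free_not_boundary; apply: h. Qed.

Lemma free_planar T p : planar V T -> (forall s, s \in sides V -> [set s.1; s.2] \in T) ->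
  (forall z, Lam0 V z -> p <> rp z) -> (forall h, h \in T -> ~ segpt h p) -> free_at p.
Proof. by move=> pl sd h1 h2; split=> // s hs; apply: h2; apply: sd. Qed.

Lemma etri_open_not_Lam0 a b c z s t : etri V a b c -> rp z = aff (rp a) (rp b) (rp c) s t ->
  0 < s -> 0 < t -> s + t < 1 -> Lam0 V z -> False.
Proof.
move=> [D0 la lb lc emp] e hs ht hst lz; have [_ _ _ D0'] := orient_neq0 D0.
have : in_ctri a b c z by apply/(in_ctri_aff D0 e); lra.
by move/(emp _ lz) => [|[|]] q; move: e; rewrite q;
  [rewrite {1}(aff00 (rp a) (rp b) (rp c))|rewrite {1}(aff10 (rp a) (rp b) (rp c))
   |rewrite {1}(aff01 (rp a) (rp b) (rp c))] => /(aff_inj D0'); lra.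
Qed.

(** The midpoint of ab is in P because ab is an edge, and off the boundary because ab is not a side.
    On the way from there to an interior point nothing of [T], in particular no side of the polygon,
    is met. *)
Lemma tri_open_inP T a b c : planar V T -> (forall s, s \in sides V -> [set s.1; s.2] \in T) ->
  tri V T a b c -> (forall s, s \in sides V -> [set s.1; s.2] <> [set a; b]) ->
  forall s t, 0 < s -> 0 < t -> s + t < 1 -> inP V (aff (rp a) (rp b) (rp c) s t).
Proof.
move=> pl sd tr nab s t hs ht hst.
have et := tri_etri pl tr; have [D0 _ _ _ _] := et; have [ab _ _ D0'] := orient_neq0 D0.
have [abT _] := tr; have /adm_set2 [[_ la lb hin] pr] := proj1 pl _ abT.
have om : oseg (rp a) (rp b) (aff (rp a) (rp b) (rp c) (1/2) 0) by apply/(oseg_ab et); lra.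
apply: (inP_free (hin _ om)) => r [k [hk]]; rewrite aff_mix => er.
have [k0|k0] := Req_dec k 0.
  move: er; rewrite k0 !Rmult_0_l !Rplus_0_r => ->; split.
    by move=> z lz e; apply: (pr z lz); rewrite -e.
  move=> x hx hsx; apply: (nab _ hx); apply: (meet_eq pl (sd _ hx) abT hsx).
  by apply/segpt_set2.
apply: (free_planar pl sd).
  move=> z lz ez; rewrite er in ez; apply: (etri_open_not_Lam0 et (esym ez)) lz; nra.
move=> h hT hh; rewrite er in hh; apply: (tri_interior_free pl tr hT hh); nra.
Qed.

Lemma tri_lattice_Lam0 T a b c : planar V T -> tri V T a b c ->
  (forall s t, 0 < s -> 0 < t -> s + t < 1 -> inP V (aff (rp a) (rp b) (rp c) s t)) ->
  forall z, in_ctri a b c z -> Lam0 V z.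
Proof.
move=> pl tr ho z hz.
have et := tri_etri pl tr; have [D0 la lb lc emp] := et.
have [ab bc ac D0'] := orient_neq0 D0.
have [s [t e]] := rp_aff z D0.
have /(in_ctri_aff D0 e)[hs [ht hst]] := hz.
have [h1 [h2 [h3 _]]] := tr.
have /adm_set2 [[_ _ _ i1] _] := proj1 pl _ h1.
have /adm_set2 [[_ _ _ i2] _] := proj1 pl _ h2.
have /adm_set2 [[_ _ _ i3] _] := proj1 pl _ h3.
have A z' : rp z = rp z' -> Lam0 V z' -> Lam0 V z by move=> /rp_inj ->.
rewrite /Lam0 e.
have [s0|s0] := Req_dec s 0; have [t0|t0] := Req_dec t 0.
- by rewrite s0 t0 -aff00.
- have [t1|t1] := Req_dec t 1; first by rewrite s0 t1 -aff01.
  by apply: i3; apply/(oseg_ac et); lra.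
- have [s1|s1] := Req_dec s 1; first by rewrite s1 t0 -aff10.
  by apply: i1; apply/(oseg_ab et); lra.
- have [st1|st1] := Req_dec (s + t) 1; first by apply: i2; apply/(oseg_bc et); lra.
  by apply: ho; lra.
Qed.

Lemma tri_unimodular T a b c : planar V T -> (forall s, s \in sides V -> [set s.1; s.2] \in T) ->
  tri V T a b c -> (forall s, s \in sides V -> [set s.1; s.2] <> [set a; b]) ->
  Z.abs (orient a b c) = 1%Z.
Proof.
move=> pl sd tr nab; apply: (unimodular (tri_etri pl tr)).
exact: (tri_lattice_Lam0 pl tr (tri_open_inP pl sd tr nab)).
Qed.

End Boundary.

(** * Integer coordinates over a unimodular triangle *)

Section Coord.
Variable n : nat.
Implicit Types (a b c z : pt n).

Definition zcoord a b c z (i j : Z) : Prop :=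
  (px z = px a + i * (px b - px a) + j * (px c - px a))%Z /\
  (py z = py a + i * (py b - py a) + j * (py c - py a))%Z.

Lemma zcoord_ex a b c z : Z.abs (orient a b c) = 1%Z -> exists i j, zcoord a b c z i j.
Proof.
rewrite /zcoord /orient => h.
set D := orient a b c.
exists (D * orient a z c)%Z, (D * orient a b z)%Z.
have DD : (D * D = 1)%Z by rewrite /D /orient; nia.
split.
- transitivity (px a + (D * D) * (px z - px a))%Z; [rewrite DD; ring|rewrite /D /orient; ring].
- transitivity (py a + (D * D) * (py z - py a))%Z; [rewrite DD; ring|rewrite /D /orient; ring].
Qed.

Lemma zcoord_aff a b c z i j : zcoord a b c z i j ->
  rp z = aff (rp a) (rp b) (rp c) (IZR i) (IZR j).
Proof.
by move=> [e1 e2]; rewrite aff_rpE /rp e1 e2 -!minus_IZR -!mult_IZR -!plus_IZR.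
Qed.

Lemma zcoord0 a b c : zcoord a b c a 0 0. Proof. by split; lia. Qed.
Lemma zcoord1 a b c : zcoord a b c b 1 0. Proof. by split; lia. Qed.
Lemma zcoord2 a b c : zcoord a b c c 0 1. Proof. by split; lia. Qed.

Lemma zcoord_orient a b c z1 z2 z3 i1 j1 i2 j2 i3 j3 :
  zcoord a b c z1 i1 j1 -> zcoord a b c z2 i2 j2 -> zcoord a b c z3 i3 j3 ->
  (orient z1 z2 z3 = ((i2 - i1) * (j3 - j1) - (j2 - j1) * (i3 - i1)) * orient a b c)%Z.
Proof.
by move=> [e1 e1'] [e2 e2'] [e3 e3']; rewrite /orient e1 e1' e2 e2' e3 e3'; ring.
Qed.

Lemma zcoord_inj a b c z z' i j : zcoord a b c z i j -> zcoord a b c z' i j -> z = z'.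
Proof. by move=> [e1 e2] [e3 e4]; apply: pt_eq; congruence. Qed.

End Coord.

(** * Flips *)

Section Flip.
Variable n : nat.
Variables (V : seq (pt n)) (xi : {set edge n}).
Hypothesis bc : boundary_cond V xi.
Implicit Types (a b c d z : pt n) (e f g h : edge n) (T : {set edge n}).

Lemma Omega_planar T : Omega V xi T -> planar V T.
Proof. by move=> [[h1 [h2 _]] _]. Qed.

Lemma Omega_sides T s : Omega V xi T -> s \in sides V -> [set s.1; s.2] \in T.
Proof. by move=> [_ /subsetP h] hs; apply: h; case: bc => _ [_]; apply. Qed.

Lemma Omega_xi T e : Omega V xi T -> e \in xi -> e \in T.
Proof. by move=> [_ /subsetP]; apply. Qed.

Lemma notin_xi_side e s : e \notin xi -> s \in sides V -> [set s.1; s.2] <> e.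
Proof. by move=> /negP he hs q; apply: he; rewrite -q; case: bc => _ [_]; apply. Qed.

Record flip_quad T e T' a b c d : Prop := FlipQuad {
  fq_e : e = [set a; b];
  fq_T : e \in T;
  fq_xi : e \notin xi;
  fq_or : orient a b c = 1%Z;
  fq_abc : tri V T a b c;
  fq_abd : tri V T a b d;
  fq_d : zcoord a b c d 1 (-1);
  fq_T' : T' = (T :\ e) :|: [set [set c; d]] }.

Lemma flip_norm T e T' : Omega V xi T -> flip V xi T e T' ->
  exists a b c d, flip_quad T e T' a b c d.
Proof.
move=> oT [eT [exi [a [b [c [d [ee [ab [tc [td [cv eT']]]]]]]]]]].
have pl := Omega_planar oT.
have ns s : s \in sides V -> [set s.1; s.2] <> [set a; b].
  by move=> hs; rewrite -ee; apply: notin_xi_side.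
have uc := tri_unimodular pl (fun s => Omega_sides oT (s := s)) tc ns.
have ud := tri_unimodular pl (fun s => Omega_sides oT (s := s)) td ns.
have key c' d' : Z.abs (orient a b c') = 1%Z -> Z.abs (orient a b d') = 1%Z ->
    (0 < orient a b c')%Z -> sconvex4 a c' b d' -> orient a b c' = 1%Z /\ zcoord a b c' d' 1 (-1).
  move=> uc' ud' pos cv'.
  have [i [j zd]] := zcoord_ex d' uc'.
  have Z0 := zcoord0 a b c'; have Z1 := zcoord1 a b c'; have Z2 := zcoord2 a b c'.
  have D1 : orient a b c' = 1%Z by lia.
  rewrite (zcoord_orient Z0 Z1 zd) D1 in ud'.
  move: cv'; rewrite /sconvex4 (zcoord_orient Z0 Z2 Z1) (zcoord_orient Z2 Z1 zd).
  rewrite (zcoord_orient Z1 zd Z0) (zcoord_orient zd Z0 Z2) D1 => cv'.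
  have [ei ej] : i = 1%Z /\ j = (-1)%Z by lia.
  by rewrite ei ej in zd.
have [pos|neg] := Z_lt_le_dec 0 (orient a b c).
  have [o1 z1] := key _ _ uc ud pos cv.
  by exists a, b, c, d; split.
have pos : (0 < orient a b d)%Z.
  by move: cv neg uc; rewrite /sconvex4 /orient; lia.
have cv' : sconvex4 a d b c by move: cv; rewrite /sconvex4 /orient; lia.
have [o1 z1] := key _ _ ud uc pos cv'.
by exists a, b, d, c; split=> //; rewrite (set2C d c).
Qed.

Section Quad.
Variables (T : {set edge n}) (e : edge n) (T' : {set edge n}) (a b c d : pt n).
Hypothesis oT : Omega V xi T.
Hypothesis fq : flip_quad T e T' a b c d.
Local Notation f := [set c; d].

Let pl := Omega_planar oT.
Let D0 : orient a b c <> 0%Z. Proof. by rewrite (fq_or fq). Qed.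
Let etc : etri V a b c. Proof. exact: tri_etri pl (fq_abc fq). Qed.
Let etd : etri V a b d. Proof. exact: tri_etri pl (fq_abd fq). Qed.
Let abT : [set a; b] \in T. Proof. by rewrite -(fq_e fq); apply: fq_T fq. Qed.
Let bcT : [set b; c] \in T. Proof. by case: (fq_abc fq) => _ []. Qed.
Let acT : [set a; c] \in T. Proof. by case: (fq_abc fq) => _ [_ []]. Qed.
Let bdT : [set b; d] \in T. Proof. by case: (fq_abd fq) => _ []. Qed.
Let adT : [set a; d] \in T. Proof. by case: (fq_abd fq) => _ [_ []]. Qed.
Let abN : a != b. Proof. by case: (orient_neq0 D0). Qed.
Let sidesT s : s \in sides V -> [set s.1; s.2] \in T. Proof. exact: Omega_sides. Qed.
Let nside s : s \in sides V -> [set s.1; s.2] <> [set a; b].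
Proof. by rewrite -(fq_e fq); apply: notin_xi_side (fq_xi fq). Qed.

Lemma fq_px : (px d = px a + px b - px c)%Z.
Proof. by have [] := fq_d fq; lia. Qed.
Lemma fq_py : (py d = py a + py b - py c)%Z.
Proof. by have [] := fq_d fq; lia. Qed.

Lemma quad_neq : [/\ a != c, b != c, a != d, b != d & c != d].
Proof.
have [_ h1 h2 _] := orient_neq0 D0.
have [_ h3 h4 _] : [/\ a != b, b != d, a != d & det (rp a) (rp b) (rp d) <> 0].
  by apply: orient_neq0; case: etd.
split=> //; apply/eqP => q; have := fq_or fq.
by rewrite q (zcoord_orient (zcoord0 _ _ _) (zcoord1 _ _ _) (fq_d fq)) (fq_or fq).
Qed.

(** The diagonal passes through the midpoint of ab at k = 1/2; for smaller k it runs in abc, for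
    larger k in abd. *)
Lemma diag_half p : oseg (rp c) (rp d) p ->
  exists k, 0 < k < 1 /\ p = aff (rp a) (rp b) (rp c) k (1 - 2 * k) /\
    p = aff (rp a) (rp b) (rp d) (1 - k) (2 * k - 1).
Proof.
move=> [k [hk ->]]; exists k; split=> //.
have e1 : IZR (px d) = IZR (px a) + IZR (px b) - IZR (px c).
  by rewrite fq_px minus_IZR plus_IZR.
have e2 : IZR (py d) = IZR (py a) + IZR (py b) - IZR (py c).
  by rewrite fq_py minus_IZR plus_IZR.
by split; rewrite aff_rpE /= e1 e2; f_equal; ring.
Qed.

Lemma diag_adm : admissible V f.
Proof.
have [_ _ _ _ cd] := quad_neq.
have [_ la lb lc _] := etc; have [_ _ _ ld _] := etd.
have /adm_set2 [[_ _ _ hin] pr] := proj1 pl _ abT.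
apply/adm_set2; split; first split=> // p.
  move=> /diag_half [k [hk [e1 e2]]].
  have [l|[q|g]] := Rtotal_order k (1/2).
  - by rewrite e1; apply: (tri_open_inP pl sidesT (fq_abc fq) nside); lra.
  - by apply: hin; rewrite e1; apply/(oseg_ab etc); lra.
  - by rewrite e2; apply: (tri_open_inP pl sidesT (fq_abd fq) nside); lra.
move=> z lz /diag_half [k [hk [e1 e2]]].
have [l|[q|g]] := Rtotal_order k (1/2).
- by apply: (etri_open_not_Lam0 etc e1); lra || done.
- by apply: (pr _ lz); rewrite e1; apply/(oseg_ab etc); lra.
- by apply: (etri_open_not_Lam0 etd e2); lra || done.
Qed.

Lemma diag_meet_ab : meet f [set a; b].
Proof.
have [_ _ _ _ cd] := quad_neq.
exists (aff (rp a) (rp b) (rp c) (1/2) 0); split; apply/segpt_set2; split=> //; last first.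
  by apply/(oseg_ab etc); lra.
have o : oseg (rp c) (rp d) ((rp c).1 + 1/2 * ((rp d).1 - (rp c).1), (rp c).2 + 1/2 * ((rp d).2 - (rp c).2)).
  by exists (1/2); split=> //; lra.
have e1 : IZR (px d) = IZR (px a) + IZR (px b) - IZR (px c).
  by rewrite fq_px minus_IZR plus_IZR.
have e2 : IZR (py d) = IZR (py a) + IZR (py b) - IZR (py c).
  by rewrite fq_py minus_IZR plus_IZR.
move: o; rewrite [X in oseg _ _ X -> _](_ : _ = aff (rp a) (rp b) (rp c) (1/2) 0) //.
by rewrite aff_rpE /= e1 e2; f_equal; field.
Qed.

Lemma diag_free h : h \in T -> h != e -> ~ meet h f.
Proof.
move=> hT he [p [hp /segpt_set2 [_ /diag_half [k [hk [e1 e2]]]]]].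
have [l|[q|g]] := Rtotal_order k (1/2).
- by apply: (tri_interior_free pl (fq_abc fq) (s := k) (t := 1 - 2 * k) hT); rewrite -?e1 //; lra.
- move/eqP: he; apply; apply: (meet_eq pl hT (fq_T fq) hp); rewrite (fq_e fq).
  by apply/segpt_set2; split=> //; rewrite e1; apply/(oseg_ab etc); lra.
- by apply: (tri_interior_free pl (fq_abd fq) (s := 1 - k) (t := 2 * k - 1) hT); rewrite -?e2 //; lra.
Qed.

Lemma diag_neq : f != e.
Proof.
have [ac bc' ad bd cd] := quad_neq.
rewrite (fq_e fq); apply/eqP => q; case: (set2_eq q) => [] [q1 q2].
  by rewrite q1 eqxx in ac.
by rewrite q1 eqxx in bc'.
Qed.

Lemma diag_notin : f \notin T.
Proof.
apply/negP => fT; have := proj2 pl _ _ fT (fq_T fq) diag_neq; rewrite (fq_e fq).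
by move=> q; apply: q; apply: diag_meet_ab.
Qed.

Lemma etri_cross x y w z1 z2 p : etri V x y w -> Lam0 V z1 -> Lam0 V z2 -> z1 != z2 ->
  prim V z1 z2 -> oseg (rp z1) (rp z2) p -> oseg (rp x) (rp y) p ->
  0 < det (rp x) (rp y) (rp w) * det (rp x) (rp y) (rp z2) ->
  z2 = w \/ meet [set z1; z2] [set x; w] \/ meet [set z1; z2] [set y; w].
Proof.
move=> et l1 l2 z12 pr o1 o2 hsg.
have [D0x lx ly lw emp] := et; have [xy yw xw D0x'] := orient_neq0 D0x.
have [s0 [t0 ep]] := aff_surj p D0x'; rewrite ep in o1 o2.
have /(oseg_ab et) [et0 hs0] := o2.
have [s1 [t1 ez]] := rp_aff z2 D0x.
have t1p : 0 < t1.
  have : det (rp x) (rp y) (rp z2) = t1 * det (rp x) (rp y) (rp w).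
    by rewrite ez /det /aff /=; ring.
  by move=> q; rewrite q in hsg; nra.
have [H1 [H2 H3]] : 0 <= s0 /\ 0 <= t0 /\ s0 + t0 <= 1 by lra.
have [[q|[q|q]]|[k [hk [s [t [_ [e2 [ok cs]]]]]]]] := exit_tri et l2 pr o1 H1 H2 H3 ez.
- by exfalso; rewrite q {1}(aff00 (rp x) (rp y) (rp w)) in ez; case: (aff_inj D0x' ez); lra.
- by exfalso; rewrite q {1}(aff10 (rp x) (rp y) (rp w)) in ez; case: (aff_inj D0x' ez); lra.
- by left.
right; case: cs => [] [c1 c2 c3].
- left; exists (aff (rp x) (rp y) (rp w) s t); split; apply/segpt_set2; split=> //.
  by apply/(oseg_ac et).
- by lra.
- right; exists (aff (rp x) (rp y) (rp w) s t); split; apply/segpt_set2; split=> //.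
  by apply/(oseg_bc et); lra.
Qed.

(** For maximality, take an admissible edge missing from [T'] that in [T] was blocked by e alone. It
    crosses ab, and in each of the two triangles it must run into the apex because the other four
    sides remain in [T']; so it is cd. *)
Lemma flip_quad_Omega : Omega V xi T'.
Proof.
have [ac bc' ad bd cd] := quad_neq.
have eE := fq_e fq.
have inT' h : h \in T' -> h = f \/ (h \in T /\ h != e).
  by rewrite (fq_T' fq) !inE => /orP[/andP[-> ->]|/eqP->]; [right|left].
have T'in h : h \in T -> h != e -> h \in T'.
  by move=> h1 h2; rewrite (fq_T' fq) !inE h1 h2.
have fT' : f \in T' by rewrite (fq_T' fq) !inE eqxx orbT.
split; last first.
  apply/subsetP => h hxi; apply: T'in; first exact: Omega_xi oT hxi.
  by apply/eqP => q; move: (fq_xi fq); rewrite -q hxi.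
split; first by move=> h /inT' [->|[hT _]]; [apply: diag_adm|apply: (proj1 pl)].
split.
  move=> h h' /inT' [->|[hT he]] /inT' [->|[hT' he']] ne.
  - by rewrite eqxx in ne.
  - by move=> [p [q1 q2]]; apply: (diag_free hT' he'); exists p.
  - exact: diag_free.
  - exact: (proj2 pl).
move=> k ka kT'.
have [ke|ke] := eqVneq k e.
  by exists f; split=> //; rewrite ke eE; apply: diag_meet_ab.
have kT : k \notin T by apply: contra kT' => kT; apply: T'in.
have [h [hT hk]] := (proj2 (proj2 (proj1 oT))) k ka kT.
have [he|he] := eqVneq h e; last by exists h; split=> //; apply: T'in.
apply: NNPP => none.
have [z1 [z2 [kE z12]]] := adm_ex ka.
rewrite kE in ka ke kT' hk; have /adm_set2 [[_ l1 l2 _] pk] := ka.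
have [p [hp kp]] := hk; rewrite he eE in hp.
have /segpt_set2 [_ op] := kp; have /segpt_set2 [_ oab] := hp.
have [_ la lb lc _] := etc; have [_ _ _ ld _] := etd.
have /adm_set2 [_ pab] := proj1 pl _ abT.
have tv : det (rp a) (rp b) (rp z1) * det (rp a) (rp b) (rp z2) < 0.
  refine (segs_straddle abN z12 la lb l1 l2 pab pk oab op _) => q.
  by move/eqP: ke; apply; rewrite eE q.
have ne x y : y != b -> y != a -> [set x; y] != e.
  move=> h1 h2; rewrite eE; apply/eqP => q.
  by case: (set2_eq q) => [] [_ q2]; [rewrite q2 eqxx in h1|rewrite q2 eqxx in h2].
have nm w x : w != b -> w != a -> [set x; w] \in T -> ~ meet [set z1; z2] [set x; w].
  move=> wb wa xT [r [r1 r2]]; apply: none; exists [set x; w]; split; first by apply: T'in => //; apply: ne.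
  by rewrite kE; exists r.
have nm' w x : w != b -> w != a -> [set x; w] \in T -> ~ meet [set z2; z1] [set x; w].
  by rewrite (set2C z2 z1); apply: nm.
have [ac2 bc2 ad2 bd2] : [/\ c != a, c != b, d != a & d != b] by rewrite !(eq_sym c) !(eq_sym d).
have dc : det (rp a) (rp b) (rp c) = 1 by rewrite -IZR_orient (fq_or fq).
have dd : det (rp a) (rp b) (rp d) = -1.
  by rewrite -IZR_orient (zcoord_orient (zcoord0 _ _ _) (zcoord1 _ _ _) (fq_d fq)) (fq_or fq).
have z21 : z2 != z1 by rewrite eq_sym.
have key u v : Lam0 V u -> Lam0 V v -> u != v -> prim V u v -> oseg (rp u) (rp v) p ->
   [set u; v] = [set z1; z2] ->
   0 < det (rp a) (rp b) (rp v) -> det (rp a) (rp b) (rp u) < 0 -> False.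
  move=> lu lv uv puv ouv Ek dv du.
  have [qv|[q|q]] := etri_cross etc lu lv uv puv ouv oab ltac:(rewrite dc; lra).
  - have [qu|[q|q]] := etri_cross etd lv lu ltac:(by rewrite eq_sym) (prim_sym puv) (oseg_sym ouv) oab ltac:(rewrite dd; lra).
    + by move/negP: kT'; apply; rewrite -Ek qv qu set2C.
    + by rewrite (set2C v u) Ek in q; apply: nm q.
    + by rewrite (set2C v u) Ek in q; apply: nm q.
  - by rewrite Ek in q; apply: nm q.
  - by rewrite Ek in q; apply: nm q.
have [d1|d1] := Rlt_le_dec 0 (det (rp a) (rp b) (rp z2)).
  by apply: (key z1 z2) => //; nra.
apply: (key z2 z1) => //; [exact: prim_sym|exact: oseg_sym|exact: set2C|nra|].
case: d1 => // d1; rewrite d1 in tv; lra.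
Qed.

(** In integer coordinates over abc the only lattice points in the new triangles are seen to be
    their vertices. The order d, c, a, b makes the orientation equal to 1 again. *)
Lemma flip_quad_rev : flip_quad T' f T d c a b.
Proof.
have [ac bc' ad bd cd] := quad_neq.
have eE := fq_e fq.
have oT' := flip_quad_Omega.
have T'in h : h \in T -> h != e -> h \in T'.
  by move=> h1 h2; rewrite (fq_T' fq) !inE h1 h2.
have fT' : f \in T' by rewrite (fq_T' fq) !inE eqxx orbT.
have ne x y : y != b -> y != a -> [set x; y] != e.
  move=> h1 h2; rewrite eE; apply/eqP => q.
  by case: (set2_eq q) => [] [_ q2]; [rewrite q2 eqxx in h1|rewrite q2 eqxx in h2].
have [ac2 bc2 ad2 bd2] : [/\ c != a, c != b, d != a & d != b] by rewrite !(eq_sym c) !(eq_sym d).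
have Z0 := zcoord0 a b c; have Z1 := zcoord1 a b c; have Z2 := zcoord2 a b c; have Z3 := fq_d fq.
have O1 := fq_or fq.
have fin x y z : (x = c \/ x = d) -> [set x; y] \in T -> True by [].
split=> //.
- by rewrite set2C.
- apply/negP => fxi; move/negP: diag_notin; apply; exact: Omega_xi oT fxi.
- by rewrite (zcoord_orient Z3 Z2 Z0) O1.
- split; first by rewrite set2C.
  split; first by rewrite (set2C c a); apply: T'in => //; apply: ne.
  split; first by rewrite (set2C d a); apply: T'in => //; apply: ne.
  split; first by rewrite (zcoord_orient Z3 Z2 Z0) O1.
  move=> z lz; rewrite /in_ctri.
  have [i [j Zz]] : exists i j, zcoord a b c z i j by apply: zcoord_ex; rewrite O1.
  rewrite (zcoord_orient Z3 Z2 Zz) (zcoord_orient Z2 Z0 Zz) (zcoord_orient Z0 Z3 Zz) O1 => hz.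
  have i01 : (0 <= i <= 1)%Z by clear -hz; lia.
  have : (i = 0 /\ j = 0 \/ (i = 0 /\ j = 1 \/ i = 1 /\ j = -1))%Z by clear -hz i01; lia.
  case=> [|[]] [ei ej]; rewrite ei ej in Zz.
  + by right; right; apply: zcoord_inj Zz Z0.
  + by right; left; apply: zcoord_inj Zz Z2.
  + by left; apply: zcoord_inj Zz Z3.
- split; first by rewrite set2C.
  split; first by rewrite (set2C c b); apply: T'in => //; apply: ne.
  split; first by rewrite (set2C d b); apply: T'in => //; apply: ne.
  split; first by rewrite (zcoord_orient Z3 Z2 Z1) O1.
  move=> z lz; rewrite /in_ctri.
  have [i [j Zz]] : exists i j, zcoord a b c z i j by apply: zcoord_ex; rewrite O1.
  rewrite (zcoord_orient Z3 Z2 Zz) (zcoord_orient Z2 Z1 Zz) (zcoord_orient Z1 Z3 Zz) O1 => hz.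
  have i01 : (0 <= i <= 1)%Z by clear -hz; lia.
  have : (i = 1 /\ j = 0 \/ (i = 0 /\ j = 1 \/ i = 1 /\ j = -1))%Z by clear -hz i01; lia.
  case=> [|[]] [ei ej]; rewrite ei ej in Zz.
  + by right; right; apply: zcoord_inj Zz Z1.
  + by right; left; apply: zcoord_inj Zz Z2.
  + by left; apply: zcoord_inj Zz Z3.
- have e1 := fq_px; have e2 := fq_py; split; clear -e1 e2; lia.
- apply/setP => h; rewrite (fq_T' fq) !inE -eE.
  have [->|hf] := eqVneq h f; first by rewrite (negbTE diag_notin) (negbTE diag_neq).
  have [->|he] := eqVneq h e; first by rewrite (fq_T fq) orbT.
  by rewrite !orbF.
Qed.

Lemma flip_quad_flip : flip V xi T e T'.
Proof.
have Z0 := zcoord0 a b c; have Z1 := zcoord1 a b c; have Z2 := zcoord2 a b c; have Z3 := fq_d fq.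
split; first exact: fq_T fq.
split; first exact: fq_xi fq.
exists a, b, c, d; split; first exact: fq_e fq.
split=> //; split; first exact: fq_abc fq.
split; first exact: fq_abd fq.
split; last exact: fq_T' fq.
right; rewrite (zcoord_orient Z0 Z2 Z1) (zcoord_orient Z2 Z1 Z3).
by rewrite (zcoord_orient Z1 Z3 Z0) (zcoord_orient Z3 Z0 Z2) (fq_or fq).
Qed.

End Quad.

Lemma flip_Omega T e T' : Omega V xi T -> flip V xi T e T' -> Omega V xi T'.
Proof. by move=> oT /(flip_norm oT) [a [b [c [d fq]]]]; apply: flip_quad_Omega fq. Qed.

Lemma flip_sym T e T' : Omega V xi T -> flip V xi T e T' ->
  exists f, [/\ flip V xi T' f T, f \notin T, e \in T, T' = (T :\ e) :|: [set f] & T = (T' :\ f) :|: [set e]].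
Proof.
move=> oT fl; have [a [b [c [d fq]]]] := flip_norm oT fl.
have fr := flip_quad_rev oT fq.
exists [set c; d]; split.
- exact: flip_quad_flip fr.
- exact: diag_notin fq.
- exact: fq_T fq.
- exact: fq_T' fq.
- by rewrite [LHS](fq_T' fr) (fq_e fq).
Qed.

Lemma flip_quad_unique T e T1 T2 a b c d a' b' c' d' : Omega V xi T ->
  flip_quad T e T1 a b c d -> flip_quad T e T2 a' b' c' d' -> [set c; d] = [set c'; d'].
Proof.
move=> oT q1 q2; have pl := Omega_planar oT.
have [o1 o2] := (fq_or q1, fq_or q2).
have o1' : orient a b d = (-1)%Z.
  by rewrite (zcoord_orient (zcoord0 _ _ _) (zcoord1 _ _ _) (fq_d q1)) o1.
have o2' : orient a' b' d' = (-1)%Z.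
  by rewrite (zcoord_orient (zcoord0 _ _ _) (zcoord1 _ _ _) (fq_d q2)) o2.
have e1 := fq_e q1; rewrite (fq_e q2) in e1.
have [t1 [t2 [t3 t4]]] := (fq_abc q1, (fq_abd q1, (fq_abc q2, fq_abd q2))).
case: (set2_eq e1) => [] [ea eb]; subst a' b'.
  have -> : c = c' by apply: (tri_unique pl t1 t3); rewrite o1 o2.
  by have -> : d = d' by apply: (tri_unique pl t2 t4); rewrite o1' o2'.
have sw z : orient b a z = (- orient a b z)%Z by apply: orient_swap.
rewrite sw in o2; rewrite sw in o2'.
have -> : c = d' by apply: (tri_unique pl t1 (tri_swap t4)); rewrite o1; lia.
have -> : d = c' by apply: (tri_unique pl t2 (tri_swap t3)); rewrite o1'; lia.
exact: set2C.
Qed.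

Lemma flip_unique T e T1 T2 : Omega V xi T ->
  flip V xi T e T1 -> flip V xi T e T2 -> T1 = T2.
Proof.
move=> oT /(flip_norm oT) [a [b [c [d q1]]]] /(flip_norm oT) [a' [b' [c' [d' q2]]]].
by rewrite (fq_T' q1) (fq_T' q2) (flip_quad_unique oT q1 q2).
Qed.

End Flip.

(** * Every midpoint is covered by every triangulation *)

Lemma enter3 x1 x2 x3 y1 y2 y3 :
  0 < x1 \/ (x1 = 0 /\ 0 < y1) -> 0 < x2 \/ (x2 = 0 /\ 0 < y2) -> 0 < x3 \/ (x3 = 0 /\ 0 < y3) ->
  exists k, 0 < k < 1 /\ [/\ 0 < x1 + k * (y1 - x1), 0 < x2 + k * (y2 - x2) & 0 < x3 + k * (y3 - x3)].
Proof.
have K x y : 0 < x \/ (x = 0 /\ 0 < y) ->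
    exists k, 0 < k < 1 /\ forall k', 0 < k' <= k -> 0 < x + k' * (y - x).
  case=> [h|[-> h]]; last by exists (1/2); split; [lra|move=> k hk; nra].
  have [hy|hy] := Rlt_le_dec 0 y; first by exists (1/2); split; [lra|move=> k hk; nra].
  have i0 : 0 < / (2 * (x - y)) by apply: Rinv_0_lt_compat; lra.
  have e : x / (2 * (x - y)) * (x - y) = x / 2 by field; lra.
  exists (x / (2 * (x - y))); split; last by move=> k hk; nra.
  split; first by rewrite /Rdiv; nra.
  by apply: (Rmult_lt_reg_r (x - y)); lra.
move=> /K [k1 [a1 b1]] /K [k2 [a2 b2]] /K [k3 [a3 b3]].
exists (Rmin k1 (Rmin k2 k3)).
have m1 := Rmin_l k1 (Rmin k2 k3); have m2 := Rmin_r k1 (Rmin k2 k3).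
have m3 := Rmin_l k2 k3; have m4 := Rmin_r k2 k3.
have m0 : 0 < Rmin k1 (Rmin k2 k3) by do 2!(apply: Rmin_glb_lt; first lra); lra.
split; first lra.
by split; [apply: b1|apply: b2|apply: b3]; lra.
Qed.

Lemma det_interp (A B : R * R) p q k :
  det A B (p.1 + k * (q.1 - p.1), p.2 + k * (q.2 - p.2)) =
  det A B p + k * (det A B q - det A B p).
Proof. by rewrite /det /=; ring. Qed.

Lemma det_aff_third (A B p q r : R * R) s t :
  det A B (aff p q r s t) = (1 - s - t) * det A B p + s * det A B q + t * det A B r.
Proof. by rewrite /det /aff /=; ring. Qed.

Lemma det_rot (A B C : R * R) : det B C A = det A B C.
Proof. by rewrite /det; ring. Qed.
Lemma det_swap (A B C : R * R) : det B A C = - det A B C.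
Proof. by rewrite /det; ring. Qed.
Lemma det_aa (A B : R * R) : det A B A = 0.
Proof. by rewrite /det; ring. Qed.
Lemma det_bb (A B : R * R) : det A B B = 0.
Proof. by rewrite /det; ring. Qed.

Lemma oseg_interp (A B p : R * R) k : oseg A B p -> 0 <= k < 1 ->
  oseg A B (p.1 + k * (B.1 - p.1), p.2 + k * (B.2 - p.2)).
Proof.
move=> [t [ht ->]] hk; exists (t + k * (1 - t)); split; first by nra.
by rewrite /=; f_equal; ring.
Qed.

Lemma oseg_sub (A B p r : R * R) : oseg A B p -> oseg A p r -> oseg A B r.
Proof.
move=> [t [ht ->]] [k [hk ->]]; exists (k * t); split; first by nra.
by rewrite /=; f_equal; ring.
Qed.

Lemma oseg_det (A B p : R * R) : oseg A B p -> det A B p = 0.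
Proof. by move=> [t [_ ->]]; rewrite det_interp det_aa det_bb; ring. Qed.

(** * Visibility across a set of disjoint edges *)

Section Visible.
Variable n : nat.
Variables (V : seq (pt n)).
Implicit Types (a b c d z w : pt n) (e f g h : edge n) (p q x y r : R * R).
Variable T : {set edge n}.
Hypothesis pl : planar V T.

(** Edges lying along the line pq do not count as obstacles: an edge met by the open segment may run
    along it but not cross it. *)
Definition clear p q : Prop := forall a b, [set a; b] \in T -> a != b ->
  forall r, oseg p q r -> oseg (rp a) (rp b) r -> det p q (rp a) = 0 /\ det p q (rp b) = 0.

Lemma clear_sub p q r : oseg p q r -> clear p q -> clear p r.
Proof.
move=> or cl a b abT ab r' o1 o2; have [h1 h2] := cl a b abT ab r' (oseg_sub or o1) o2.
have [k [hk er]] := or.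
have E w : det p r (rp w) = k * det p q (rp w) by rewrite er /det /=; ring.
by rewrite !E h1 h2; lra.
Qed.

(* Among the lattice points of the triangle [p x z] off the line [p x], the one seen from [p] under
   the smallest angle from [x] cannot be hidden. *)
Lemma visible p x z : det p x (rp z) <> 0 -> Lam0 V z ->
  (forall a b, [set a; b] \in T -> a != b -> forall r, oseg p x r \/ r = x \/ oseg x (rp z) r ->
     oseg (rp a) (rp b) r ->
     (det p x (rp a) = 0 /\ det p x (rp b) = 0) \/
     (det x (rp z) (rp a) = 0 /\ det x (rp z) (rp b) = 0)) ->
  (forall w, Lam0 V w -> ~ oseg p x (rp w) /\ rp w <> x) ->
  exists w s t, [/\ Lam0 V w, rp w = aff p x (rp z) s t, 0 <= s /\ 0 < t, s + t <= 1 & clear p (rp w)].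
Proof.
move=> D0 lz H1 H2.
pose P w := Lam0 V w /\ exists s t, [/\ rp w = aff p x (rp z) s t, 0 <= s, 0 < t & s + t <= 1].
pose F w := det p x (rp w) / (det p x (rp w) + det p (rp w) (rp z)).
have FE w s t : rp w = aff p x (rp z) s t -> 0 < s + t -> F w = t / (s + t).
  move=> e st; rewrite /F e.
  have -> : det p x (aff p x (rp z) s t) = t * det p x (rp z) by rewrite /det /aff /=; ring.
  have -> : det p (aff p x (rp z) s t) (rp z) = s * det p x (rp z) by rewrite /det /aff /=; ring.
  field; split; first lra.
  have -> : t * det p x (rp z) + s * det p x (rp z) = (s + t) * det p x (rp z) by ring.
  by apply: Rmult_integral_contrapositive; split=> //; lra.
have [|w [[lw [s [t [ew hs ht hst]]]] wmin]] := finite_argmin (P := P) F.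
  by exists z; split=> //; exists 0, 1; split; [rewrite -aff01| | |]; lra || done.
exists w, s, t; split=> //.
(* b is the end of a blocking edge on the px side of the ray pw. If b is in the triangle, it
   contradicts minimality. Otherwise the edge leaves through px or xz, where [H1] would make it
   collinear with that side, or through pz, which is not on the px side of the ray. *)
have key a b r : [set a; b] \in T -> a != b -> oseg p (rp w) r -> oseg (rp a) (rp b) r ->
    det p (rp w) (rp b) * det p x (rp z) < 0 -> False.
  move=> abT ab o1 o2 sg.
  have /adm_set2 [[_ la lb _] pr] := proj1 pl _ abT.
  have [s' [t' eb]] := aff_surj (rp b) D0.
  have sg' : s * t' - t * s' < 0.
    move: sg; rewrite ew eb.
    have -> : det p (aff p x (rp z) s t) (aff p x (rp z) s' t') = (s * t' - t * s') * det p x (rp z).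
      by rewrite /det /aff /=; ring.
    by move=> q; have := Rsqr_pos_lt _ D0; rewrite /Rsqr; nra.
  have [k [hk er]] := o1.
  have er' : r = aff p x (rp z) (k * s) (k * t) by rewrite er ew /aff /=; f_equal; ring.
  have [hin|hout] := classic (0 <= s' /\ 0 <= t' /\ 0 <= 1 - s' - t').
    have tp : 0 < t'.
      apply: Rnot_le_lt => t0; have t0' : t' = 0 by lra.
      have sp : 0 < s' by nra.
      have [n1 n2] := H2 _ lb.
      have [s1|s1] := Req_dec s' 1; first by apply: n2; rewrite eb t0' s1 -aff10.
      apply: n1; rewrite eb t0'; exists s'; split; first lra.
      by rewrite /aff /=; f_equal; ring.
    have Pb : P b by split=> //; exists s', t'; split=> //; lra.
    have := wmin _ Pb; rewrite (FE _ _ _ ew) ?(FE _ _ _ eb); try lra.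
    have W0 : 0 <= (s + t) * (s' + t') by nra.
    move=> /(Rmult_le_compat_r _ _ _ W0).
    have -> : t / (s + t) * ((s + t) * (s' + t')) = t * (s' + t') by field; lra.
    have -> : t' / (s' + t') * ((s + t) * (s' + t')) = t' * (s + t) by field; lra.
    by nra.
  have [X1 [X2 X3]] : 0 <= k * s /\ 0 <= k * t /\ 0 <= 1 - k * s - k * t.
    by split; [nra|split; nra].
  have [m [hm [[A1 A2 A3] B]]] := exit3 X1 X2 X3 hout.
  set qs := k * s + m * (s' - k * s) in A1 B; set qt := k * t + m * (t' - k * t) in A2 B.
  have oq : oseg (rp a) (rp b) (aff p x (rp z) qs qt).
    have := oseg_interp o2 hm; by rewrite er' eb aff_mix.
  have lin : s * qt - t * qs = m * (s * t' - t * s') by rewrite /qs /qt; ring.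
  have m0 : m = 0 \/ 0 < m by lra.
  have detx s1 t1 : det p x (aff p x (rp z) s1 t1) = t1 * det p x (rp z) by rewrite /det /aff /=; ring.
  have detz s1 t1 : det x (rp z) (aff p x (rp z) s1 t1) = (1 - s1 - t1) * det p x (rp z) by rewrite /det /aff /=; ring.
  have i0 u : u * det p x (rp z) = 0 -> u = 0 by move=> /Rmult_integral [].
  have use : (oseg p x (aff p x (rp z) qs qt) \/ aff p x (rp z) qs qt = x \/ oseg x (rp z) (aff p x (rp z) qs qt)) ->
      (t' = 0 /\ k * t = 0) \/ (1 - s' - t' = 0 /\ 1 - k * s - k * t = 0).
    move=> hq; case: (H1 a b abT ab _ hq oq) => [] [h1 h2]; [left|right].
      split; first by move: h2; rewrite eb detx => /i0.
      have hr : det p x r = 0.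
        by case: o2 => u [_ ->]; rewrite det_interp h1 h2; ring.
      by move: hr; rewrite er' detx => /i0.
    have hr : det x (rp z) r = 0.
      by case: o2 => u [_ ->]; rewrite det_interp h1 h2; ring.
    by move: h2 hr; rewrite er' eb !detz => /i0 ? /i0.
  case: B => [] [B1 B2].
  - rewrite B2 in lin; case: m0 => [m0|m0].
      rewrite /qs m0 in B2; have s0 : s = 0 by clear -B2 hk hs; nra.
      by rewrite s0 in sg'; clear -sg' ht B1; nra.
    have mneg : m * (s * t' - t * s') < 0 by clear -m0 sg'; nra.
    by have : 0 <= s * qt by [clear -hs A2; nra]; lra.
  - have qsp : 0 < qs.
      case: m0 => m0; last by rewrite B2 in lin; nra.
      by move: B2; rewrite /qt m0; nra.
    have qs1 : qs <= 1 by rewrite /qs /qt in A3 B2 *; lra.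
    have [q1|q1] := Req_dec qs 1.
      have [||] := use; [right; left|nra|nra].
      by rewrite q1 B2 -aff10.
    have [||] := use; [left|nra|nra].
    exists qs; split; first lra.
    by rewrite B2 /aff /=; f_equal; ring.
  - have qsum : qs + qt = 1 by rewrite /qs /qt; lra.
    have qt1 : qt < 1.
      apply: Rnot_le_lt => q1; have q0 : qs = 0 by lra.
      rewrite q0 in lin qsum; case: m0 => m0; last by nra.
      by move: q0 qsum; rewrite /qs /qt m0; nra.
    have [q0|q0] := Req_dec qt 0.
      have [||] := use; [right; left|nra|nra].
      have q1 : qs = 1 by lra.
      by rewrite q0 q1 -aff10.
    have [||] := use; [right; right|nra|nra].
    exists qt; split; first lra.
    have q1 : qs = 1 - qt by lra.
    by rewrite q1 /aff /=; f_equal; ring.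
move=> a b abT ab r o1 o2.
have d0 := oseg_det o1.
have [u [hu eu]] := o2; rewrite eu det_interp in d0.
have Dn := Rsqr_pos_lt _ D0; rewrite /Rsqr in Dn.
have [b0|b0] := Req_dec (det p (rp w) (rp b)) 0.
  by split=> //; rewrite b0 in d0; nra.
have [neg|pos] := Rlt_le_dec (det p (rp w) (rp b) * det p x (rp z)) 0.
  by case: (key a b r abT ab o1 o2 neg).
have neg : det p (rp w) (rp a) * det p x (rp z) < 0.
  have pos' : 0 < det p (rp w) (rp b) * det p x (rp z).
    by case: pos => // q; case: (Rmult_integral_contrapositive _ _ (conj b0 D0)); rewrite q.
  nra.
by case: (key b a r _ _ o1 (oseg_sym o2) neg); rewrite 1?set2C 1?eq_sym.
Qed.

End Visible.

(** * The empty triangle on one side of an edge *)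

Section Face.
Variable n : nat.
Variables (V : seq (pt n)).
Implicit Types (a b c d z w : pt n) (e f g h : edge n) (p q x y r : R * R).
Variable T : {set edge n}.
Hypothesis pl : planar V T.

Lemma edge_data a b : [set a; b] \in T -> [/\ Lam0 V a, Lam0 V b & prim V a b].
Proof. by move=> h; have /adm_set2 [[_ la lb _] pr] := proj1 pl _ h. Qed.

Lemma same_edge a b c d r : [set a; b] \in T -> [set c; d] \in T -> a != b -> c != d ->
  oseg (rp a) (rp b) r -> oseg (rp c) (rp d) r -> [set a; b] = [set c; d].
Proof. by move=> h1 h2 ab cd o1 o2; apply: (meet_eq pl h1 h2 (p := r)); apply/segpt_set2. Qed.

(** Take the obstacle nearest to y. [F] is the parameter at which an edge crosses the line from y to
    w0, so minimising it leaves a clear view up to the crossing point. *)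
Lemma first_crossing y (w0 : R * R) : (exists a b r, [/\ [set a; b] \in T, a != b, oseg y w0 r,
     oseg (rp a) (rp b) r & det y w0 (rp a) <> 0]) ->
  exists k1 k2 r, [/\ [set k1; k2] \in T, k1 != k2, oseg y w0 r /\ oseg (rp k1) (rp k2) r,
     det y w0 (rp k1) <> 0 /\ det y w0 (rp k2) <> 0 & clear T y r].
Proof.
pose P (ab : pt n * pt n) := [/\ [set ab.1; ab.2] \in T, ab.1 != ab.2 &
  exists r, [/\ oseg y w0 r, oseg (rp ab.1) (rp ab.2) r & det y w0 (rp ab.1) <> 0]].
pose F (ab : pt n * pt n) := det (rp ab.1) (rp ab.2) y / (det (rp ab.1) (rp ab.2) y - det (rp ab.1) (rp ab.2) w0).
move=> [a [b [r0 [abT ab o1 o2 d0]]]].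
have [|[k1 k2] [[/= kT k12 [r [or1 or2 dk]]] kmin]] := finite_argmin (P := P) F.
  by exists (a, b); split=> //; exists r0.
have dne c d r' : oseg y w0 r' -> oseg (rp c) (rp d) r' -> det y w0 (rp c) <> 0 ->
    det y w0 (rp d) <> 0 /\ det (rp c) (rp d) y - det (rp c) (rp d) w0 <> 0.
  move=> q1 q2 q3; have e1 := oseg_det q1; have e2 := oseg_det q2.
  have [u [hu eu]] := q2; have [v [hv ev]] := q1.
  rewrite eu det_interp in e1.
  have q4 : det y w0 (rp d) <> 0 by move=> q; rewrite q in e1; apply: q3; clear -hu e1; nra.
  split=> // q5; rewrite ev det_interp in e2.
  have e3 : det (rp c) (rp d) y - det (rp c) (rp d) w0 = det y w0 (rp d) - det y w0 (rp c).
    by rewrite /det; ring.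
  rewrite e3 in q5; have e4 : det y w0 (rp c) = det y w0 (rp d) by lra.
  by apply: q3; rewrite e4 in e1 *; clear -e1; nra.
have FE c d k : oseg (rp c) (rp d) (y.1 + k * (w0.1 - y.1), y.2 + k * (w0.2 - y.2)) -> 0 < k < 1 ->
    det y w0 (rp c) <> 0 -> F (c, d) = k.
  move=> q2 hk q3.
  have [_ q4] : det y w0 (rp d) <> 0 /\ det (rp c) (rp d) y - det (rp c) (rp d) w0 <> 0.
    by apply: dne q2 q3; exists k.
  have := oseg_det q2; rewrite det_interp /F /= => e.
  apply: (Rmult_eq_reg_r (det (rp c) (rp d) y - det (rp c) (rp d) w0)) => //.
  by field_simplify; [lra|].
have [dk2 _] := dne _ _ _ or1 or2 dk.
exists k1, k2, r; split=> // c d cdT cd r' o3 o4.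
have [k [hk er]] := or1; have [k' [hk' er']] := o3.
have E (w : R * R) : det y r w = k * det y w0 w by rewrite er /det /=; ring.
have dz : det y w0 (rp c) = 0.
  apply: NNPP => dn.
  have er2 : r' = (y.1 + (k' * k) * (w0.1 - y.1), y.2 + (k' * k) * (w0.2 - y.2)).
    by rewrite er' er /=; f_equal; ring.
  have : F (k1, k2) <= F (c, d).
    apply: kmin; split=> //; exists r'; split=> //.
    by rewrite er2; exists (k' * k); split=> //; clear -hk hk'; nra.
  rewrite (FE k1 k2 k) -?er // (FE c d (k' * k)) -?er2 //; clear -hk hk'; nra.
have := oseg_det (oseg_sub or1 o3); have [u [hu eu]] := o4.
rewrite eu det_interp dz !E dz => q; split; first by ring.
have : det y w0 (rp d) = 0 by clear -q hu; nra.
by move=> ->; ring.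
Qed.

Section EmptySide.
Variables (h1 h2 : pt n) (y : R * R).
Hypothesis hT : [set h1; h2] \in T.
Hypothesis h12 : h1 != h2.
Hypothesis yh : oseg (rp h1) (rp h2) y.
Local Notation H p := (det (rp h1) (rp h2) p).

Let Hy : H y = 0. Proof. exact: oseg_det. Qed.

Lemma on_base_eq a b r : [set a; b] \in T -> a != b -> oseg (rp a) (rp b) r ->
  oseg (rp h1) (rp h2) r -> H (rp a) = 0 /\ H (rp b) = 0.
Proof.
move=> abT ab o1 o2; case: (set2_eq (same_edge abT hT ab h12 o1 o2)) => [] [-> ->];
by rewrite ?det_aa ?det_bb.
Qed.

(** [H] measures height over the base. The blocking edge crosses neither the base nor the clear
    sight line from y to z, so each of its ends is either inside the triangle y gg z and below z, or
    on or beyond the line through gg and z. Not both ends are of the second kind, since the edge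
    passes strictly inside. *)
Lemma lower_endpoint z gg w0 s t r k1 k2 : Lam0 V z -> gg = h1 \/ gg = h2 ->
  det y (rp gg) (rp z) <> 0 -> clear T y (rp z) ->
  (forall w, Lam0 V w -> ~ oseg y (rp z) (rp w)) -> Lam0 V w0 ->
  rp w0 = aff y (rp gg) (rp z) s t -> 0 <= s -> 0 < t -> s + t <= 1 -> t < 1 ->
  [set k1; k2] \in T -> k1 != k2 -> oseg y (rp w0) r -> oseg (rp k1) (rp k2) r ->
  exists w2 t2, (w2 = k1 \/ w2 = k2) /\ H (rp w2) = t2 * H (rp z) /\ 0 < t2 < 1.
Proof.
move=> lz hg D0 cl noz lw0 ew0 hs ht hst t1 kT k12 o1 o2.
have [lh1 lh2 prh] := edge_data hT.
have lg : Lam0 V gg by case: hg => ->.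
have Hg : H (rp gg) = 0 by case: hg => ->; rewrite ?det_aa ?det_bb.
have spos : 0 < s.
  case: hs => // s0; case: (noz _ lw0); rewrite ew0 -s0; exists t; split=> //.
  by rewrite /aff; f_equal; ring.
have [k [hk er]] := o1.
have er' : r = aff y (rp gg) (rp z) (k * s) (k * t) by rewrite er ew0 /aff /=; f_equal; ring.
have [lk1 lk2 prk] := edge_data kT.
have Haff s1 t1' : H (aff y (rp gg) (rp z) s1 t1') = t1' * H (rp z).
  by rewrite det_aff_third Hy Hg; ring.
have Hz : H (rp z) <> 0.
  move=> q; apply: D0.
  have := oseg_det yh => q2.
  have [u [hu eu]] := yh.
  have : det y (rp gg) (rp z) = H (rp z) * (if gg == h1 then - u else 1 - u).
    case: hg => ->; first by rewrite eqxx eu /det /=; ring.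
    by rewrite eq_sym (negbTE h12) eu /det /=; ring.
  by rewrite q Rmult_0_l.
have Hr : H r = k * t * H (rp z) by rewrite er' Haff.
have noH p : oseg (rp k1) (rp k2) p -> oseg (rp h1) (rp h2) p -> False.
  move=> p1 p2; have [z1 z2] := on_base_eq kT k12 p1 p2.
  have : H r = 0 by case: o2 => u [_ ->]; rewrite det_interp z1 z2; ring.
  by rewrite Hr => /Rmult_integral [] //; clear -hk ht; nra.
have detz s1 t1' : det y (rp z) (aff y (rp gg) (rp z) s1 t1') = - (s1 * det y (rp gg) (rp z)).
  by rewrite /det /aff /=; ring.
have segbase sg : 0 < sg < 1 -> oseg (rp h1) (rp h2) (aff y (rp gg) (rp z) sg 0).
  move=> hsg; have [u [hu eu]] := yh; case: hg => ->.
    exists (u * (1 - sg)); split; first by clear -hu hsg; nra.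
    by rewrite eu /aff /=; f_equal; ring.
  exists (u + sg * (1 - u)); split; first by clear -hu hsg; nra.
  by rewrite eu /aff /=; f_equal; ring.
have end_ok a b : [set a; b] = [set k1; k2] -> a != b -> oseg (rp a) (rp b) r -> exists s' t',
   rp b = aff y (rp gg) (rp z) s' t' /\ (0 < t' < 1 \/ 1 <= s' + t').
  move=> ab abN oab.
  have abT : [set a; b] \in T by rewrite ab.
  have [la lb pr] := edge_data abT.
  have [s' [t' eb]] := aff_surj (rp b) D0.
  exists s', t'; split=> //.
  have noab p : oseg (rp a) (rp b) p -> oseg (rp h1) (rp h2) p -> False.
    move=> p1 p2; apply: (noH p) => //; case: (set2_eq ab) => [] [<- <-] //; exact: oseg_sym.
  have [hin|hout] := classic (0 <= s' /\ 0 <= t' /\ 0 <= 1 - s' - t').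
    have [t0|t0] := Req_dec t' 0.
      have [s1|s1] := Rlt_le_dec s' 1; last by right; lra.
      exfalso; case: hin => [[s0|s0] _].
        by apply: (prh _ lb); rewrite eb t0; apply: segbase.
      apply: (prh _ lb); rewrite eb t0 -s0; case: yh => u [hu eu]; exists u; split=> //.
      by rewrite -eu /aff /= !Rmult_0_l !Rplus_0_r -surjective_pairing.
    have [tt|tt] := Rlt_le_dec t' 1; first by left; lra.
    by right; lra.
  right.
  have X1 : 0 <= k * s by clear -hk spos; nra.
  have X2 : 0 <= k * t by clear -hk ht; nra.
  have X2' : 0 < k * t by clear -hk ht; nra.
  have X3 : 0 <= 1 - k * s - k * t by clear -hk hst spos ht; nra.
  have [m [hm [[A1 A2 A3] B]]] := exit3 X1 X2 X3 hout.
  set qs := k * s + m * (s' - k * s) in A1 B; set qt := k * t + m * (t' - k * t) in A2 B.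
  have oq : oseg (rp a) (rp b) (aff y (rp gg) (rp z) qs qt).
    by have := oseg_interp oab hm; rewrite er' eb aff_mix.
  have A3' : qs + qt <= 1 by rewrite /qs /qt; lra.
  case: B => [] [B1 B2]; last by lra.
  - exfalso; rewrite B2 in oq A3'.
    have [t0|t0] := Req_dec qt 0.
      apply: (noab _ oq); rewrite t0; case: yh => u [hu eu]; exists u; split=> //.
      by rewrite -eu /aff /= !Rmult_0_l !Rplus_0_r -surjective_pairing.
    have [t1'|t1'] := Req_dec qt 1.
      by apply: (pr _ lz); move: oq; rewrite t1' -aff01.
    have oz : oseg y (rp z) (aff y (rp gg) (rp z) 0 qt).
      by exists qt; split; [lra|rewrite /aff; f_equal; ring].
    have [_] := cl a b abT abN _ oz oq.
    rewrite eb detz => q.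
    have : s' * det y (rp gg) (rp z) = 0 by lra.
    by move=> /Rmult_integral [] //; lra.
  - exfalso; rewrite B2 in oq A3'.
    have [s0|s0] := Req_dec qs 0.
      apply: (noab _ oq); rewrite s0; case: yh => u [hu eu]; exists u; split=> //.
      by rewrite -eu /aff /= !Rmult_0_l !Rplus_0_r -surjective_pairing.
    have [s1|s1] := Req_dec qs 1.
      by apply: (pr _ lg); move: oq; rewrite s1 -aff10.
    by apply: (noab _ oq); apply: segbase; lra.
have [s1 [t1' [e1 c1]]] := end_ok k2 k1 (set2C _ _) ltac:(by rewrite eq_sym) (oseg_sym o2).
have [s2 [t2' [e2 c2]]] := end_ok k1 k2 erefl k12 o2.
case: c1 => [c1|c1]; first by exists k1, t1'; split; [left|split=> //; rewrite e1 Haff].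
case: c2 => [c2|c2]; first by exists k2, t2'; split; [right|split=> //; rewrite e2 Haff].
exfalso; have [u [hu eu]] := o2; move: eu; rewrite er' e1 e2 aff_mix => /(aff_inj D0) [q1 q2].
have : k * s + k * t < 1 by clear -hk spos ht hst; nra.
by rewrite q1 q2; clear -hu c1 c2; nra.
Qed.

(** z is a visible point of least height over the edge. Another lattice point of the triangle would
    be hidden; by [lower_endpoint] its nearest obstacle has an end below z, and [visible] then
    produces a visible point below z. An edge through the interior would reach both h1 z and h2 z
    and so cross the sight line yz. *)
Lemma empty_side z0 : Lam0 V z0 -> 0 < H (rp z0) -> clear T y (rp z0) ->
  exists z, [/\ etri V h1 h2 z, 0 < H (rp z), clear T y (rp z) &
    forall a b s t, [set a; b] \in T -> a != b ->
      oseg (rp a) (rp b) (aff (rp h1) (rp h2) (rp z) s t) -> 0 < s -> 0 < t -> s + t < 1 -> False].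
Proof.
move=> lz0 pz0 cz0.
have [lh1 lh2 prh] := edge_data hT.
pose P z := [/\ Lam0 V z, 0 < H (rp z) & clear T y (rp z)].
have [|z [[lz pz cz] zmin]] := finite_argmin (P := P) (fun z => H (rp z)); first by exists z0.
have noz w : Lam0 V w -> ~ oseg y (rp z) (rp w).
  move=> lw ow; have [u [hu eu]] := ow.
  have Hw : H (rp w) = u * H (rp z) by rewrite eu det_interp Hy; ring.
  have : P w by split=> //; [rewrite Hw; clear -hu pz; nra|exact: clear_sub cz].
  by move=> /zmin; rewrite Hw; clear -hu pz; nra.
have [u [hu eu]] := yh.
have D1 : det y (rp h1) (rp z) <> 0.
  have -> : det y (rp h1) (rp z) = - (u * H (rp z)) by rewrite eu /det /=; ring.
  by clear -hu pz; nra.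
have D2 : det y (rp h2) (rp z) <> 0.
  have -> : det y (rp h2) (rp z) = (1 - u) * H (rp z) by rewrite eu /det /=; ring.
  by clear -hu pz; nra.
have D0 : det (rp h1) (rp h2) (rp z) <> 0 by lra.
have D0Z : orient h1 h2 z <> 0%Z by move=> q; apply: D0; rewrite -IZR_orient q.
have emp : forall w, Lam0 V w -> in_ctri h1 h2 z w -> w = h1 \/ w = h2 \/ w = z.
  move=> w0 lw0 hw0.
  have [s [t ew]] := rp_aff w0 D0Z.
  have /(in_ctri_aff D0Z ew) [hs [ht hst]] := hw0.
  apply: NNPP => nw.
  have tpos : 0 < t.
    case: ht => // t0; exfalso; rewrite -t0 in ew hst.
    have [s0|s0] := Req_dec s 0.
      by apply: nw; left; apply: rp_inj; rewrite ew s0 -aff00.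
    have [s1|s1] := Req_dec s 1.
      by apply: nw; right; left; apply: rp_inj; rewrite ew s1 -aff10.
    apply: (prh _ lw0); rewrite ew; exists s; split; first lra.
    by rewrite /aff; f_equal; ring.
  have t1 : t < 1.
    have [//|t1] := Rlt_le_dec t 1; exfalso.
    have [e1 e2] : s = 0 /\ t = 1 by lra.
    by apply: nw; right; right; apply: rp_inj; rewrite ew e1 e2 -aff01.
  have Hw0 : H (rp w0) = t * H (rp z) by rewrite ew det_aff_third det_aa det_bb; ring.
  have ncl : ~ clear T y (rp w0).
    move=> c; have : P w0 by split=> //; rewrite Hw0; clear -tpos pz; nra.
    by move=> /zmin; rewrite Hw0; clear -t1 pz; nra.
  have blk : exists a b r, [/\ [set a; b] \in T, a != b, oseg y (rp w0) r,
      oseg (rp a) (rp b) r & det y (rp w0) (rp a) <> 0].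
    apply: NNPP => nb; apply: ncl => a b abT ab r o1 o2; split; apply: NNPP => q; apply: nb.
      by exists a, b, r.
    exists b, a, r; split=> //; [by rewrite set2C|by rewrite eq_sym|exact: oseg_sym].
  have [k1 [k2 [r [kT k12 [o1 o2] [dk1 dk2] cr]]]] := first_crossing blk.
  (* gg is the end of the base on the same side of the sight line yz as w0. *)
  have [gg [s' [hg [Dg [ew' hs' hst']]]]] : exists gg s', (gg = h1 \/ gg = h2) /\
     det y (rp gg) (rp z) <> 0 /\ [/\ rp w0 = aff y (rp gg) (rp z) s' t, 0 <= s' & s' + t <= 1].
    have [l|l] := Rle_lt_dec s (u * (1 - t)).
      exists h1, (1 - t - s / u); split; [by left|split=> //; split].
      - by rewrite ew eu /aff /=; f_equal; field; lra.
      - apply: (Rmult_le_reg_r u); first lra.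
        by rewrite Rmult_0_l; field_simplify; lra.
      - have : 0 <= s / u by apply: Rle_mult_inv_pos; lra.
        by lra.
    have q : (s - u * (1 - t)) / (1 - u) * (1 - u) = s - u * (1 - t) by field; lra.
    exists h2, ((s - u * (1 - t)) / (1 - u)); split; [by right|split=> //; split].
    - by rewrite ew eu /aff /=; f_equal; field; lra.
    - by apply: Rle_mult_inv_pos; lra.
    - by apply: (Rmult_le_reg_r (1 - u)); [lra|rewrite Rmult_plus_distr_r q; lra].
  have [w2 [t2 [hw2 [Hw2 ht2]]]] :=
    lower_endpoint lz hg Dg cz noz lw0 ew' hs' tpos hst' t1 kT k12 o1 o2.
  have [lk1 lk2 prk] := edge_data kT.
  have lw2 : Lam0 V w2 by case: hw2 => ->.
  have [kk [hkk ekk]] := o1.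
  have Er (w : R * R) : det y r w = kk * det y (rp w0) w by rewrite ekk /det /=; ring.
  have Dw2 : det y r (rp w2) <> 0.
    rewrite Er; have dw2 : det y (rp w0) (rp w2) <> 0 by case: hw2 => ->.
    by move=> /Rmult_integral [] //; lra.
  have rw2 r' : oseg r (rp w2) r' -> oseg (rp k1) (rp k2) r'.
    case: hw2 => -> [m [hm ->]]; last by apply: oseg_interp => //; lra.
    by apply: oseg_sym; apply: oseg_interp; [exact: oseg_sym|lra].
  have dr k : k = k1 \/ k = k2 -> det r (rp w2) (rp k) = 0.
    have q1 : det r (rp k1) (rp k2) = 0 by rewrite -(det_rot r); apply: oseg_det.
    have q2 : det r (rp k2) (rp k1) = 0.
      by have -> : det r (rp k2) (rp k1) = - det r (rp k1) (rp k2); [rewrite /det; ring|lra].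
    by case: hw2 => ->; case=> ->; rewrite ?det_bb.
  (* In the triangle y r w2 the side y r is clear and the side r w2 runs along the blocking edge,
     which gives the hypotheses of [visible]. *)
  have [w [s1 [t3 [lw ew3 [hs1 ht3] hst3 cw]]]] : exists w s t, [/\ Lam0 V w,
      rp w = aff y r (rp w2) s t, 0 <= s /\ 0 < t, s + t <= 1 & clear T y (rp w)].
    apply: (visible pl Dw2 lw2).
      move=> a b abT ab r' hr' or'.
      case: hr' => [q|q]; first by left; apply: (cr a b abT ab r').
      right; have ok : oseg (rp k1) (rp k2) r' by case: q => [->|/rw2].
      by case: (set2_eq (same_edge abT kT ab k12 or' ok)) => [] [-> ->]; split; apply: dr; auto.
    move=> w lw; split; last by move=> q; apply: (prk _ lw); rewrite q.
    move=> ow; have [v [hv ev]] := oseg_sub o1 ow.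
    have Hw : H (rp w) = v * H (rp w0) by rewrite ev det_interp Hy; ring.
    have : P w.
      by split=> //; [rewrite Hw Hw0; clear -hv tpos pz; have := Rmult_lt_0_compat _ _ tpos pz; nra|exact: clear_sub cr].
    move=> /zmin; rewrite Hw Hw0; clear -hv t1 tpos pz.
    have := Rmult_lt_0_compat _ _ tpos pz; nra.
  have Hw : H (rp w) = (s1 * (kk * t) + t3 * t2) * H (rp z).
    by rewrite ew3 det_aff_third Hy Hw2 ekk det_interp Hy Hw0; ring.
  have b1 : 0 < kk * t < 1 by clear -hkk tpos t1; nra.
  have b2 : 0 < s1 * (kk * t) + t3 * t2 < 1 by clear -b1 ht2 hs1 ht3 hst3; nra.
  have : P w by split=> //; rewrite Hw; clear -b2 pz; nra.
  by move=> /zmin; rewrite Hw; clear -b2 pz; nra.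
have et : etri V h1 h2 z by split.
exists z; split=> // a b s t abT ab o hs ht hst.
have [la lb prab] := edge_data abT.
(* [L] vanishes on the line yz; it is negative on h1 z and positive on h2 z, away from z. *)
pose L s' t' := s' - u * (1 - t').
have notbase s' t' : oseg (rp a) (rp b) (aff (rp h1) (rp h2) (rp z) s' t') -> t' = 0 -> 0 < s' < 1 -> False.
  move=> o' t0 hs'.
  have o'' : oseg (rp h1) (rp h2) (aff (rp h1) (rp h2) (rp z) s' t') by apply/(oseg_ab et).
  have [z1 z2] := on_base_eq abT ab o' o''.
  have : H (aff (rp h1) (rp h2) (rp z) s t) = 0.
    by case: o => m [_ ->]; rewrite det_interp z1 z2; ring.
  rewrite det_aff_third det_aa det_bb; clear -ht pz; nra.
have stop c w : Lam0 V w -> prim V c w -> (forall r, oseg (rp c) (rp w) r -> oseg (rp a) (rp b) r) ->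
    oseg (rp c) (rp w) (aff (rp h1) (rp h2) (rp z) s t) ->
    exists sw tw m, rp w = aff (rp h1) (rp h2) (rp z) sw tw /\ 0 < m <= 1 /\
      let s' := s + m * (sw - s) in let t' := t + m * (tw - t) in
      0 <= t' <= 1 /\ (s' = 0 \/ s' + t' = 1).
  move=> lw pr sub oxw; have [sw [tw ew]] := rp_aff w D0Z.
  exists sw, tw.
  have [q|[k [hk [s' [t' [es [et' [ok cs]]]]]]]] :=
    exit_tri et lw pr oxw (Rlt_le _ _ hs) (Rlt_le _ _ ht) (Rlt_le _ _ hst) ew.
    exists 1; split=> //; split; first lra.
    have [e1 e2] : s + 1 * (sw - s) = sw /\ t + 1 * (tw - t) = tw by lra.
    rewrite e1 e2; case: q => [|[|]] q; rewrite q in ew.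
    - rewrite {1}(aff00 (rp h1) (rp h2) (rp z)) in ew; have [<- <-] := aff_inj D0 ew; lra.
    - rewrite {1}(aff10 (rp h1) (rp h2) (rp z)) in ew; have [<- <-] := aff_inj D0 ew; lra.
    - rewrite {1}(aff01 (rp h1) (rp h2) (rp z)) in ew; have [<- <-] := aff_inj D0 ew; lra.
  exists k; split=> //; rewrite /= -es -et'.
  have kpos : 0 < k.
    case: hk => [[//|k0] _]; rewrite -k0 in es et'.
    by case: cs => [] [c1 c2 _]; lra.
  split; first lra.
  case: cs => [] [c1 c2 _]; [lra| |lra].
  by case: (notbase s' t' (sub _ ok)).
have [sa [ta [ma [ea [hma]]]]] := stop b a la (prim_sym prab) (fun r o1 => oseg_sym o1) (oseg_sym o).
have [sb [tb [mb [eb [hmb]]]]] := stop a b lb prab (fun r o1 => o1) o.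
set s1 := s + mb * (sb - s); set t1 := t + mb * (tb - t).
set s2 := s + ma * (sa - s); set t2 := t + ma * (ta - t) => /= q1 q2.
have [m [hm em]] := o; move: em; rewrite ea eb aff_mix => /(aff_inj D0) [em1 em2].
have fin i1 i2 j1 j2 m1 m2 : i1 = sa + m1 * (sb - sa) -> j1 = ta + m1 * (tb - ta) ->
    i2 = sa + m2 * (sb - sa) -> j2 = ta + m2 * (tb - ta) -> 0 <= m1 <= 1 -> 0 <= m2 <= 1 -> m1 <> m2 ->
    0 <= j1 < 1 -> 0 <= j2 < 1 -> 0 < j1 + j2 -> i1 = 0 -> i2 + j2 = 1 -> False.
  move=> ei1 ej1 ei2 ej2 hm1 hm2 m12 hj1 hj2 hy e1 e2.
  have L1 : L i1 j1 < 0 by rewrite /L e1; clear -hu hj1; nra.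
  have L2 : 0 < L i2 j2.
    have -> : i2 = 1 - j2 by lra.
    by rewrite /L; clear -hu hj2; nra.
  pose k := L i1 j1 / (L i1 j1 - L i2 j2).
  have ek : k * (L i1 j1 - L i2 j2) = L i1 j1 by rewrite /k; field; lra.
  have hk : 0 < k < 1 by clear -ek L1 L2; nra.
  have ts : 0 < j1 + k * (j2 - j1) < 1.
    split; last by clear -hk hj1 hj2; nra.
    have [l|l] := Rlt_le_dec 0 j1; first by clear -l hk hj2; nra.
    have e : j1 = 0 by lra.
    by clear -e hk hy; nra.
  have mm : 0 < m1 + k * (m2 - m1) < 1.
    have [l|l] : m1 < m2 \/ m2 < m1 by lra.
      by clear -l hk hm1 hm2; nra.
    by clear -l hk hm1 hm2; nra.
  have xs : i1 + k * (i2 - i1) = u * (1 - (j1 + k * (j2 - j1))).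
    have q : L i1 j1 + k * (L i2 j2 - L i1 j1) = 0 by lra.
    by move: q; rewrite /L => q; clear -q; lra.
  have oq : oseg (rp a) (rp b) (aff (rp h1) (rp h2) (rp z) (i1 + k * (i2 - i1)) (j1 + k * (j2 - j1))).
    exists (m1 + k * (m2 - m1)); split=> //; rewrite ea eb aff_mix ei1 ei2 ej1 ej2.
    by congr aff; ring.
  have oz : oseg y (rp z) (aff (rp h1) (rp h2) (rp z) (i1 + k * (i2 - i1)) (j1 + k * (j2 - j1))).
    exists (j1 + k * (j2 - j1)); split=> //; rewrite xs eu /aff /=; f_equal; ring.
  have [z1 z2] := cz a b abT ab _ oz oq.
  have : det y (rp z) (aff (rp h1) (rp h2) (rp z) i1 j1) = 0.
    rewrite ei1 ej1 -aff_mix -ea -eb det_interp z1 z2; ring.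
  have -> : det y (rp z) (aff (rp h1) (rp h2) (rp z) i1 j1) = - (L i1 j1 * H (rp z)).
    by rewrite eu /L /det /aff /=; ring.
  by clear -L1 pz; nra.
have S1 : s1 = sa + (m + mb * (1 - m)) * (sb - sa) by rewrite /s1 em1; ring.
have T1 : t1 = ta + (m + mb * (1 - m)) * (tb - ta) by rewrite /t1 em2; ring.
have S2 : s2 = sa + (m - ma * m) * (sb - sa) by rewrite /s2 em1; ring.
have T2 : t2 = ta + (m - ma * m) * (tb - ta) by rewrite /t2 em2; ring.
have M1 : m < m + mb * (1 - m) <= 1 by clear -hm hmb; nra.
have M2 : 0 <= m - ma * m < m by clear -hm hma; nra.
have [k [hk [ek1 ek2]]] : exists k, 0 < k < 1 /\ s = s2 + k * (s1 - s2) /\ t = t2 + k * (t1 - t2).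
  have dn : 0 < ma * m + mb * (1 - m) by clear -hm hma hmb; nra.
  have ek : ma * m / (ma * m + mb * (1 - m)) * (ma * m + mb * (1 - m)) = ma * m by field; lra.
  exists (ma * m / (ma * m + mb * (1 - m))); split; first by clear -dn ek hm hma hmb; nra.
  have e1 : s1 - s2 = (ma * m + mb * (1 - m)) * (sb - sa) by rewrite S1 S2; ring.
  have e2 : t1 - t2 = (ma * m + mb * (1 - m)) * (tb - ta) by rewrite T1 T2; ring.
  rewrite e1 e2 -!Rmult_assoc ek S2 T2 em1 em2; split; ring.
have B1 : ~ (s1 = 0 /\ s2 = 0) by move=> [e1 e2]; rewrite ek1 e1 e2 in hs; lra.
have B2 : ~ (s1 + t1 = 1 /\ s2 + t2 = 1).
  move=> [e1 e2]; have : s + t = (s2 + t2) + k * ((s1 + t1) - (s2 + t2)) by rewrite {1}ek1 {1}ek2; ring.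
  by rewrite e1 e2; lra.
have B3 : 0 < t1 + t2.
  have : 0 <= t1 + t2 by lra.
  case=> // q; have [e1 e2] : t1 = 0 /\ t2 = 0 by lra.
  by rewrite ek2 e1 e2 in ht; lra.
case: q1 => r1 [c1|c1]; case: q2 => r2 [c2|c2]; try (by case: B1); try (by case: B2).
- have t1l : t1 < 1 by apply: Rnot_le_lt => q; apply: B2; lra.
  have t2l : t2 < 1 by apply: Rnot_le_lt => q; apply: B1; lra.
  by apply: (fin s1 s2 t1 t2 _ _ S1 T1 S2 T2); try lra.
- have t1l : t1 < 1 by apply: Rnot_le_lt => q; apply: B1; lra.
  have t2l : t2 < 1 by apply: Rnot_le_lt => q; apply: B2; lra.
  by apply: (fin s2 s1 t2 t1 _ _ S2 T2 S1 T1); try lra.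
Qed.

End EmptySide.
End Face.

Lemma mix_pos a b k : 0 < a -> 0 <= b -> 0 <= k <= 1 -> k < 1 \/ 0 < b -> 0 < a + k * (b - a).
Proof.
move=> ha hb hk; have -> : a + k * (b - a) = (1 - k) * a + k * b by ring.
by case=> h; [nra|have [l|l] := Rlt_le_dec k 1; nra].
Qed.

Lemma mix_tri s t s' t' k : 0 < s -> 0 < t -> s + t < 1 -> 0 <= s' -> 0 <= t' -> s' + t' <= 1 ->
  0 <= k <= 1 -> k < 1 \/ (0 < s' /\ 0 < t' /\ s' + t' < 1) ->
  [/\ 0 < s + k * (s' - s), 0 < t + k * (t' - t) & s + k * (s' - s) + (t + k * (t' - t)) < 1].
Proof.
move=> hs ht hst hs' ht' hst' hk h.
have h1 : 0 < s + k * (s' - s) by apply: mix_pos => //; tauto.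
have h2 : 0 < t + k * (t' - t) by apply: mix_pos => //; tauto.
have h3 : 0 < (1 - s - t) + k * ((1 - s' - t') - (1 - s - t)).
  have h' : k < 1 \/ 0 < 1 - s' - t' by case: h; [left|right; lra].
  by apply: mix_pos => //; lra.
by split=> //; lra.
Qed.

(** * Midpoints of edges and their independence of the triangulation *)

Section Midpoints.
Variable n : nat.
Variables (V : seq (pt n)) (xi : {set edge n}).
Hypothesis bc : boundary_cond V xi.
Implicit Types (a b c d z w : pt n) (e f g h : edge n) (p q x y r : R * R).

Lemma emid_eq a b c d : a != b -> c != d -> emid [set a; b] = emid [set c; d] <->
  (px a + px b = px c + px d)%Z /\ (py a + py b = py c + py d)%Z.
Proof.
move=> ab cd; rewrite /emid !big_setU1 ?inE //= !big_set1 /px /py.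
have := (ltn_ord a.1, ltn_ord a.2, ltn_ord b.1, ltn_ord b.2).
have := (ltn_ord c.1, ltn_ord c.2, ltn_ord d.1, ltn_ord d.2).
move=> [[[c1 c2] d1] d2] [[[a1 a2] b1] b2]; split.
  move=> [/(congr1 val) e1 /(congr1 val) e2]; move: e1 e2; rewrite /= !inordK; lia.
move=> [e1 e2]; f_equal; congr inord; lia.
Qed.

Definition rmid a b : R * R := ((rp a).1 + 1/2 * ((rp b).1 - (rp a).1), (rp a).2 + 1/2 * ((rp b).2 - (rp a).2)).

Lemma rmid_oseg a b : oseg (rp a) (rp b) (rmid a b).
Proof. by exists (1/2); split=> //; lra. Qed.

Lemma rmid_eq a b c d : rmid a b = rmid c d <->
  (px a + px b = px c + px d)%Z /\ (py a + py b = py c + py d)%Z.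
Proof.
rewrite /rmid /=; split=> [[e1 e2]|[e1 e2]].
  by split; apply: eq_IZR; rewrite ?(plus_IZR (px _)) ?(plus_IZR (py _)); lra.
move: e1 e2 => /(congr1 IZR) e1 /(congr1 IZR) e2; rewrite !(plus_IZR (px _)) in e1; rewrite !(plus_IZR (py _)) in e2.
by f_equal; lra.
Qed.

Lemma emid_rmid a b c d : a != b -> c != d ->
  emid [set a; b] = emid [set c; d] <-> rmid a b = rmid c d.
Proof. by move=> ab cd; rewrite (emid_eq ab cd) rmid_eq. Qed.

(** If the midpoint of cd were in ab but nearer to a than to b, the reflection of a in it would be a
    lattice point in the interior of ab. *)
Lemma half_point a b c d : a != b -> admissible V [set a; b] ->
  oseg (rp a) (rp b) (rmid c d) -> rmid a b = rmid c d.
Proof.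
have half a' b' t : a' != b' -> admissible V [set a'; b'] -> 0 < t < 1/2 ->
    rmid c d = ((rp a').1 + t * ((rp b').1 - (rp a').1), (rp a').2 + t * ((rp b').2 - (rp a').2)) -> False.
  move=> ab /adm_set2 [[_ la lb hin] pr] ht e.
  have [E1 E2] : IZR (px c + px d - px a') = IZR (px a') + 2 * t * (IZR (px b') - IZR (px a')) /\
     IZR (py c + py d - py a') = IZR (py a') + 2 * t * (IZR (py b') - IZR (py a')).
    move: e; rewrite /rmid /= => [] [e1 e2]; rewrite (minus_IZR (px c + px d)) (minus_IZR (py c + py d)) (plus_IZR (px c)) (plus_IZR (py c)); split; lra.
  have bd u v (w m : Z) : (- m <= u <= m)%Z -> (- m <= v <= m)%Z -> IZR w = IZR u + 2 * t * (IZR v - IZR u) -> (- m <= w <= m)%Z.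
    move=> [/IZR_le u1 /IZR_le u2] [/IZR_le v1 /IZR_le v2] ew; rewrite opp_IZR in u1 v1.
    split; apply: le_IZR; rewrite ?opp_IZR ew; clear -ht u1 u2 v1 v2; nra.
  have [w [w1 w2]] := pt_ex (bd _ _ _ _ (px_bd a') (px_bd b') E1) (bd _ _ _ _ (py_bd a') (py_bd b') E2).
  have ow : oseg (rp a') (rp b') (rp w).
    by exists (2 * t); split; [lra|rewrite {1}/rp w1 w2 E1 E2].
  by apply: (pr w) => //; apply: hin.
move=> ab adm [t [ht e]].
have [l|[q|g]] := Rtotal_order t (1/2).
- by case: (half a b t ab adm _ e); lra.
- by rewrite e q.
- have ba : b != a by rewrite eq_sym.
  have adm' : admissible V [set b; a] by rewrite set2C.
  case: (half b a (1 - t) ba adm'); first lra.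
  by rewrite e; f_equal; ring.
Qed.

Section Covered.
Variable T : {set edge n}.
Hypothesis oT : Omega V xi T.
Let pl := Omega_planar oT.
Let sd s : s \in sides V -> [set s.1; s.2] \in T. Proof. exact: (Omega_sides bc oT). Qed.

Lemma maximal_in e : admissible V e -> (forall h, h \in T -> ~ meet h e) -> e \in T.
Proof.
move=> ae nm; apply: contraT => ne.
by have [h [hT hm]] := (proj2 (proj2 (proj1 oT))) e ae ne; case: (nm h hT).
Qed.

(** A missing side h1 z or h2 z would be admissible and meet no edge of [T], against maximality. So
    this is a triangle of [T], hence of area 1/2, and the path from y to X, which meets neither
    edges nor lattice points of P, cannot leave it. *)
Lemma face_at (h1 h2 : pt n) y z (X : R * R) : [set h1; h2] \in T -> h1 != h2 -> oseg (rp h1) (rp h2) y ->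
  etri V h1 h2 z -> 0 < det (rp h1) (rp h2) (rp z) ->
  (forall a b s t, [set a; b] \in T -> a != b ->
      oseg (rp a) (rp b) (aff (rp h1) (rp h2) (rp z) s t) -> 0 < s -> 0 < t -> s + t < 1 -> False) ->
  0 < det (rp h1) (rp h2) X ->
  (forall k, 0 < k <= 1 -> let p := (y.1 + k * (X.1 - y.1), y.2 + k * (X.2 - y.2)) in
     [/\ inP V p, forall h, h \in T -> ~ segpt h p & forall w, Lam0 V w -> rp w <> p]) ->
  Z.abs (orient h1 h2 z) = 1%Z /\ exists s t, [/\ X = aff (rp h1) (rp h2) (rp z) s t, 0 < s, 0 < t & s + t < 1].
Proof.
move=> hT h12 yh et pz intfree pX good.
have [D0 lh1 lh2 lz emp] := et; have [_ h2z h1z D0'] := orient_neq0 D0.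
have [u [hu eu]] := yh.
have ey : y = aff (rp h1) (rp h2) (rp z) u 0 by rewrite eu /aff /=; f_equal; ring.
have [sX [tX eX]] := aff_surj X D0'.
have tXp : 0 < tX.
  move: pX; rewrite eX det_aff_third det_aa det_bb => q; clear -q pz; nra.
have inter k : (y.1 + k * (X.1 - y.1), y.2 + k * (X.2 - y.2)) =
    aff (rp h1) (rp h2) (rp z) (u + k * (sX - u)) (0 + k * (tX - 0)).
  by rewrite ey eX aff_mix.
(* [k0] picks a point of the path just inside the triangle. It is known to be in P and is the base
   point from which membership spreads over the open triangle. *)
have [k0 [hk0 [K1 K2 K3]]] : exists k, 0 < k < 1 /\ [/\ 0 < u + k * (sX - u), 0 < 0 + k * (tX - 0) & 0 < (1 - u) + k * ((1 - sX - tX) - (1 - u))].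
  by apply: enter3; [left; lra|right; lra|left; lra].
set sm := u + k0 * (sX - u) in K1; set tm := 0 + k0 * (tX - 0) in K2.
have K3' : sm + tm < 1 by rewrite /sm /tm; lra.
have [gm1 gm2 gm3] : [/\ inP V (aff (rp h1) (rp h2) (rp z) sm tm),
   forall h, h \in T -> ~ segpt h (aff (rp h1) (rp h2) (rp z) sm tm) &
   forall w, Lam0 V w -> rp w <> (aff (rp h1) (rp h2) (rp z) sm tm)].
  by rewrite /sm /tm -inter; apply: good; lra.
have intfree' h s t : h \in T -> segpt h (aff (rp h1) (rp h2) (rp z) s t) -> 0 < s -> 0 < t -> s + t < 1 -> False.
  move=> hhT; have [a [b [eh ab]]] := adm_ex (proj1 pl _ hhT); rewrite eh in hhT *.
  by move=> /segpt_set2 [_ o]; apply: intfree o.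
have openin s t : 0 < s -> 0 < t -> s + t < 1 -> inP V (aff (rp h1) (rp h2) (rp z) s t).
  move=> hs ht hst; apply: (inP_free gm1) => r [k [hk]]; rewrite aff_mix => er.
  have [M1 M2 M3] := mix_tri K1 K2 K3' (Rlt_le _ _ hs) (Rlt_le _ _ ht) (Rlt_le _ _ hst) hk (or_intror (conj hs (conj ht hst))).
  apply: (free_planar pl sd).
    by move=> w lw ew; rewrite er in ew; apply: (etri_open_not_Lam0 et (esym ew)) lw.
  by move=> h hhT hh; rewrite er in hh; apply: (intfree' h _ _ hhT hh).
have sideT i v : i = h1 /\ v = h2 \/ i = h2 /\ v = h1 -> [set i; z] \in T.
  move=> hi; apply: contraT => nT.
  have iz : i != z by case: hi => [] [-> _].
  have li : Lam0 V i by case: hi => [] [-> _].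
  have co s t : oseg (rp i) (rp z) (aff (rp h1) (rp h2) (rp z) s t) ->
      (s = 0 /\ 0 < t < 1 /\ i = h1) \/ (s + t = 1 /\ 0 < t < 1 /\ i = h2).
    by case: hi => [] [-> _]; [move=> /(oseg_ac et)|move=> /(oseg_bc et)]; tauto.
  have piz : prim V i z.
    move=> w lw; have [s [t ew]] := rp_aff w D0; rewrite ew => ow.
    have hw : in_ctri h1 h2 z w by apply/(in_ctri_aff D0 ew); case: (co _ _ ow); lra.
    case: (emp w lw hw) => [|[|]] q; rewrite q in ew.
    - by rewrite {1}(aff00 (rp h1) (rp h2) (rp z)) in ew; have [? ?] := aff_inj D0' ew; case: (co _ _ ow); lra.
    - by rewrite {1}(aff10 (rp h1) (rp h2) (rp z)) in ew; have [? ?] := aff_inj D0' ew; case: (co _ _ ow); lra.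
    - by rewrite {1}(aff01 (rp h1) (rp h2) (rp z)) in ew; have [? ?] := aff_inj D0' ew; case: (co _ _ ow); lra.
  have nomeet h r : h \in T -> segpt h r -> oseg (rp i) (rp z) r -> False.
    move=> hhT; have [a [b [eh ab]]] := adm_ex (proj1 pl _ hhT); rewrite eh in hhT *.
    move=> /segpt_set2 [_ o1] o2.
    have [la lb prab] := edge_data pl hhT.
    have ne : [set i; z] <> [set a; b] by move=> q; move: nT; rewrite q hhT.
    have sg := segs_straddle iz ab li lz la lb piz prab o2 o1 ne.
    have [s [t er]] := aff_surj r D0'; rewrite er in o1 o2.
    have cr := co _ _ o2.
    have fin c d : (forall r, oseg (rp c) (rp d) r -> oseg (rp a) (rp b) r) -> oseg (rp c) (rp d) (aff (rp h1) (rp h2) (rp z) s t) ->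
       (forall se te, rp d = aff (rp h1) (rp h2) (rp z) se te -> (i = h1 -> 0 < se) /\ (i = h2 -> se + te < 1)) -> False.
      move=> sub ocd hd; have [s' [t' ed]] := aff_surj (rp d) D0'.
      have [d1 d2] := hd _ _ ed.
      have [k [hk [Q1 Q2 Q3]]] : exists k, 0 < k < 1 /\ [/\ 0 < s + k * (s' - s), 0 < t + k * (t' - t) & 0 < (1 - s - t) + k * ((1 - s' - t') - (1 - s - t))].
        apply: enter3; first by case: cr => [] [q1 [q2 q3]]; [right; split=> //; apply: d1|left; lra].
          by case: cr; left; lra.
        by case: cr => [] [q1 [q2 q3]]; [left; lra|right; split; [lra|have := d2 q3; lra]].
      have oq := sub _ (oseg_interp ocd (conj (Rlt_le _ _ (proj1 hk)) (proj2 hk))).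
      rewrite ed aff_mix in oq; apply: (intfree _ _ _ _ hhT ab oq) => //; lra.
    have dE w s' t' : rp w = aff (rp h1) (rp h2) (rp z) s' t' ->
       det (rp i) (rp z) (rp w) = (if i == h1 then - s' else 1 - s' - t') * det (rp h1) (rp h2) (rp z).
      move=> ->; case: hi => [] [-> _]; first by rewrite eqxx /det /aff /=; ring.
      by rewrite eq_sym (negbTE h12) /det /aff /=; ring.
    have [sa [ta ea]] := aff_surj (rp a) D0'; have [sb [tb eb]] := aff_surj (rp b) D0'.
    rewrite (dE _ _ _ ea) (dE _ _ _ eb) in sg.
    have h21 : h2 == h1 = false by rewrite eq_sym (negbTE h12).
    have sg' : (if i == h1 then - sa else 1 - sa - ta) * (if i == h1 then - sb else 1 - sb - tb) < 0.
      by move: sg; move: (if _ then _ else _) (if _ then _ else _) => A B q; clear -q pz; nra.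
    have [posb|nposb] : (i = h1 -> 0 < sb) /\ (i = h2 -> sb + tb < 1) \/ (i = h1 -> 0 < sa) /\ (i = h2 -> sa + ta < 1).
      move: sg'; case: hi => [] [ei _]; rewrite ei ?eqxx ?h21 => sg'.
        have [l|l] := Rlt_le_dec 0 sb; [left|right]; split=> // q; try (by move: h12; rewrite q eqxx).
        by clear -sg' l; nra.
      have [l|l] := Rlt_le_dec (sb + tb) 1; [left|right]; split=> // q; try (by move: h12; rewrite q eqxx).
      by clear -sg' l; nra.
    - apply: (fin a b) => // se te; rewrite eb => /(aff_inj D0') [<- <-] //.
    - apply: (fin b a) => //; [by move=> r'; apply: oseg_sym|exact: oseg_sym|].
      by move=> se te; rewrite ea => /(aff_inj D0') [<- <-].
  apply: contraR nT => _; apply: maximal_in.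
    apply/adm_set2; split=> //; split=> // r orr.
    have [s [t er]] := aff_surj r D0'; rewrite er in orr *.
    have cr := co _ _ orr.
    apply: (inP_free gm1) => r' [k [hk]]; rewrite aff_mix => er'.
    have [k1|k1] := Req_dec k 1.
      move: er'; have -> : sm + k * (s - sm) = s by rewrite k1; ring.
      have -> : tm + k * (t - tm) = t by rewrite k1; ring.
      move=> ->; apply: (free_planar pl sd).
        by move=> w lw ew; apply: (piz w lw); rewrite -ew.
      by move=> h hhT hh; apply: (nomeet h _ hhT hh).
    have [Y1 [Y2 Y3]] : 0 <= s /\ 0 <= t /\ s + t <= 1 by case: cr => [] [q1 [q2 _]]; lra.
    have kl : k < 1 by lra.
    have [M1 M2 M3] := mix_tri K1 K2 K3' Y1 Y2 Y3 hk (or_introl kl).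
    apply: (free_planar pl sd).
      by move=> w lw ew; rewrite er' in ew; apply: (etri_open_not_Lam0 et (esym ew)) lw.
    by move=> h hhT hh; rewrite er' in hh; apply: (intfree' h _ _ hhT hh).
  move=> h hhT [r [r1 /segpt_set2 [_ r2]]]; exact: (nomeet h r).
have t1 : [set h1; z] \in T by apply: (sideT h1 h2); left.
have t2 : [set h2; z] \in T by apply: (sideT h2 h1); right.
have tr : tri V T h1 h2 z by [].
split; first by apply: (unimodular et); apply: (tri_lattice_Lam0 pl tr).
have nob k s t : 0 <= k <= 1 -> s = sm + k * (sX - sm) -> t = tm + k * (tX - tm) ->
    0 <= s -> s + t <= 1 -> s = 0 \/ s + t = 1 -> False.
  move=> hk es ett hs hst hb.
  have tp : 0 < t by rewrite ett; apply: mix_pos; lra.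
  have hk' : 0 < k0 + k * (1 - k0) <= 1 by clear -hk hk0; nra.
  have [g1 g2 g3] := good _ hk'; rewrite inter in g1 g2 g3.
  have e1 : u + (k0 + k * (1 - k0)) * (sX - u) = s by rewrite es /sm; ring.
  have e2 : 0 + (k0 + k * (1 - k0)) * (tX - 0) = t by rewrite ett /tm; ring.
  rewrite e1 e2 in g1 g2 g3.
  have [tt|tt] := Req_dec t 1.
    have s0 : s = 0 by lra.
    by apply: (g3 z lz); rewrite s0 tt -aff01.
  case: hb => hb.
    by apply: (g2 _ t1); apply/segpt_set2; split=> //; apply/(oseg_ac et); lra.
  by apply: (g2 _ t2); apply/segpt_set2; split=> //; apply/(oseg_bc et); lra.
have [hin|hout] := classic (0 <= sX /\ 0 <= tX /\ 0 <= 1 - sX - tX).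
  exists sX, tX; split=> //; apply: Rnot_le_lt => q; apply: (nob 1 sX tX); lra.
have [k [hk [[A1 A2 A3] B]]] := exit3 (Rlt_le _ _ K1) (Rlt_le _ _ K2) (Rlt_le 0 (1 - sm - tm) ltac:(lra)) hout.
case: B => [] [B1 B2]; [|lra|]; exfalso;
  by apply: (nob k (sm + k * (sX - sm)) (tm + k * (tX - tm))) => //; lra.
Qed.

(** y is the crossing of e0 with [T] nearest to the midpoint, so the way from y to the midpoint is
    free. [empty_side] and [face_at] put the midpoint in an open unimodular triangle, where its
    doubled coordinates would be positive integers of sum below 2. *)
Lemma covered_aux a0 b0 (h1 h2 : pt n) tau0 : admissible V [set a0; b0] -> a0 != b0 ->
  [set h1; h2] \in T -> h1 != h2 -> 1/2 < tau0 < 1 ->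
  let P tau := ((rp a0).1 + tau * ((rp b0).1 - (rp a0).1), (rp a0).2 + tau * ((rp b0).2 - (rp a0).2)) in
  oseg (rp h1) (rp h2) (P tau0) -> 0 < det (rp h1) (rp h2) (rp a0) ->
  (forall c d tau, [set c; d] \in T -> c != d -> 0 < tau < 1 -> oseg (rp c) (rp d) (P tau) ->
     tau0 <= tau \/ tau <= 1 - tau0) -> False.
Proof.
move=> adm0 ab0 hT h12 ht P yh pa near.
have /adm_set2 [[_ la lb hin] pr0] := adm0.
set y := P tau0 in yh.
have Hy := oseg_det yh.
have oP tau : 0 < tau < 1 -> oseg (rp a0) (rp b0) (P tau) by move=> q; exists tau.
have PE k : (y.1 + k * ((rp a0).1 - y.1), y.2 + k * ((rp a0).2 - y.2)) = P (tau0 * (1 - k)).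
  by rewrite /y /P /=; f_equal; ring.
(* A visible point on the a0 side: a0 itself or, when it is hidden, a point found by [visible] from
   an end of the nearest obstacle that lies above the base. *)
have [z0 [lz0 pz0 cz0]] : exists z0, [/\ Lam0 V z0, 0 < det (rp h1) (rp h2) (rp z0) & clear T y (rp z0)].
  have [bl|nb] := classic (exists a b r, [/\ [set a; b] \in T, a != b, oseg y (rp a0) r,
      oseg (rp a) (rp b) r & det y (rp a0) (rp a) <> 0]); last first.
    exists a0; split=> // a b abT ab r o1 o2; split; apply: NNPP => q; apply: nb.
      by exists a, b, r.
    exists b, a, r; split=> //; [by rewrite set2C|by rewrite eq_sym|exact: oseg_sym].
  have [k1 [k2 [r [kT k12 [o1 o2] [dk1 dk2] cr]]]] := first_crossing bl.
  have [kk [hkk er]] := o1.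
  have Er (w : R * R) : det y r w = kk * det y (rp a0) w by rewrite er /det /=; ring.
  have Hr : 0 < det (rp h1) (rp h2) r by rewrite er det_interp Hy; clear -hkk pa; nra.
  have sub0 p : oseg y r p -> oseg (rp a0) (rp b0) p.
    move=> /(oseg_sub o1) [m [hm ->]]; rewrite PE; apply: oP; clear -hm ht; nra.
  have r0 : oseg (rp a0) (rp b0) r by rewrite er PE; apply: oP; clear -hkk ht; nra.
  have [w2 [hw2 Hw2]] : exists w2, (w2 = k1 \/ w2 = k2) /\ 0 < det (rp h1) (rp h2) (rp w2).
    have [m [hm em]] := o2; rewrite em det_interp in Hr.
    have [l|l] := Rlt_le_dec 0 (det (rp h1) (rp h2) (rp k1)); first by exists k1; auto.
    by exists k2; split; [right|clear -Hr hm l; nra].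
  have [lk1 lk2 prk] := edge_data pl kT.
  have lw2 : Lam0 V w2 by case: hw2 => ->.
  have Dw2 : det y r (rp w2) <> 0.
    rewrite Er; have dw2 : det y (rp a0) (rp w2) <> 0 by case: hw2 => ->.
    by move=> /Rmult_integral [] //; lra.
  have rw2 r' : oseg r (rp w2) r' -> oseg (rp k1) (rp k2) r'.
    case: hw2 => -> [m [hm ->]]; last by apply: oseg_interp => //; lra.
    by apply: oseg_sym; apply: oseg_interp; [exact: oseg_sym|lra].
  have dr k : k = k1 \/ k = k2 -> det r (rp w2) (rp k) = 0.
    have q1 : det r (rp k1) (rp k2) = 0 by rewrite -(det_rot r); apply: oseg_det.
    have q2 : det r (rp k2) (rp k1) = 0.
      by have -> : det r (rp k2) (rp k1) = - det r (rp k1) (rp k2); [rewrite /det; ring|lra].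
    by case: hw2 => ->; case=> ->; rewrite ?det_bb.
  have [w [s [t [lw ew [hs htt] hst cw]]]] : exists w s t, [/\ Lam0 V w,
      rp w = aff y r (rp w2) s t, 0 <= s /\ 0 < t, s + t <= 1 & clear T y (rp w)].
    apply: (visible pl Dw2 lw2).
      move=> a b abT ab r' hr' or'.
      case: hr' => [q|q]; first by left; apply: (cr a b abT ab r').
      right; have ok : oseg (rp k1) (rp k2) r' by case: q => [->|/rw2].
      by case: (set2_eq (same_edge pl abT kT ab k12 or' ok)) => [] [-> ->]; split; apply: dr; auto.
    move=> w lw; split; first by move=> /sub0; apply: pr0.
    by move=> q; apply: (pr0 w lw); rewrite q.
  exists w; split=> //; rewrite ew det_aff_third Hy; clear -hs htt Hr Hw2; nra.
have [z [et pz cz free]] := empty_side pl hT h12 yh lz0 pz0 cz0.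
have XE : rmid a0 b0 = P (1/2) by [].
have yX k : (y.1 + k * ((P (1/2)).1 - y.1), y.2 + k * ((P (1/2)).2 - y.2)) = P (tau0 + k * (1/2 - tau0)).
  by rewrite /y /P /=; f_equal; ring.
have pX : 0 < det (rp h1) (rp h2) (P (1/2)).
  have -> : P (1/2) = P (tau0 * (1 - (1 - 1 / (2 * tau0)))) by congr P; field; lra.
  rewrite -PE det_interp Hy; have : 1 / (2 * tau0) < 1.
    by apply: (Rmult_lt_reg_r (2 * tau0)); [lra|field_simplify; lra].
  by move=> q; clear -q pa; nra.
have [uni [s [t [eX hs htt hst]]]] :
    Z.abs (orient h1 h2 z) = 1%Z /\ exists s t, [/\ P (1/2) = aff (rp h1) (rp h2) (rp z) s t, 0 < s, 0 < t & s + t < 1].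
  apply: (face_at hT h12 yh et pz free pX) => k hk; rewrite yX.
  have hk' : 1/2 <= tau0 + k * (1/2 - tau0) < tau0 by clear -hk ht; nra.
  split.
  - by apply: hin; apply: oP; lra.
  - move=> h hhT; have [c [d [eh cd]]] := adm_ex (proj1 pl _ hhT); rewrite eh in hhT *.
    by move=> /segpt_set2 [_ o]; case: (near _ _ _ hhT cd _ o); lra.
  - by move=> w lw ew; apply: (pr0 w lw); rewrite ew; apply: oP; lra.
have [i [j /zcoord_aff za]] := zcoord_ex a0 uni.
have [i' [j' /zcoord_aff zb]] := zcoord_ex b0 uni.
have [D0 _ _ _ _] := et; have [_ _ _ D0'] := orient_neq0 D0.
move: eX; rewrite /P za zb aff_mix => /(aff_inj D0') [es ett].
have s1 : 0 < IZR (i + i') by rewrite plus_IZR; lra.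
have t1 : 0 < IZR (j + j') by rewrite plus_IZR; lra.
have st1 : IZR (i + i' + (j + j')) < 2 by rewrite !plus_IZR; lra.
move: s1 t1 st1 => /lt_IZR s1 /lt_IZR t1 /lt_IZR st1; lia.
Qed.

(** Among the edges of [T] crossing e0, which exist by maximality, take one crossing nearest to the
    midpoint. A crossing at the midpoint itself would cover it by [half_point]; the other cases
    reduce to [covered_aux] after exchanging ends. *)
Lemma midpoint_covered e0 : admissible V e0 -> exists e, e \in T /\ emid e = emid e0.
Proof.
move=> adm0; apply: NNPP => none.
have [a0 [b0 [e0E ab0]]] := adm_ex adm0; rewrite e0E in adm0 none.
have /adm_set2 [[_ la lb hin] pr0] := adm0.
have e0T : [set a0; b0] \notin T by apply/negP => q; apply: none; exists [set a0; b0].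
pose P tau := ((rp a0).1 + tau * ((rp b0).1 - (rp a0).1), (rp a0).2 + tau * ((rp b0).2 - (rp a0).2)).
have str c d tau : [set c; d] \in T -> c != d -> 0 < tau < 1 -> oseg (rp c) (rp d) (P tau) ->
    det (rp c) (rp d) (rp a0) * det (rp c) (rp d) (rp b0) < 0.
  move=> cdT cd htau o; have [lc ld pcd] := edge_data pl cdT.
  apply: (segs_straddle cd ab0 lc ld la lb pcd pr0 o); first by exists tau.
  by move=> q; move: e0T; rewrite -q cdT.
pose Q (cd : pt n * pt n) := [/\ [set cd.1; cd.2] \in T, cd.1 != cd.2 &
   exists tau, 0 < tau < 1 /\ oseg (rp cd.1) (rp cd.2) (P tau)].
pose G (cd : pt n * pt n) := det (rp cd.1) (rp cd.2) (rp a0) / (det (rp cd.1) (rp cd.2) (rp a0) - det (rp cd.1) (rp cd.2) (rp b0)).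
have GE c d tau : [set c; d] \in T -> c != d -> 0 < tau < 1 -> oseg (rp c) (rp d) (P tau) -> G (c, d) = tau.
  move=> cdT cd htau o; have sg := str c d tau cdT cd htau o.
  have := oseg_det o; rewrite det_interp /G /= => q.
  have D : det (rp c) (rp d) (rp a0) - det (rp c) (rp d) (rp b0) <> 0.
    by move=> q1; clear -sg q1; nra.
  by apply: (Rmult_eq_reg_r (det (rp c) (rp d) (rp a0) - det (rp c) (rp d) (rp b0))) => //; field_simplify; [lra|].
have [|[h1 h2] [[/= hT h12 [tau0 [ht0 oh]]] hmin]] := finite_argmin (P := Q) (fun cd => Rabs (G cd - 1/2)).
  have [h [hT [p [p1 /segpt_set2 [_ [tau [htau ep]]]]]]] := (proj2 (proj2 (proj1 oT))) _ adm0 e0T.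
  have [c [d [eh cd]]] := adm_ex (proj1 pl _ hT); rewrite eh in hT p1.
  exists (c, d); split=> //; exists tau; split=> //.
  by move: p1 => /segpt_set2 [_]; rewrite ep.
have near c d tau : [set c; d] \in T -> c != d -> 0 < tau < 1 -> oseg (rp c) (rp d) (P tau) ->
    Rabs (tau0 - 1/2) <= Rabs (tau - 1/2).
  move=> cdT cd htau o; have := hmin (c, d).
  by rewrite (GE h1 h2 tau0 hT h12 ht0 oh) (GE c d tau cdT cd htau o); apply; split=> //; exists tau.
have notmid : tau0 <> 1/2.
  move=> q; apply: none; exists [set h1; h2]; split=> //.
  apply/(emid_rmid h12 ab0); apply: (half_point h12 (proj1 pl _ hT)).
  by move: oh; rewrite q.
have sg := str h1 h2 tau0 hT h12 ht0 oh.
have go a' b' tau' : [set a'; b'] = [set a0; b0] -> a' != b' -> 1/2 < tau' < 1 ->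
   (forall tau, ((rp a').1 + tau * ((rp b').1 - (rp a').1), (rp a').2 + tau * ((rp b').2 - (rp a').2)) = P tau) \/
   (forall tau, ((rp a').1 + tau * ((rp b').1 - (rp a').1), (rp a').2 + tau * ((rp b').2 - (rp a').2)) = P (1 - tau)) ->
   oseg (rp h1) (rp h2) ((rp a').1 + tau' * ((rp b').1 - (rp a').1), (rp a').2 + tau' * ((rp b').2 - (rp a').2)) ->
   Rabs (tau0 - 1/2) = tau' - 1/2 -> det (rp h1) (rp h2) (rp a') <> 0 -> False.
  move=> eab abN htau' PP oh' eqt dn.
  have near' c d tau : [set c; d] \in T -> c != d -> 0 < tau < 1 -> oseg (rp c) (rp d)
      ((rp a').1 + tau * ((rp b').1 - (rp a').1), (rp a').2 + tau * ((rp b').2 - (rp a').2)) -> tau' <= tau \/ tau <= 1 - tau'.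
    move=> cdT cd htau o.
    have : Rabs (tau0 - 1/2) <= Rabs (tau - 1/2).
      case: PP => PP; rewrite PP in o; first exact: near o.
      have -> : Rabs (tau - 1/2) = Rabs (1 - tau - 1/2) by rewrite -Rabs_Ropp; congr Rabs; lra.
      by apply: near o => //; lra.
    by rewrite eqt /Rabs; case: Rcase_abs; lra.
  have adm' : admissible V [set a'; b'] by rewrite eab.
  have [l|l] := Rlt_le_dec 0 (det (rp h1) (rp h2) (rp a')).
    exact: (covered_aux adm' abN hT h12 htau' oh' l near').
  have hT' : [set h2; h1] \in T by rewrite set2C.
  have h21 : h2 != h1 by rewrite eq_sym.
  have l' : 0 < det (rp h2) (rp h1) (rp a') by rewrite det_swap; lra.
  exact: (covered_aux adm' abN hT' h21 htau' (oseg_sym oh') l' near').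
have [l|l] : tau0 < 1/2 \/ 1/2 < tau0 by lra.
  have PP tau : ((rp b0).1 + tau * ((rp a0).1 - (rp b0).1), (rp b0).2 + tau * ((rp a0).2 - (rp b0).2)) = P (1 - tau).
    by rewrite /P; f_equal; ring.
  apply: (go b0 a0 (1 - tau0)); [exact: set2C|by rewrite eq_sym|lra|by right| | |].
  - by rewrite PP; have -> : 1 - (1 - tau0) = tau0 by ring.
  - by rewrite /Rabs; case: Rcase_abs; lra.
  - by move=> q; rewrite q in sg; lra.
apply: (go a0 b0 tau0) => //; [lra|by left| |].
- by rewrite /Rabs; case: Rcase_abs; lra.
- by move=> q; rewrite q in sg; lra.
Qed.

Lemma emid_inj : {in T &, injective (@emid n)}.
Proof.
move=> e f eT fT em.
have [a [b [eE ab]]] := adm_ex (proj1 pl _ eT); have [c [d [fE cd]]] := adm_ex (proj1 pl _ fT).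
rewrite eE fE in em eT fT *.
have q := proj1 (emid_rmid ab cd) em.
by apply: (same_edge pl eT fT ab cd (rmid_oseg a b)); rewrite q; apply: rmid_oseg.
Qed.

(** [Lambda] collects the midpoints of all triangulations; this identity turns every sum over
    midpoints into a sum over the edges of the current state. *)
Lemma Lambda_emid : Lambda V = [set emid e | e in T].
Proof.
apply/setP => x; rewrite inE; apply/pbP/imsetP.
  move=> [T' [trT' [e [eT' ex]]]].
  have [f [fT ef]] := midpoint_covered (proj1 trT' _ eT').
  by exists f; rewrite // ef.
by move=> [e eT ->]; exists T; split; [exact: (proj1 oT)|exists e].
Qed.

Lemma card_Lambda : #|Lambda V| = #|T|.
Proof. by rewrite Lambda_emid card_in_imset //; apply: emid_inj. Qed.

End Covered.
End Midpoints.

(** * Edge lengths and parents *)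

Local Open Scope Z_scope.

Definition len1 (x y : Z) : Z := Z.abs x + Z.abs y.

Lemma abs_add_same x y : 0 <= x * y -> Z.abs (x + y) = Z.abs x + Z.abs y.
Proof. by move=> h; have [?|?] := Z_le_gt_dec 0 x; have [?|?] := Z_le_gt_dec 0 y; nia. Qed.

(** If the two coordinate differences have the same sign, equality holds without the 2. With
    strictly opposite signs the determinant forces both to be 1 in absolute value. *)
Lemma nonneg_uni a b c d : 0 <= a -> 0 <= b -> 0 <= c -> 0 <= d -> Z.abs (a * d - b * c) = 1 ->
  Z.abs (a - c) + Z.abs (b - d) <= Z.abs (a + b - (c + d)) + 2.
Proof.
have key s t x y : 1 <= s -> 1 <= t -> 0 <= x -> 0 <= y -> (x + s) * (y + t) - y * x <= 1 -> s = 1 /\ t = 1.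
  move=> hs ht hx hy; have -> : (x + s) * (y + t) - y * x = x * t + s * y + s * t by ring.
  have h1 : 0 <= x * t by apply: Z.mul_nonneg_nonneg; lia.
  have h2 : 0 <= s * y by apply: Z.mul_nonneg_nonneg; lia.
  by nia.
move=> ha hb hc hd U.
have [ac|ac] := Z_le_gt_dec a c; have [bd|bd] := Z_le_gt_dec b d; try (clear -ac bd; lia).
- have E : (a + (c - a)) * (d + (b - d)) - d * a = - (a * d - b * c) by ring.
  have := key (c - a) (b - d) a d; rewrite E; lia.
- have E : (c + (a - c)) * (b + (d - b)) - b * c = a * d - b * c by ring.
  have := key (a - c) (d - b) c b; rewrite E; lia.
Qed.

Section Quadrant.
Variables u1 u2 v1 v2 : Z.
Hypothesis uni : Z.abs (u1 * v2 - u2 * v1) = 1.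

(** If u1 v1 > 0 > u2 v2, then u1 v2 and u2 v1 have opposite signs and the determinant is at least 2
    in absolute value. If one product is negative and the other is not positive, u - v is longer
    than u + v. *)
Lemma quadrant : len1 (u1 - v1) (u2 - v2) <= len1 (u1 + v1) (u2 + v2) ->
  0 <= u1 * v1 /\ 0 <= u2 * v2.
Proof.
rewrite /len1 => h.
have [a1|a1] := Z_le_gt_dec 0 (u1 * v1); have [a2|a2] := Z_le_gt_dec 0 (u2 * v2) => //; exfalso.
- have [a3|a3] := Z_le_gt_dec (u1 * v1) 0.
    have e1 : Z.abs (u1 - v1) = Z.abs (u1 + v1) by nia.
    have e2 : Z.abs (u2 - v2) = Z.abs u2 + Z.abs v2.
      by rewrite -(Z.abs_opp v2) -abs_add_same; [congr Z.abs; lia|nia].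
    have : Z.abs (u2 + v2) < Z.abs u2 + Z.abs v2 by nia.
    by lia.
  by have : (u1 * v2) * (u2 * v1) < 0 by [nia]; nia.
- have [a3|a3] := Z_le_gt_dec (u2 * v2) 0.
    have e1 : Z.abs (u2 - v2) = Z.abs (u2 + v2) by nia.
    have e2 : Z.abs (u1 - v1) = Z.abs u1 + Z.abs v1.
      by rewrite -(Z.abs_opp v1) -abs_add_same; [congr Z.abs; lia|nia].
    have : Z.abs (u1 + v1) < Z.abs u1 + Z.abs v1 by nia.
    by lia.
  by have : (u1 * v2) * (u2 * v1) < 0 by [nia]; nia.
- have : Z.abs (u1 + v1) < Z.abs (u1 - v1) by nia.
  by have : Z.abs (u2 + v2) < Z.abs (u2 - v2) by [nia]; lia.
Qed.

Hypothesis quad : 0 <= u1 * v1 /\ 0 <= u2 * v2.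

Lemma quadrant_add : len1 (u1 + v1) (u2 + v2) = len1 u1 u2 + len1 v1 v2.
Proof. by case: quad => h1 h2; rewrite /len1 !abs_add_same //; lia. Qed.

(** In a common quadrant u1 v2 and u2 v1 have the same sign, so passing to absolute values of the
    coordinates keeps the determinant condition and [nonneg_uni] applies. *)
Lemma quadrant_sub : len1 (u1 - v1) (u2 - v2) <= Z.abs (len1 u1 u2 - len1 v1 v2) + 2.
Proof.
case: quad => h1 h2; rewrite /len1.
have abs_sub x y : 0 <= x * y -> Z.abs (x - y) = Z.abs (Z.abs x - Z.abs y).
  by move=> h; have [?|?] := Z_le_gt_dec 0 x; have [?|?] := Z_le_gt_dec 0 y; nia.
rewrite (abs_sub _ _ h1) (abs_sub _ _ h2).
have E : Z.abs (u1 * v2 - u2 * v1) = Z.abs (Z.abs u1 * Z.abs v2 - Z.abs u2 * Z.abs v1).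
  have e1 := Z.abs_mul u1 v2; have e2 := Z.abs_mul u2 v1.
  have q : 0 <= (u1 * v2) * (u2 * v1).
    have -> : (u1 * v2) * (u2 * v1) = (u1 * v1) * (u2 * v2) by ring.
    exact: Z.mul_nonneg_nonneg.
  by rewrite (abs_sub _ _ q) e1 e2.
by apply: nonneg_uni; rewrite -?E //; apply: Z.abs_nonneg.
Qed.
End Quadrant.

Lemma same_quadrant_shift u v k : 1 <= k -> 0 <= u * v ->
  0 <= (u + k * (u + v)) * (v - k * (u + v)) -> u = 0.
Proof.
move=> hk h1 h2.
have [h|[h|h]] : u = 0 \/ (0 < u \/ u < 0) by lia.
- by [].
- exfalso; have hv : 0 <= v by nia.
  have : 0 < u + k * (u + v) by nia.
  have : v - k * (u + v) < 0 by nia.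
  nia.
- exfalso; have hv : v <= 0 by nia.
  have : u + k * (u + v) < 0 by nia.
  have : 0 < v - k * (u + v) by nia.
  nia.
Qed.

Section Parents.
Variable n : nat.
Variables (V : seq (pt n)) (xi : {set edge n}).
Hypothesis bc : boundary_cond V xi.
Implicit Types (a b c d z : pt n) (e f g h : edge n) (T : {set edge n}).

Lemma elen1 a b : Z.of_nat (elen [set a; b]) = len1 (px b - px a) (py b - py a).
Proof. by rewrite elenZ /len1; lia. Qed.

Section QuadLen.
Variables (T T' : {set edge n}) (e : edge n) (a b c d : pt n).
Hypothesis oT : Omega V xi T.
Hypothesis fq : flip_quad V xi T e T' a b c d.

Definition qu1 := px c - px a.
Definition qu2 := py c - py a.
Definition qv1 := px d - px a.
Definition qv2 := py d - py a.

Lemma quad_uni : Z.abs (qu1 * qv2 - qu2 * qv1) = 1.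
Proof.
have := fq_or fq; rewrite /orient /qu1 /qu2 /qv1 /qv2 (fq_px fq) (fq_py fq) => <-.
rewrite -Z.abs_opp; have -> : - ((px c - px a) * (py a + py b - py c - py a) - (py c - py a) * (px a + px b - px c - px a)) =
  (px b - px a) * (py c - py a) - (py b - py a) * (px c - px a) by ring.
by have := fq_or fq; rewrite /orient => ->.
Qed.

Lemma quad_len_e : Z.of_nat (elen e) = len1 (qu1 + qv1) (qu2 + qv2).
Proof.
rewrite (fq_e fq) elen1 /qu1 /qu2 /qv1 /qv2 (fq_px fq) (fq_py fq); congr len1; ring.
Qed.

Lemma quad_len_f : Z.of_nat (elen [set c; d]) = len1 (qu1 - qv1) (qu2 - qv2).
Proof. by rewrite elenZ /len1 /qu1 /qu2 /qv1 /qv2; congr (Z.abs _ + Z.abs _); ring. Qed.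

Lemma quad_len_ac : Z.of_nat (elen [set a; c]) = len1 qu1 qu2.
Proof. by rewrite elen1. Qed.
Lemma quad_len_ad : Z.of_nat (elen [set a; d]) = len1 qv1 qv2.
Proof. by rewrite elen1. Qed.
Lemma quad_len_bd : Z.of_nat (elen [set b; d]) = len1 qu1 qu2.
Proof.
rewrite elenZ /len1 /qu1 /qu2 (fq_px fq) (fq_py fq); congr (Z.abs _ + Z.abs _); ring.
Qed.
Lemma quad_len_bc : Z.of_nat (elen [set b; c]) = len1 qv1 qv2.
Proof.
rewrite elenZ /len1 /qv1 /qv2 (fq_px fq) (fq_py fq); congr (Z.abs _ + Z.abs _); ring.
Qed.

Lemma quad_emid : emid [set c; d] = emid e.
Proof.
have [_ _ _ _ cd] := quad_neq oT fq.
have ab : a != b by have [] := @orient_neq0 n a b c; [rewrite (fq_or fq)|].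
rewrite (fq_e fq); apply/(emid_eq cd ab); rewrite (fq_px fq) (fq_py fq); lia.
Qed.

Lemma quad_Ex_e : Ex V xi (emid e) e.
Proof. by exists T; split=> //; split=> //; apply: fq_T fq. Qed.

Lemma quad_Ex_f : Ex V xi (emid e) [set c; d].
Proof.
exists T'; split; first refine (flip_quad_Omega bc oT fq).
by split; [rewrite (fq_T' fq) !inE eqxx orbT|exact: quad_emid].
Qed.

Lemma quad_parent_down : (elen [set c; d] < elen e)%N -> parent V xi [set c; d] e.
Proof.
move=> lt; exists (emid e); split; first exact: quad_Ex_f.
split; first exact: quad_Ex_e.
split; first by move=> [_ /(_ _ quad_Ex_f)]; rewrite leqNgt lt.
split=> //; exists T; split=> //; split; first exact: fq_T fq.
by rewrite -(fq_T' fq); apply: flip_quad_flip fq.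
Qed.
End QuadLen.

Lemma quad_parent_up T e T' a b c d : Omega V xi T -> flip_quad V xi T e T' a b c d ->
  (elen e < elen [set c; d])%N -> parent V xi e [set c; d].
Proof.
move=> oT fq lt; have fr := flip_quad_rev bc oT fq.
have oT' := flip_quad_Omega bc oT fq.
have := quad_parent_down oT' fr; rewrite (fq_e fq); apply.
by rewrite -(fq_e fq).
Qed.

Lemma parent_quad p f : parent V xi p f -> exists T T' a b c d,
  [/\ Omega V xi T, flip_quad V xi T f T' a b c d, p = [set c; d] & (elen p < elen f)%N].
Proof.
move=> [x [_ [_ [_ [lt [T [oT [fT fl]]]]]]]].
have [a [b [c [d fq]]]] := flip_norm bc oT fl.
exists T, ((T :\ f) :|: [set p]), a, b, c, d; split=> //.
have : [set c; d] \in (T :\ f) :|: [set p] by rewrite (fq_T' fq) !inE eqxx orbT.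
by rewrite !inE (negbTE (diag_notin oT fq)) andbF orFb => /eqP->.
Qed.

(** Apexes at height 1 over ab differ by a multiple i of b - a. For nonzero i, [same_quadrant_shift]
    in both coordinates makes c - a or d - a vanish, contrary to the orientation. *)
Lemma apex_unique a b c d c' d' :
  orient a b c = 1 -> orient a b c' = 1 -> zcoord a b c d 1 (-1) -> zcoord a b c' d' 1 (-1) ->
  0 <= (px c - px a) * (px d - px a) -> 0 <= (py c - py a) * (py d - py a) ->
  0 <= (px c' - px a) * (px d' - px a) -> 0 <= (py c' - py a) * (py d' - py a) -> c = c'.
Proof.
move=> o o' [zx zy] [zx' zy'] q1 q2 q1' q2'.
have [i [j [cx cy]]] : exists i j, zcoord a b c c' i j by apply: zcoord_ex; rewrite o.
have j1 : j = 1.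
  have := zcoord_orient (zcoord0 a b c) (zcoord1 a b c) (conj cx cy); rewrite o o'; lia.
rewrite j1 in cx cy.
set u1 := px c - px a in q1; set u2 := py c - py a in q2.
set v1 := px d - px a in q1; set v2 := py d - py a in q2.
have e1 : px c' - px a = u1 + i * (u1 + v1) by rewrite /u1 /v1 zx; lia.
have e2 : py c' - py a = u2 + i * (u2 + v2) by rewrite /u2 /v2 zy; lia.
have e3 : px d' - px a = v1 - i * (u1 + v1) by rewrite /u1 /v1 zx; lia.
have e4 : py d' - py a = v2 - i * (u2 + v2) by rewrite /u2 /v2 zy; lia.
rewrite e1 e3 in q1'; rewrite e2 e4 in q2'.
have [i0|[ip|im]] : i = 0 \/ (1 <= i \/ 1 <= - i) by lia.
- by apply: pt_eq; lia.
- have z1 := same_quadrant_shift ip q1 q1'; have z2 := same_quadrant_shift ip q2 q2'.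
  by exfalso; move: o; rewrite /orient -/u1 -/u2 z1 z2; clear; lia.
- have z1 : v1 = 0.
    apply: (same_quadrant_shift (v := u1) im); first by rewrite Z.mul_comm.
    have -> : (v1 + - i * (v1 + u1)) * (u1 - - i * (v1 + u1)) = (u1 + i * (u1 + v1)) * (v1 - i * (u1 + v1)) by ring.
    by [].
  have z2 : v2 = 0.
    apply: (same_quadrant_shift (v := u2) im); first by rewrite Z.mul_comm.
    have -> : (v2 + - i * (v2 + u2)) * (u2 - - i * (v2 + u2)) = (u2 + i * (u2 + v2)) * (v2 - i * (u2 + v2)) by ring.
    by [].
  exfalso; move: o; have b1 : px b - px a = u1 + v1 by rewrite /u1 /v1 zx; lia.
  have b2 : py b - py a = u2 + v2 by rewrite /u2 /v2 zy; lia.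
  rewrite /orient b1 b2 -/u1 -/u2 z1 z2; lia.
Qed.

(** In whichever triangulation a shortening flip takes place, its sides ac and ad lie in a common
    quadrant by [quadrant], so [apex_unique] identifies the two parallelograms. The second half
    treats f read from b to a. *)
Lemma parent_unique p1 p2 f : parent V xi p1 f -> parent V xi p2 f -> p1 = p2.
Proof.
move=> /parent_quad [T1 [U1 [a [b [c [d [oT fq -> lt]]]]]]].
move=> /parent_quad [T2 [U2 [a' [b' [c' [d' [oT' fq' -> lt']]]]]]].
have Q : len1 (qu1 a c - qv1 a d) (qu2 a c - qv2 a d) <= len1 (qu1 a c + qv1 a d) (qu2 a c + qv2 a d).
  by rewrite -(quad_len_f a c d) -(quad_len_e fq); lia.
have Q' : len1 (qu1 a' c' - qv1 a' d') (qu2 a' c' - qv2 a' d') <= len1 (qu1 a' c' + qv1 a' d') (qu2 a' c' + qv2 a' d').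
  by rewrite -(quad_len_f a' c' d') -(quad_len_e fq'); lia.
have [r1 r2] := quadrant (quad_uni fq) Q; have [r1' r2'] := quadrant (quad_uni fq') Q'.
move: r1 r2 r1' r2'; rewrite /qu1 /qu2 /qv1 /qv2 => r1 r2 r1' r2'.
have e := fq_e fq; rewrite (fq_e fq') in e.
case: (set2_eq e) => [] [ea eb]; subst a' b'.
  have ec := apex_unique (fq_or fq) (fq_or fq') (fq_d fq) (fq_d fq') r1 r2 r1' r2'.
  congr [set _; _] => //; apply: (zcoord_inj (fq_d fq)); rewrite ec; exact: fq_d fq'.
have [p1' p2'] := (fq_px fq', fq_py fq'); have [p1x p2x] := (fq_px fq, fq_py fq).
have od : orient a b d' = 1.
  have := fq_or fq'; have := zcoord_orient (zcoord0 b a c') (zcoord1 b a c') (fq_d fq').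
  by rewrite (orient_swap a b d'); lia.
have zd : zcoord a b d' c' 1 (-1) by split; lia.
have ec : c = d'.
  apply: (apex_unique (fq_or fq) od (fq_d fq) zd r1 r2).
    have -> : px d' - px a = - (px c' - px b) by lia.
    have -> : px c' - px a = - (px d' - px b) by lia.
    by lia.
  have -> : py d' - py a = - (py c' - py b) by lia.
  have -> : py c' - py a = - (py d' - py b) by lia.
  by lia.
have ed : d = c' by apply: pt_eq; rewrite ec in p1x p2x; lia.
by rewrite ec ed set2C.
Qed.

Lemma parent_len p f : parent V xi p f -> (elen p < elen f)%N.
Proof. by move=> [x [_ [_ [_ []]]]]. Qed.

Lemma preceq_len e f : preceq V xi e f -> e = f \/ (elen e < elen f)%N.
Proof.
move=> h; have h' := clos_rt_rtn1 _ _ _ _ h; elim: h' {h} => [|y z /parent_len lt _ [->|lt']]; first by left.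
  by right.
by right; apply: ltn_trans lt.
Qed.

Lemma preceq_last e f : preceq V xi e f -> e = f \/ exists2 p, parent V xi p f & preceq V xi e p.
Proof.
move=> h; have h' := clos_rt_rtn1 _ _ _ _ h; case: h' {h} => [|y z py hy]; first by left.
right; exists y => //; exact: (clos_rtn1_rt _ _ _ _ hy).
Qed.

Lemma preceq_trans e f g : preceq V xi e f -> preceq V xi f g -> preceq V xi e g.
Proof. exact: rt_trans. Qed.

(* Equal diagonals are those of a unit square, so neither has a parent. *)
Lemma equal_no_parent T e T' a b c d : Omega V xi T -> flip_quad V xi T e T' a b c d ->
  elen e = elen [set c; d] -> elen e = 2%N /\ forall p, ~ parent V xi p e.
Proof.
move=> oT fq eqn.
have L1 := quad_len_e fq; have L2 := quad_len_f a c d; rewrite -eqn in L2.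
have U := quad_uni fq.
have [r1 r2] := quadrant U (Z.eq_le_incl _ _ (etrans (esym L2) L1)).
move: L1 L2 U r1 r2.
move: (qu1 a c) (qu2 a c) (qv1 a d) (qv2 a d) => u1 u2 v1 v2 L1 L2 U r1 r2.
have U' : Z.abs (u1 * (- v2) - u2 * (- v1)) = 1 by rewrite -Z.abs_opp -U; congr Z.abs; ring.
have le' : len1 (u1 - - v1) (u2 - - v2) <= len1 (u1 + - v1) (u2 + - v2).
  have -> : u1 - - v1 = u1 + v1 by ring.
  have -> : u2 - - v2 = u2 + v2 by ring.
  have -> : u1 + - v1 = u1 - v1 by ring.
  have -> : u2 + - v2 = u2 - v2 by ring.
  by rewrite -L1 -L2; lia.
have [r3 r4] := quadrant U' le'.
have s1 : u1 * v1 = 0 by lia.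
have s2 : u2 * v2 = 0 by lia.
have E2 : elen e = 2%N.
  have A := quadrant_add (conj r1 r2); rewrite -L1 /len1 in A.
  have : Z.of_nat (elen e) = 2.
    have one x y : Z.abs (x * y) = 1 -> Z.abs x = 1 /\ Z.abs y = 1.
      by rewrite Z.abs_mul; apply: Z.eq_mul_1_nonneg; apply: Z.abs_nonneg.
    rewrite A; have [z|z] : u1 = 0 \/ v1 = 0 by apply: Zmult_integral.
      have [y1 y2] : Z.abs u2 = 1 /\ Z.abs v1 = 1.
        by apply: one; rewrite -U z -Z.abs_opp; congr Z.abs; ring.
      have z' : v2 = 0 by nia.
      by rewrite z z' y1 y2.
    have [y1 y2] : Z.abs u1 = 1 /\ Z.abs v2 = 1.
      by apply: one; rewrite -U z; congr Z.abs; ring.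
    have z' : u2 = 0 by nia.
    by rewrite z z' y1 y2.
  lia.
split=> // p /parent_quad [T2 [U2 [a' [b' [c' [d' [oT' fq' pE lt]]]]]]].
have M1 := quad_len_e fq'; have M2 := quad_len_f a' c' d'; rewrite -pE in M2.
have W := quad_uni fq'; move: M1 M2 W.
move: (qu1 a' c') (qu2 a' c') (qv1 a' d') (qv2 a' d') => w1 w2 x1 x2 M1 M2 W.
have l1 : Z.of_nat (elen p) < 2 by lia.
have l2 : Z.of_nat (elen e) = 2 by lia.
rewrite M1 in l2; rewrite M2 in l1; rewrite /len1 in l1 l2.
have : w1 = x1 /\ w2 = x2 by lia.
by move=> [q1 q2]; rewrite q1 q2 in W; lia.
Qed.

End Parents.

Local Close Scope Z_scope.

(** * The height function and the transition kernel *)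

Fact RplusA : associative Rplus. Proof. by move=> x y z; ring. Qed.
Fact RplusC : commutative Rplus. Proof. by move=> x y; ring. Qed.
Fact Rplus0l : left_id R0 Rplus. Proof. by move=> x; ring. Qed.
HB.instance Definition _ := Monoid.isComLaw.Build R R0 Rplus RplusA RplusC Rplus0l.
Fact Rmult0l : left_zero R0 Rmult. Proof. by move=> x; ring. Qed.
Fact Rmult0r : right_zero R0 Rmult. Proof. by move=> x; ring. Qed.
HB.instance Definition _ := Monoid.isMulLaw.Build R R0 Rmult Rmult0l Rmult0r.
Fact RmultDl : left_distributive Rmult Rplus. Proof. by move=> x y z; ring. Qed.
Fact RmultDr : right_distributive Rmult Rplus. Proof. by move=> x y z; ring. Qed.
HB.instance Definition _ := Monoid.isAddLaw.Build R Rmult Rplus RmultDl RmultDr.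

Notation "\rsum_ ( i | P ) F" := (\big[Rplus/R0]_(i | P%B) F)
  (at level 41, F at level 41, i at level 50, format "\rsum_ ( i  |  P )  F").
Notation "\rsum_ ( i 'in' A ) F" := (\big[Rplus/R0]_(i in A) F)
  (at level 41, F at level 41, i at level 50, format "\rsum_ ( i  'in'  A )  F").

(** * Finite sums and maxima of reals *)

Section RSum.
Variables (I : finType).
Implicit Types (P Q : pred I) (F G : I -> R).

Lemma rsum_ge0 P F : (forall i, P i -> 0 <= F i) -> 0 <= \rsum_(i | P i) F i.
Proof. by move=> h; apply: (big_ind (fun x => 0 <= x)) => [|x y|//]; lra. Qed.

Lemma rsum_le P F G : (forall i, P i -> F i <= G i) ->
  \rsum_(i | P i) F i <= \rsum_(i | P i) G i.
Proof. by move=> h; apply: (big_ind2 (fun x y => x <= y)) => [|x y z t|//]; lra. Qed.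

Lemma rsum_mulr P F x : (\rsum_(i | P i) F i) * x = \rsum_(i | P i) (F i * x).
Proof. exact: big_distrl. Qed.
Lemma rsum_mull P F x : x * (\rsum_(i | P i) F i) = \rsum_(i | P i) (x * F i).
Proof. exact: big_distrr. Qed.

Lemma rsum_le_subset P Q F : (forall i, Q i -> 0 <= F i) -> (forall i, P i -> Q i) ->
  \rsum_(i | P i) F i <= \rsum_(i | Q i) F i.
Proof.
move=> h PQ; rewrite (big_mkcond P) (big_mkcond Q) /=; apply: rsum_le => i _.
case Pi: (P i); first by rewrite (PQ i Pi); lra.
by case Qi: (Q i); [apply: h|lra].
Qed.

Lemma rsum_ge_term P F i0 : (forall i, P i -> 0 <= F i) -> P i0 -> F i0 <= \rsum_(i | P i) F i.
Proof.
move=> h P0; rewrite (bigD1 i0) //=.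
suff : 0 <= \rsum_(i | P i && (i != i0)) F i by lra.
by apply: rsum_ge0 => i /andP[Pi _]; apply: h.
Qed.

Lemma rsum_const (A : {set I}) x : \rsum_(i in A) x = INR #|A| * x.
Proof.
rewrite big_const; elim: #|A| => [|k IH]; first by rewrite /= Rmult_0_l.
by rewrite iterS IH S_INR; ring.
Qed.

Lemma rsumB P F G : \rsum_(i | P i) (F i - G i) = \rsum_(i | P i) F i - \rsum_(i | P i) G i.
Proof.
have -> : \rsum_(i | P i) F i - \rsum_(i | P i) G i = \rsum_(i | P i) F i + (-1) * \rsum_(i | P i) G i by ring.
by rewrite rsum_mull -big_split /=; apply: eq_bigr => i _; ring.
Qed.

Definition rmax (A : {set I}) F : R := \big[Rmax/R0]_(i in A) F i.

Lemma rmax_ge0 A F : 0 <= rmax A F.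
Proof. by rewrite /rmax; elim/big_rec: _ => [|i x _ h]; [lra|apply: Rle_trans h (Rmax_r _ _)]. Qed.

Lemma rmax_ub (A : {set I}) F i : i \in A -> F i <= rmax A F.
Proof.
rewrite /rmax => iA; have : i \in index_enum I by rewrite mem_index_enum.
elim: (index_enum I) => // j s IH; rewrite inE big_cons => /orP[/eqP<-|/IH h].
  by rewrite iA; apply: Rmax_l.
by case: ifP => _ //; apply: Rle_trans h (Rmax_r _ _).
Qed.

Lemma rmax_le (A : {set I}) F x : 0 <= x -> (forall i, i \in A -> F i <= x) -> rmax A F <= x.
Proof. by move=> x0 h; rewrite /rmax; elim/big_rec: _ => // i y iA hy; apply: Rmax_lub => //; apply: h. Qed.

Lemma rmax_att (A : {set I}) F : rmax A F = 0 \/ exists2 i, i \in A & F i = rmax A F.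
Proof.
rewrite /rmax; elim/big_rec: _ => [|i y iA [->|[j jA <-]]]; first by left.
  by rewrite /Rmax; case: Rle_dec => _; [left|right; exists i].
by right; rewrite /Rmax; case: Rle_dec => _; [exists j|exists i].
Qed.

End RSum.

Section Height.
Variable n : nat.
Variables (V : seq (pt n)) (xi : {set edge n}).
Hypothesis bc : boundary_cond V xi.
Variables (alpha : R) (g : edge n).
Hypothesis al1 : 1 < alpha.
Implicit Types (a b c d z : pt n) (e f h : edge n) (T U : {set edge n}).

Definition wt e : R := powerRZ alpha (Z.of_nat (elen e) - Z.of_nat (elen g)).
(** [phi e] is the term of e itself; [Phi e] is the full inner sum of the height function at the
    midpoint of e when e is the current edge. *)
Definition phi e : R := if pb (meet e g) then wt e else 0.
Definition below e' e : Prop := Ex V xi (emid e) e' /\ meet e' g /\ preceq V xi e' e.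
Definition Phi e : R := \rsum_(e' | pb (below e' e)) wt e'.

Lemma wt_gt0 e : 0 < wt e.
Proof. by apply: powerRZ_lt; lra. Qed.

Lemma phi_ge0 e : 0 <= phi e.
Proof. by rewrite /phi; case: pbP => _; [have := wt_gt0 e; lra|lra]. Qed.

Lemma phi_meet e : meet e g -> phi e = wt e.
Proof. by move=> h; rewrite /phi; case: pbP. Qed.
Lemma phi_nmeet e : ~ meet e g -> phi e = 0.
Proof. by move=> h; rewrite /phi; case: pbP. Qed.

Lemma Phi_ge0 e : 0 <= Phi e.
Proof. by apply: rsum_ge0 => i _; apply: Rlt_le; apply: wt_gt0. Qed.

Lemma Phi_ge_phi T e : Omega V xi T -> e \in T -> phi e <= Phi e.
Proof.
move=> oT eT; rewrite /phi; case: pbP => [m|_]; last exact: Phi_ge0.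
apply: (rsum_ge_term (F := wt)) => [i _|]; first by apply: Rlt_le; apply: wt_gt0.
by apply/pbP; split; [exists T|split=> //; apply: rt_refl].
Qed.

Lemma Psi_E T : Omega V xi T -> Psi V xi g alpha T = \rsum_(e in T) Phi e.
Proof.
move=> oT; rewrite /Psi (Lambda_emid bc oT) big_imset /=; last by apply: emid_inj oT.
apply: eq_bigr => e eT; apply: eq_bigl => e'.
apply/pbP/pbP => [[h1 [h2 [f [fT [ef pf]]]]]|[h1 [h2 h3]]].
  have fe : f = e := emid_inj oT fT eT ef.
  by split=> //; split=> //; rewrite -fe.
by split=> //; split=> //; exists e.
Qed.

Lemma below_emid e' e f : emid e = emid f -> preceq V xi e f -> below e' e -> below e' f.
Proof. by move=> em pr [h1 [h2 h3]]; split; rewrite -?em //; split=> //; apply: preceq_trans pr. Qed.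

Section OneFlip.
Variables (T T' : {set edge n}) (e : edge n) (a b c d : pt n).
Hypothesis oT : Omega V xi T.
Hypothesis fq : flip_quad V xi T e T' a b c d.
Local Notation f := [set c; d].

(** Whatever is strictly below f is below its parent, which is unique and hence e; for equal lengths
    f has no parent. *)
Lemma Phi_up : (elen e <= elen f)%N -> Phi f <= Phi e + phi f.
Proof.
move=> le.
have em : emid f = emid e := quad_emid oT fq.
have sub e' : below e' f -> e' = f \/ below e' e.
  move=> [h1 [h2 h3]]; case: (preceq_last h3) => [->|[p pf ep]]; first by left.
  right; split; first by rewrite -em.
  split=> //; move: le; rewrite leq_eqVlt => /orP[/eqP eq|lt].
    have fr := flip_quad_rev bc oT fq.
    have eqr : elen f = elen [set a; b] by rewrite -(fq_e fq).
    by case: (proj2 (equal_no_parent bc (flip_quad_Omega bc oT fq) fr eqr) _ pf).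
  by rewrite -(parent_unique bc pf (quad_parent_up bc oT fq lt)).
rewrite /Phi (bigID (pred1 f)) /= Rplus_comm; apply: Rplus_le_compat.
  apply: rsum_le_subset => [i _|i /andP[/pbP bi /eqP ne]]; first by apply: Rlt_le; apply: wt_gt0.
  by apply/pbP; case: (sub i bi).
rewrite /phi; case: pbP => m.
  rewrite -[wt f]/(wt f) -(big_pred1_eq Rplus f wt); apply: rsum_le_subset => [i _|i /andP[]//].
  by apply: Rlt_le; apply: wt_gt0.
rewrite big_pred0 => [|i]; first lra.
by apply/negbTE/negP => /andP[/pbP [_ [h2 _]] /eqP q]; apply: m; rewrite -q.
Qed.

(** e lies below itself but not below the shorter f, so its own term is lost. *)
Lemma Phi_down : (elen f < elen e)%N -> Phi f + phi e <= Phi e.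
Proof.
move=> lt.
have em : emid f = emid e := quad_emid oT fq.
have pr : preceq V xi f e by apply: rt_step; apply: (quad_parent_down bc oT fq lt).
have nb : ~ below e f.
  by move=> [_ [_ h]]; case: (preceq_len h) => [q|]; [rewrite -q ltnn in lt|lia].
rewrite [X in _ <= X]/Phi (bigID (pred1 e)) /= Rplus_comm; apply: Rplus_le_compat.
  rewrite /phi; case: pbP => m; last by apply: rsum_ge0 => i _; apply: Rlt_le; apply: wt_gt0.
  apply: (rsum_ge_term (F := wt)) => [i _|]; first by apply: Rlt_le; apply: wt_gt0.
  rewrite eqxx andbT; apply/pbP; split; first exact: (quad_Ex_e oT fq).
  by split=> //; apply: rt_refl.
apply: rsum_le_subset => [i _|i /pbP bi]; first by apply: Rlt_le; apply: wt_gt0.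
apply/andP; split; first by apply/pbP; apply: below_emid bi.
by apply/eqP => q; apply: nb; rewrite -{1}q.
Qed.

Lemma Psi_flip : Psi V xi g alpha T' = Psi V xi g alpha T - Phi e + Phi f.
Proof.
rewrite (Psi_E oT) (Psi_E (flip_quad_Omega bc oT fq)) (fq_T' fq).
rewrite [X in _ = X - _ + _](bigD1 e) /=; last exact: fq_T fq.
rewrite (bigD1 f) /=; last by rewrite !inE eqxx orbT.
have -> : \rsum_(i | (i \in (T :\ e) :|: [set f]) && (i != f)) Phi i = \rsum_(i | (i \in T) && (i != e)) Phi i.
  apply: eq_bigl => i; rewrite !inE.
  have [->|ne] := eqVneq i f; first by rewrite (negbTE (diag_notin oT fq)) ?andbF.
  by rewrite orbF andbT andbC.
match goal with |- _ + ?S1 = _ + ?S2 - _ + _ => change S1 with S2; generalize S2 end.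
by move=> S; ring.
Qed.

End OneFlip.
End Height.

(** * Transition operator and law of the chain *)

Section Kernel.
Variable n : nat.
Variables (V : seq (pt n)) (xi : {set edge n}).
Hypothesis bc : boundary_cond V xi.
Variable lam : R.
Hypothesis lam01 : 0 < lam < 1.
Implicit Types (a b c d z : pt n) (e f h : edge n) (T U : {set edge n}).

(** [Pop] is the one-step transition operator and [flip_sum F T e] the expected change of F when the
    midpoint of e has been picked; so on [Omega], [Pop F T] is [F T] plus the average of these
    changes. *)
Definition Pop (F : {set edge n} -> R) T : R := \rsum_(U | true) (kernel V xi lam T U * F U).
Definition frate T e U : R := if pb (flip V xi T e U) then qflip lam T e U else 0.
Definition flip_sum (F : {set edge n} -> R) T e : R := \rsum_(U | true) (frate T e U * (F U - F T)).

Local Notation N := (INR #|Lambda V|).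

Lemma kernelE T U : Omega V xi T -> kernel V xi lam T U =
  / N * \rsum_(e in T) (frate T e U + (if U == T then 1 - \rsum_(W | true) frate T e W else 0)).
Proof.
move=> oT; rewrite /kernel; congr Rmult.
rewrite [RHS](partition_big (@emid n) (fun x => x \in Lambda V)) /=; last first.
  by move=> e eT; rewrite (Lambda_emid bc oT) imset_f.
apply: eq_bigr => x xL; apply: eq_bigr => e _; congr Rplus; case: ifP => // _; congr Rminus.
by rewrite big_mkcond.
Qed.

Lemma N_T T : Omega V xi T -> N = INR #|T|.
Proof. by move=> oT; rewrite (card_Lambda bc oT). Qed.

Lemma Pop_E F T : Omega V xi T -> 0 < N ->
  Pop F T = F T + / N * \rsum_(e in T) flip_sum F T e.
Proof.
move=> oT Npos; rewrite /Pop.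
have -> : F T = / N * \rsum_(e in T) F T by rewrite rsum_const -(N_T oT); field; lra.
rewrite -Rmult_plus_distr_l -big_split /=.
transitivity (\rsum_(U | true) (/ N * \rsum_(e in T) ((frate T e U + (if U == T then 1 - \rsum_(W | true) frate T e W else 0)) * F U))).
  by apply: eq_bigr => U _; rewrite (kernelE U oT) Rmult_assoc rsum_mulr.
rewrite -rsum_mull; congr Rmult; rewrite exchange_big /=; apply: eq_bigr => e eT.
rewrite /flip_sum.
have -> : \rsum_(U | true) (frate T e U * (F U - F T)) =
   \rsum_(U | true) (frate T e U * F U) - (\rsum_(U | true) frate T e U) * F T.
  by rewrite rsum_mulr -rsumB; apply: eq_bigr => U _; ring.
transitivity (\rsum_(U | true) (frate T e U * F U) + \rsum_(U | true) ((if U == T then 1 - \rsum_(W | true) frate T e W else 0) * F U)).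
  by rewrite -big_split /=; apply: eq_bigr => U _; ring.
rewrite [X in _ + X = _](bigD1 T) //= eqxx [X in _ + (_ + X) = _]big1 => [|U /negbTE->]; last by ring.
by ring.
Qed.

Lemma qflip_quad T e U a b c d : Omega V xi T -> flip_quad V xi T e U a b c d ->
  qflip lam T e U = lam ^ elen [set c; d] / (lam ^ elen [set c; d] + lam ^ elen e).
Proof.
move=> oT fq; rewrite /qflip (fq_T' fq).
have -> : ((T :\ e) :|: [set [set c; d]]) :\: T = [set [set c; d]].
  apply/setP => i; rewrite !inE; have [->|ne] := eqVneq i [set c; d].
    by rewrite (negbTE (diag_notin oT fq)) orbT.
  by rewrite orbF; case: (i \in T); rewrite ?andbF.
by rewrite big_set1.
Qed.

Lemma flip_sum_cases F T e : Omega V xi T ->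
  ((forall U, ~ flip V xi T e U) /\ flip_sum F T e = 0) \/
  exists U a b c d, flip_quad V xi T e U a b c d /\
    flip_sum F T e = lam ^ elen [set c; d] / (lam ^ elen [set c; d] + lam ^ elen e) * (F U - F T).
Proof.
move=> oT; have [[U fl]|nf] := classic (exists U, flip V xi T e U); last first.
  left; split; first by move=> U fl; apply: nf; exists U.
  rewrite /flip_sum big1 // => U _; rewrite /frate; case: pbP => [fl|_]; last by ring.
  by case: nf; exists U.
right; have [a [b [c [d fq]]]] := flip_norm bc oT fl.
exists U, a, b, c, d; split=> //.
rewrite /flip_sum (bigD1 U) //= big1 => [|W /eqP ne].
  by rewrite /frate; case: pbP => // _; rewrite (qflip_quad oT fq); ring.
rewrite /frate; case: pbP => [fl'|_]; last by ring.
by case: ne; apply: (flip_unique bc oT fl' fl).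
Qed.

Lemma qrate_bounds i j : 0 < lam ^ i / (lam ^ i + lam ^ j) < 1.
Proof.
have h1 := pow_lt lam i (proj1 lam01); have h2 := pow_lt lam j (proj1 lam01).
split; first by apply: Rdiv_lt_0_compat; lra.
by apply: (Rmult_lt_reg_r (lam ^ i + lam ^ j)); [lra|field_simplify; lra].
Qed.

Lemma frate_ge0 T e U : Omega V xi T -> 0 <= frate T e U.
Proof.
move=> oT; rewrite /frate; case: pbP => [fl|_]; last lra.
have [a [b [c [d fq]]]] := flip_norm bc oT fl.
by rewrite (qflip_quad oT fq); have := qrate_bounds (elen [set c; d]) (elen e); lra.
Qed.

Lemma frate_sum_le1 T e : Omega V xi T -> \rsum_(U | true) frate T e U <= 1.
Proof.
move=> oT; have [[U fl]|nf] := classic (exists U, flip V xi T e U); last first.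
  rewrite big1 => [|U _]; first lra.
  by rewrite /frate; case: pbP => [fl|//]; case: nf; exists U.
have [a [b [c [d fq]]]] := flip_norm bc oT fl.
rewrite (bigD1 U) //= big1 => [|W /eqP ne].
  rewrite /frate; case: pbP => // _; rewrite (qflip_quad oT fq).
  by have := qrate_bounds (elen [set c; d]) (elen e); lra.
rewrite /frate; case: pbP => [fl'|//].
by case: ne; apply: (flip_unique bc oT fl' fl).
Qed.

Lemma kernel_ge0 T U : Omega V xi T -> 0 <= kernel V xi lam T U.
Proof.
move=> oT; rewrite (kernelE U oT); apply: Rmult_le_pos.
  have [->|ne] := Req_dec N 0; first by rewrite Rinv_0; lra.
  by apply: Rlt_le; apply: Rinv_0_lt_compat; have := pos_INR #|Lambda V|; lra.
apply: rsum_ge0 => e _; have := frate_ge0 e U oT; have := frate_sum_le1 e oT.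
by case: ifP => _; lra.
Qed.

Lemma kernel_support T U : Omega V xi T -> ~ Omega V xi U -> kernel V xi lam T U = 0.
Proof.
move=> oT nU; rewrite (kernelE U oT) big1 ?Rmult_0_r // => e _.
rewrite /frate; case: pbP => [fl|_]; first by case: nU; apply: (flip_Omega bc oT fl).
by case: eqP => [q|_]; [case: nU; rewrite q|ring].
Qed.

(** The kernel is defined on all edge sets but controlled only on [Omega]; this confines the chain
    to [Omega]. *)
Lemma law_support s t T : Omega V xi s -> ~ Omega V xi T -> law V xi lam s t T = 0.
Proof.
move=> os; elim: t T => [|t IH] T nT /=; first by case: eqP => // q; case: nT; rewrite q.
rewrite big1 // => U _; have [oU|nU] := classic (Omega V xi U).
  by rewrite (kernel_support oU nT); ring.
by rewrite (IH U nU); ring.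
Qed.

Lemma law_ge0 s t T : Omega V xi s -> 0 <= law V xi lam s t T.
Proof.
move=> os; elim: t T => [|t IH] T /=; first by case: eqP => _; lra.
apply: rsum_ge0 => U _; have [oU|nU] := classic (Omega V xi U).
  by apply: Rmult_le_pos => //; apply: kernel_ge0.
by rewrite (law_support t os nU); lra.
Qed.

Definition expect s t (F : {set edge n} -> R) : R := \rsum_(T | true) (law V xi lam s t T * F T).

Lemma expect0 s F : expect s 0 F = F s.
Proof.
rewrite /expect (bigD1 s) //= eqxx big1 => [|T /negbTE->]; first by ring.
by ring.
Qed.

Lemma expectS s t F : expect s t.+1 F = expect s t (Pop F).
Proof.
rewrite /expect /=.
transitivity (\rsum_(T | true) \rsum_(U | true) (law V xi lam s t U * kernel V xi lam U T * F T)).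
  by apply: eq_bigr => T _; rewrite rsum_mulr.
rewrite exchange_big /=; apply: eq_bigr => U _; rewrite /Pop rsum_mull.
by apply: eq_bigr => T _; ring.
Qed.

Lemma expect_le s t F G : Omega V xi s -> (forall T, Omega V xi T -> F T <= G T) ->
  expect s t F <= expect s t G.
Proof.
move=> os h; apply: rsum_le => T _; have [oT|nT] := classic (Omega V xi T).
  by apply: Rmult_le_compat_l; [apply: law_ge0|apply: h].
by rewrite (law_support t os nT); lra.
Qed.

Lemma expect_lin s t F x : expect s t (fun T => x * F T) = x * expect s t F.
Proof. by rewrite /expect rsum_mull; apply: eq_bigr => T _; ring. Qed.

Lemma expect_add s t F G : expect s t (fun T => F T + G T) = expect s t F + expect s t G.
Proof. by rewrite /expect -big_split /=; apply: eq_bigr => T _; ring. Qed.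

Lemma expect_cst s t x : Omega V xi s -> 0 < N -> expect s t (fun=> x) = x.
Proof.
move=> os Np; elim: t => [|t IH]; first exact: expect0.
rewrite expectS -[RHS]IH; apply: Rle_antisym; apply: expect_le => // T oT;
rewrite (Pop_E _ oT Np) big1 => [|e _]; try lra;
by rewrite /flip_sum big1 // => U _; ring.
Qed.

Lemma Exp1_Pop s F : Exp1 V xi lam s F = Pop F s.
Proof. by rewrite -[LHS]/(expect s 1 F) expectS expect0. Qed.

End Kernel.

(** * Increase of the height function under one flip *)

(** As in [nonneg_uni], coordinates that strictly disagree do so by exactly 1 each, and then the two
    sums are equal. *)
Lemma nonneg_uni_dom a b c d : (0 <= a -> 0 <= b -> 0 <= c -> 0 <= d -> Z.abs (a * d - b * c) = 1 ->
  c + d < a + b -> c <= a /\ d <= b)%Z.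
Proof.
have key s t x y : (1 <= s -> 1 <= t -> 0 <= x -> 0 <= y -> (x + s) * (y + t) - y * x <= 1 -> s = 1 /\ t = 1)%Z.
  move=> hs ht hx hy; have -> : ((x + s) * (y + t) - y * x = x * t + s * y + s * t)%Z by ring.
  have h1 : (0 <= x * t)%Z by apply: Z.mul_nonneg_nonneg; lia.
  have h2 : (0 <= s * y)%Z by apply: Z.mul_nonneg_nonneg; lia.
  by nia.
move=> ha hb hc hd U lt.
have [ac|ac] := Z_le_gt_dec c a; have [bd|bd] := Z_le_gt_dec d b; [lia| | |clear -ac bd lt; lia]; exfalso.
- have E : ((c + (a - c)) * (b + (d - b)) - b * c = a * d - b * c)%Z by ring.
  have [] : (a - c = 1 /\ d - b = 1)%Z by apply: (key _ _ c b); rewrite ?E; lia.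
  lia.
- have E : ((a + (c - a)) * (d + (b - d)) - d * a = - (a * d - b * c))%Z by ring.
  have [] : (c - a = 1 /\ b - d = 1)%Z by apply: (key _ _ a d); rewrite ?E; lia.
  lia.
Qed.

Lemma abs_dom_mul x y : (0 <= x * - y -> Z.abs y <= Z.abs x -> 0 <= x * (x + y))%Z.
Proof. nia. Qed.

Lemma abs_combine i j x y : (1 <= i -> 1 <= j -> 0 <= x * y ->
  Z.abs x + Z.abs y <= Z.abs (i * y + j * x))%Z.
Proof.
move=> hi hj h; have h' : (0 <= (i * y) * (j * x))%Z.
  have -> : ((i * y) * (j * x) = (i * j) * (x * y))%Z by ring.
  by apply: Z.mul_nonneg_nonneg => //; apply: Z.mul_nonneg_nonneg; lia.
rewrite (abs_add_same h') !Z.abs_mul; move: (Z.abs_nonneg x) (Z.abs_nonneg y).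
move: (Z.abs x) (Z.abs y) => X Y; clear -hi hj; nia.
Qed.

Section LongDiagonal.
Variables u1 u2 v1 v2 : Z.
Hypothesis uni : Z.abs (u1 * v2 - u2 * v1) = 1%Z.
Hypothesis le : (len1 (u1 + v1) (u2 + v2) <= len1 (v1 - u1) (v2 - u2))%Z.

Let uni' : Z.abs (u1 * (- v2) - u2 * (- v1)) = 1%Z.
Proof. rewrite -uni -Z.abs_opp; congr Z.abs; ring. Qed.
Let le' : (len1 (u1 - (- v1)) (u2 - (- v2)) <= len1 (u1 + (- v1)) (u2 + (- v2)))%Z.
Proof.
have -> : (u1 - (- v1) = u1 + v1)%Z by ring.
have -> : (u2 - (- v2) = u2 + v2)%Z by ring.
have : len1 (u1 + (- v1)) (u2 + (- v2)) = len1 (v1 - u1) (v2 - u2) by rewrite /len1; lia.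
by move=> ->.
Qed.
Let qd := quadrant uni' le'.

(** In the application u = w - a and v = b - w for a triangle abw, so u + v is the flipped edge and
    v - u the new diagonal, which is at least as long; [quadrant] applies to u and -v. *)
Lemma long_diag_len : len1 (v1 - u1) (v2 - u2) = (len1 u1 u2 + len1 v1 v2)%Z.
Proof.
have -> : len1 (v1 - u1) (v2 - u2) = len1 (u1 + (- v1)) (u2 + (- v2)) by rewrite /len1; lia.
by rewrite (quadrant_add qd) /len1; lia.
Qed.

Lemma short_diag_len : (len1 (u1 + v1) (u2 + v2) <= Z.abs (len1 u1 u2 - len1 v1 v2) + 2)%Z.
Proof.
have := quadrant_sub uni' qd; have -> : (u1 - (- v1) = u1 + v1)%Z by ring.
have -> : (u2 - (- v2) = u2 + v2)%Z by ring.
have -> : len1 (- v1) (- v2) = len1 v1 v2 by rewrite /len1; lia.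
by [].
Qed.

(** u dominates v in each coordinate, so u + v lies in the quadrant of u and lengths of positive
    combinations of the two add. This bounds |g| from below when g starts at an endpoint of the
    flipped edge. *)
Lemma short_diag_dir i j : (len1 v1 v2 < len1 u1 u2)%Z -> (1 <= i)%Z -> (1 <= j)%Z ->
  (len1 u1 u2 + len1 (u1 + v1) (u2 + v2) <=
   len1 (i * (u1 + v1) + j * u1) (i * (u2 + v2) + j * u2))%Z.
Proof.
move=> lt hi hj; have [q1 q2] := qd.
have E : (Z.abs (Z.abs u1 * Z.abs v2 - Z.abs u2 * Z.abs v1) = 1)%Z.
  rewrite -!Z.abs_mul; have q : (0 <= (u1 * v2) * (u2 * v1))%Z.
    have -> : ((u1 * v2) * (u2 * v1) = (u1 * - v1) * (u2 * - v2))%Z by ring.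
    exact: Z.mul_nonneg_nonneg.
  by move: uni q; move: (u1 * v2)%Z (u2 * v1)%Z => x y; clear; nia.
have [d1 d2] := nonneg_uni_dom (Z.abs_nonneg _) (Z.abs_nonneg _) (Z.abs_nonneg _) (Z.abs_nonneg _) E lt.
have A := abs_combine hi hj (abs_dom_mul q1 d1); have B := abs_combine hi hj (abs_dom_mul q2 d2).
rewrite /len1 (_ : (Z.abs u1 + Z.abs u2 + (Z.abs (u1 + v1) + Z.abs (u2 + v2)) =
  Z.abs u1 + Z.abs (u1 + v1) + (Z.abs u2 + Z.abs (u2 + v2)))%Z); last by ring.
exact: Z.add_le_mono.
Qed.
End LongDiagonal.

(** * Powers of alpha against flip rates *)

Section Power.
Variables (alpha lam : R).
Hypothesis al1 : 1 < alpha.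
Hypothesis lam01 : 0 < lam < 1.
Hypothesis al_lam : alpha * alpha * lam <= 1.
Local Notation pz := (powerRZ alpha).

Lemma pz_add i j : pz (i + j) = pz i * pz j.
Proof. by apply: powerRZ_add; lra. Qed.
Lemma pz_gt0 i : 0 < pz i.
Proof. by apply: powerRZ_lt; lra. Qed.
Lemma pz_nat k : pz (Z.of_nat k) = alpha ^ k.
Proof. by rewrite pow_powerRZ. Qed.
Lemma pz_le i j : (i <= j)%Z -> pz i <= pz j.
Proof.
move=> h; have -> : j = (i + Z.of_nat (Z.to_nat (j - i)))%Z by lia.
rewrite pz_add pz_nat; have := pz_gt0 i; have := pow_R1_Rle alpha (Z.to_nat (j - i)); nra.
Qed.

(** Lengthening by k has rate at most lam^k, and lam <= alpha^(-2). *)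
Lemma qrate_le i j : (j <= i)%N -> lam ^ i / (lam ^ i + lam ^ j) <= pz (- 2 * Z.of_nat (i - j)).
Proof.
move=> ji; have h2 := pow_lt lam j (proj1 lam01); have h1 := pow_lt lam i (proj1 lam01).
have E : lam ^ i = lam ^ (i - j) * lam ^ j by rewrite -pow_add; congr (_ ^ _); lia.
have l1 : lam ^ i / (lam ^ i + lam ^ j) <= lam ^ (i - j).
  apply: (Rmult_le_reg_r (lam ^ i + lam ^ j)); first lra.
  have -> : lam ^ i / (lam ^ i + lam ^ j) * (lam ^ i + lam ^ j) = lam ^ i by field; lra.
  by have := pow_lt lam (i - j) (proj1 lam01); rewrite {1}E; nra.
apply: Rle_trans l1 _.
elim: (i - j)%N => [|k IH]; first by rewrite /=; lra.
have -> : (- 2 * Z.of_nat k.+1 = - 2 + - 2 * Z.of_nat k)%Z by lia.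
rewrite pz_add -tech_pow_Rmult; apply: Rmult_le_compat => //; [lra|apply: pow_le; lra|].
have -> : pz (- 2) = / (alpha * alpha) by rewrite /= Rmult_1_r.
by apply: (Rmult_le_reg_r (alpha * alpha)); [nra|rewrite Rinv_l; nra].
Qed.

(** The exponent falls as the new length i grows: the rate outweighs the growth of the weight. All
    charging bounds start from this. *)
Lemma qrate_wt i j m : (j <= i)%N ->
  lam ^ i / (lam ^ i + lam ^ j) * pz (Z.of_nat i - m) <= pz (2 * Z.of_nat j - Z.of_nat i - m).
Proof.
move=> ji; have -> : (2 * Z.of_nat j - Z.of_nat i - m = - 2 * Z.of_nat (i - j) + (Z.of_nat i - m))%Z by lia.
by rewrite pz_add; apply: Rmult_le_compat_r; [apply: Rlt_le; apply: pz_gt0|apply: qrate_le].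
Qed.
End Power.

Section Increase.
Variable n : nat.
Variables (V : seq (pt n)) (xi : {set edge n}).
Hypothesis bc : boundary_cond V xi.
Variables (alpha lam : R) (g : edge n).
Hypothesis al1 : 1 < alpha.
Hypothesis lam01 : 0 < lam < 1.
Hypothesis al_lam : alpha * alpha * lam <= 1.
Hypothesis ga : admissible V g.
Implicit Types (a b c d z w : pt n) (e f h p : edge n) (T U : {set edge n}).
Local Notation pz := (powerRZ alpha).
Local Notation len e := (Z.of_nat (elen e)).

(** h and p are the other two sides of a triangle of [T] at e; h receives a charge and the length of
    p enters its size. *)
Definition adj T e h p : Prop := exists a b w, [/\ e = [set a; b], h = [set b; w], p = [set a; w] & tri V T a b w].

(** g passes through the interior, avoids ab and does not end at w, so in each direction it leaves
    through aw or bw or stops at a or b. Combinations incompatible with the interior point are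
    discarded. *)
Lemma tri_crossed T a b w r s t : planar V T -> tri V T a b w -> segpt g r ->
  r = aff (rp a) (rp b) (rp w) s t -> 0 < s -> 0 < t -> s + t < 1 -> ~ meet g [set a; b] ->
  (forall z1 z2, g = [set z1; z2] -> z1 = w -> False) ->
  [\/ meet g [set a; w] /\ meet g [set b; w],
      (exists z s1 t1, [/\ g = [set a; z], rp z = aff (rp a) (rp b) (rp w) s1 t1, 0 < s1 & 0 < t1]) /\ meet g [set b; w] |
      (exists z s1 t1, [/\ g = [set b; z], rp z = aff (rp b) (rp a) (rp w) s1 t1, 0 < s1 & 0 < t1]) /\ meet g [set a; w] ].
Proof.
move=> pl tr gr er hs ht hst nab nw.
have et := tri_etri pl tr; have [D0 la lb lw emp] := et; have [ab bw aw D0'] := orient_neq0 D0.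
have [z1 [z2 [gE z12]]] := adm_ex ga; have gA := ga; rewrite gE in gA.
have /adm_set2 [[_ l1 l2 _] pr] := gA.
have o : oseg (rp z1) (rp z2) (aff (rp a) (rp b) (rp w) s t).
  by move: gr; rewrite gE er => /segpt_set2 [].
have kinds x y : [set x; y] = g -> x != y -> Lam0 V y -> prim V x y -> oseg (rp x) (rp y) (aff (rp a) (rp b) (rp w) s t) ->
    exists sw tw, rp y = aff (rp a) (rp b) (rp w) sw tw /\
     ([\/ y = a, y = b | (exists k, 0 <= k < 1 /\ s + k * (sw - s) = 0 /\ sw < 0) /\ meet g [set a; w] ] \/
      ((exists k, 0 <= k < 1 /\ s + k * (sw - s) + (t + k * (tw - t)) = 1 /\ 1 < sw + tw) /\ meet g [set b; w])).
  move=> xyg xy ly prxy oxy; have [sw [tw ey]] := rp_aff y D0.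
  exists sw, tw; split=> //.
  have [[q|[q|q]]|[k [hk [s' [t' [es [ett [ok cs]]]]]]]] :=
    exit_tri et ly prxy oxy (Rlt_le _ _ hs) (Rlt_le _ _ ht) (Rlt_le _ _ hst) ey.
  - by left; constructor 1.
  - by left; constructor 2.
  - by case: (nw y x) => //; rewrite set2C.
  have gk : segpt g (aff (rp a) (rp b) (rp w) s' t') by rewrite -xyg; apply/segpt_set2.
  case: cs => [] [c1 c2 c3].
  - left; constructor 3; split; first by exists k; rewrite -es.
    by exists (aff (rp a) (rp b) (rp w) s' t'); split=> //; apply/segpt_set2; split=> //; apply/(oseg_ac et).
  - case: nab; exists (aff (rp a) (rp b) (rp w) s' t'); split=> //; apply/segpt_set2; split=> //; apply/(oseg_ab et); lra.
  - right; split; first by exists k; rewrite -es -ett.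
    by exists (aff (rp a) (rp b) (rp w) s' t'); split=> //; apply/segpt_set2; split=> //; apply/(oseg_bc et); lra.
have z21 : z2 != z1 by rewrite eq_sym.
have [s2 [t2 [e2 k2]]] := kinds z1 z2 (esym gE) z12 l2 pr o.
have [s1 [t1 [e1 k1]]] := kinds z2 z1 (etrans (set2C _ _) (esym gE)) z21 l1 (prim_sym pr) (oseg_sym o).
have [m [hm em]] := o; move: em; rewrite e1 e2 aff_mix => /(aff_inj D0') [m1 m2].
have ca y sy ty : y = a -> rp y = aff (rp a) (rp b) (rp w) sy ty -> sy = 0 /\ ty = 0.
  by move=> ->; rewrite {1}(aff00 (rp a) (rp b) (rp w)) => /(aff_inj D0') [<- <-].
have cb y sy ty : y = b -> rp y = aff (rp a) (rp b) (rp w) sy ty -> sy = 1 /\ ty = 0.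
  by move=> ->; rewrite {1}(aff10 (rp a) (rp b) (rp w)) => /(aff_inj D0') [<- <-].
have sgn1 : 0 < s1 \/ 0 < s2 by apply: NNPP => q; have : s <= 0; [rewrite m1; clear -hm q; nra|lra].
have tgn : 0 < t1 \/ 0 < t2 by apply: NNPP => q; have : t <= 0; [rewrite m2; clear -hm q; nra|lra].
have stn : s1 + t1 < 1 \/ s2 + t2 < 1.
  by apply: NNPP => q; have : 1 <= s + t; [rewrite m1 m2; clear -hm q; nra|lra].
have swap s' t' : aff (rp a) (rp b) (rp w) s' t' = aff (rp b) (rp a) (rp w) (1 - s' - t') t'.
  by rewrite /aff /=; f_equal; ring.
case: k1 => [[y1|y1|[q1 y1]]|[q1 y1]]; case: k2 => [[y2|y2|[q2 y2]]|[q2 y2]].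
- by move: z12; rewrite y1 y2 eqxx.
- by have [? ?] := ca _ _ _ y1 e1; have [? ?] := cb _ _ _ y2 e2; lra.
- by have [? ?] := ca _ _ _ y1 e1; case: q2 => k [_ [_ ?]]; lra.
- constructor 2; split=> //; have [? ?] := ca _ _ _ y1 e1.
  by exists z2, s2, t2; split; [rewrite ?gE y1| | |]; lra || done.
- by have [? ?] := cb _ _ _ y1 e1; have [? ?] := ca _ _ _ y2 e2; lra.
- by move: z12; rewrite y1 y2 eqxx.
- constructor 3; split=> //; have [? ?] := cb _ _ _ y1 e1.
  by exists z2, (1 - s2 - t2), t2; split; [rewrite ?gE y1|rewrite e2 swap| |]; lra || done.
- by have [? ?] := cb _ _ _ y1 e1; case: q2 => k [_ [_ ?]]; lra.
- by have [? ?] := ca _ _ _ y2 e2; case: q1 => k [_ [_ ?]]; lra.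
- constructor 3; split=> //; have [? ?] := cb _ _ _ y2 e2.
  by exists z1, (1 - s1 - t1), t1; split; [rewrite ?gE y2 set2C|rewrite e1 swap| |]; lra || done.
- by case: q1 => k [_ [_ ?]]; case: q2 => k' [_ [_ ?]]; lra.
- by constructor 1.
- constructor 2; split=> //; have [? ?] := ca _ _ _ y2 e2.
  by exists z1, s1, t1; split; [rewrite ?gE y2 set2C| | |]; lra || done.
- by have [? ?] := cb _ _ _ y2 e2; case: q1 => k [_ [_ ?]]; lra.
- by constructor 1.
- by case: q1 => k [_ [_ ?]]; case: q2 => k' [_ [_ ?]]; lra.
Qed.

(* [w'] is the reflected apex, so [w w'] is the diagonal obtained by flipping [a b]. *)
Lemma inc_side T a b w w' r k : planar V T -> tri V T a b w -> Z.abs (orient a b w) = 1%Z ->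
  (px w' = px a + px b - px w)%Z -> (py w' = py a + py b - py w)%Z ->
  (elen [set a; b] <= elen [set w; w'])%N -> segpt g r -> oseg (rp w) (rp w') r ->
  r = aff (rp a) (rp b) (rp w) k (1 - 2 * k) -> 0 < k < 1/2 -> ~ meet g [set a; b] ->
  (exists h p, [/\ adj T [set a; b] h p, meet g h &
     (2 * len [set a; b] - len [set w; w'] <= len h - 3 * len p + 4)%Z]) \/
  (exists x y, [/\ [set a; b] = [set x; y], x \in g &
     (2 * len [set a; b] - len [set w; w'] - len g <= 1 - len [set a; b])%Z]).
Proof.
move=> pl tr uni wx wy le gr owr er hk nab.
have et := tri_etri pl tr; have [D0 la lb lw emp] := et; have [ab bw aw D0'] := orient_neq0 D0.
have Le : len [set a; b] = len1 ((px w - px a) + (px b - px w)) ((py w - py a) + (py b - py w)).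
  by rewrite elen1; congr len1; ring.
have Lf : len [set w; w'] = len1 ((px b - px w) - (px w - px a)) ((py b - py w) - (py w - py a)).
  by rewrite elen1 wx wy; congr len1; ring.
have La : len [set a; w] = len1 (px w - px a) (py w - py a) by rewrite elen1.
have Lb : len [set b; w] = len1 (px b - px w) (py b - py w) by rewrite (set2C b w) elen1.
have U : Z.abs ((px w - px a) * (py b - py w) - (py w - py a) * (px b - px w)) = 1%Z.
  by rewrite -uni -Z.abs_opp /orient; congr Z.abs; ring.
have le' : (len1 ((px w - px a) + (px b - px w)) ((py w - py a) + (py b - py w)) <=
   len1 ((px b - px w) - (px w - px a)) ((py b - py w) - (py w - py a)))%Z by rewrite -Le -Lf; lia.
have F := long_diag_len U le'; have E := short_diag_len U le'.
have Dir := short_diag_dir U le'.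
rewrite -Lf -La -Lb in F; rewrite -Le -La -Lb in E; rewrite -Le -La -Lb in Dir.
have U2 : Z.abs ((px w - px b) * (py a - py w) - (py w - py b) * (px a - px w)) = 1%Z.
  by rewrite -uni /orient; congr Z.abs; ring.
have le2 : (len1 ((px w - px b) + (px a - px w)) ((py w - py b) + (py a - py w)) <=
   len1 ((px a - px w) - (px w - px b)) ((py a - py w) - (py w - py b)))%Z.
  by move: le'; rewrite /len1; clear; lia.
have Dir2 := short_diag_dir U2 le2.
have L2a : len1 (px a - px w) (py a - py w) = len [set a; w] by rewrite La /len1; clear; lia.
have L2b : len1 (px w - px b) (py w - py b) = len [set b; w] by rewrite Lb /len1; clear; lia.
have L2e : len1 ((px w - px b) + (px a - px w)) ((py w - py b) + (py a - py w)) = len [set a; b] by rewrite Le /len1; clear; lia.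
rewrite L2a L2b L2e in Dir2.
have pos (x y : pt n) : x != y -> (1 <= len [set x; y])%Z.
  move=> xy; rewrite elenZ; have : ~ ((px x - px y = 0 /\ py x - py y = 0)%Z).
    by move=> [q1 q2]; move/eqP: xy; apply; apply: pt_eq; lia.
  by clear; lia.
have pa := pos _ _ aw; have pb' := pos _ _ bw.
have adj1 : adj T [set a; b] [set b; w] [set a; w] by exists a, b, w.
have adj2 : adj T [set a; b] [set a; w] [set b; w].
  by exists b, a, w; split=> //; [exact: set2C|exact: tri_swap].
(* If g ended at w, it would run along the diagonal ww'; as it does not cross ab, it would stop
   inside the empty triangle or on ab. *)
have nw z1 z2 : g = [set z1; z2] -> z1 = w -> False.
  move=> gE q; rewrite q in gE; have gA := ga; rewrite gE in gA.
  have /adm_set2 [[wz _ lz2 _] pr] := gA.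
  have o : oseg (rp w) (rp z2) r by move: gr; rewrite gE => /segpt_set2 [].
  have [s1 [t1 ez]] := rp_aff z2 D0.
  have [m [hm em]] := o; have E1 : k = 0 + m * (s1 - 0) /\ 1 - 2 * k = 1 + m * (t1 - 1).
    apply: (aff_inj D0'); rewrite -er em ez -aff_mix -aff01 //.
  have s1p : 0 < s1 by case: E1 => q1 _; clear -q1 hm hk; nra.
  have t1E : t1 = 1 - 2 * s1.
    have : m * (t1 - 1 + 2 * s1) = 0 by case: E1; lra.
    by move=> /Rmult_integral [] q0; lra.
  have ow s' : 0 < s' < s1 -> oseg (rp w) (rp z2) (aff (rp a) (rp b) (rp w) s' (1 - 2 * s')).
    move=> hs'; have es : s' / s1 * s1 = s' by field; lra.
    exists (s' / s1); split; first by clear -es hs'; nra.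
    by rewrite ez t1E; move: (s' / s1) es => kp <-; rewrite /aff /=; f_equal; ring.
  have [l|[l|l]] := Rtotal_order s1 (1/2).
  - by apply: (etri_open_not_Lam0 et ez s1p _ _ lz2); lra.
  - have abT : [set a; b] \in T by case: tr.
    have [_ _ prab] := edge_data pl abT.
    by apply: (prab _ lz2); rewrite ez; apply/(oseg_ab et); lra.
  - apply: nab; exists (aff (rp a) (rp b) (rp w) (1/2) (1 - 2 * (1/2))); split.
      by rewrite gE; apply/segpt_set2; split=> //; apply: ow; lra.
    by apply/segpt_set2; split=> //; apply/(oseg_ab et); lra.
have K1 : 0 < k by lra.
have K2 : 0 < 1 - 2 * k by lra.
have K3 : k + (1 - 2 * k) < 1 by lra.
(* Let L and S be the longer and the shorter of |aw| and |bw|. Then |f| = L + S and |e| <= L - S +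
   2, so 2|e| - |f| <= L - 3S + 4, and the longer side is charged if g is known to meet it. The
   remaining case is that g starts at the end of e on the longer side; then [short_diag_dir] gives
   |g| >= L + |e|. *)
case: (tri_crossed pl tr gr er K1 K2 K3 nab nw) => [[m1 m2]|[[z [s1 [t1 [gE ez ps pt]]]] m1]|[[z [s1 [t1 [gE ez ps pt]]]] m1]].
- left; have [l|l] := Z_le_gt_dec (len [set a; w]) (len [set b; w]).
    by exists [set b; w], [set a; w]; split=> //; lia.
  by exists [set a; w], [set b; w]; split=> //; lia.
- have [l|l] := Z_le_gt_dec (len [set a; w]) (len [set b; w]).
    by left; exists [set b; w], [set a; w]; split=> //; lia.
  right; exists a, b; split=> //; first by rewrite gE set21.
  have [i [j zc]] := zcoord_ex z uni.
  have := zcoord_aff zc; rewrite ez => /(aff_inj D0') [ei ej].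
  have i1 : (1 <= i)%Z by rewrite ei in ps; move: ps => /lt_IZR; lia.
  have j1 : (1 <= j)%Z by rewrite ej in pt; move: pt => /lt_IZR; lia.
  have l' : (len [set b; w] < len [set a; w])%Z by lia.
  have := Dir i j l' i1 j1.
  have -> : len1 (i * (px w - px a + (px b - px w)) + j * (px w - px a)) (i * (py w - py a + (py b - py w)) + j * (py w - py a)) = len g.
    by rewrite gE elen1; case: zc => -> ->; congr len1; ring.
  by move: F E pa pb' l'; clear; lia.
- have [l|l] := Z_le_gt_dec (len [set b; w]) (len [set a; w]).
    by left; exists [set a; w], [set b; w]; split=> //; lia.
  right; exists b, a; split=> //; [exact: set2C|by rewrite gE set21|].
  have uni' : Z.abs (orient b a w) = 1%Z by rewrite orient_swap Z.abs_opp.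
  have [_ _ _ D0''] := @orient_neq0 n b a w ltac:(lia).
  have [i [j zc]] := zcoord_ex z uni'.
  have := zcoord_aff zc; rewrite ez => /(aff_inj D0'') [ei ej].
  have i1 : (1 <= i)%Z by rewrite ei in ps; move: ps => /lt_IZR; lia.
  have j1 : (1 <= j)%Z by rewrite ej in pt; move: pt => /lt_IZR; lia.
  have l' : (len [set a; w] < len [set b; w])%Z by lia.
  have := Dir2 i j l' i1 j1.
  have -> : len1 (i * (px w - px b + (px a - px w)) + j * (px w - px b)) (i * (py w - py b + (py a - py w)) + j * (py w - py b)) = len g.
    by rewrite gE elen1; case: zc => -> ->; congr len1; ring.
  by move: F E pa pb' l'; clear; lia.
Qed.

(** If g already meets e, the weight of e suffices because the new diagonal is at least as long.
    Otherwise g meets one of the open halves of the diagonal, and [inc_side] applies in the triangle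
    containing that half. *)
Lemma inc_bound T e U a b c d : Omega V xi T -> flip_quad V xi T e U a b c d ->
  (elen e <= elen [set c; d])%N -> meet [set c; d] g ->
  let x := lam ^ elen [set c; d] / (lam ^ elen [set c; d] + lam ^ elen e) * wt alpha g [set c; d] in
  [\/ meet e g /\ x <= wt alpha g e,
      (exists h p, [/\ adj T e h p, meet h g & x <= pz (len h - 3 * len p + 4 - len g)]) |
      (exists a' b', [/\ e = [set a'; b'], a' \in g & x <= pz (1 - len e)])].
Proof.
move=> oT fq le [r [fr gr]] x.
have pl := Omega_planar oT.
have X : x <= pz (2 * len e - len [set c; d] - len g) by apply: qrate_wt.
have [me|nme] := classic (meet e g).
  by constructor 1; split=> //; apply: Rle_trans X _; apply: pz_le => //; lia.
have nme' : ~ meet g [set a; b] by move=> [q [q1 q2]]; apply: nme; exists q; rewrite (fq_e fq).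
have /segpt_set2 [_ ocd] := fr.
have [k [hk [e1 e2]]] := diag_half fq ocd.
have et := tri_etri pl (fq_abc fq).
have key w w' k' : tri V T a b w -> Z.abs (orient a b w) = 1%Z -> (px w' = px a + px b - px w)%Z ->
    (py w' = py a + py b - py w)%Z -> [set w; w'] = [set c; d] -> oseg (rp w) (rp w') r ->
    r = aff (rp a) (rp b) (rp w) k' (1 - 2 * k') -> 0 < k' < 1/2 ->
    (exists h p, [/\ adj T e h p, meet h g & x <= pz (len h - 3 * len p + 4 - len g)]) \/
    (exists a' b', [/\ e = [set a'; b'], a' \in g & x <= pz (1 - len e)]).
  move=> tw uw wx wy ew ow er hk'.
  have le' : (elen [set a; b] <= elen [set w; w'])%N by rewrite ew -(fq_e fq).
  case: (inc_side pl tw uw wx wy le' gr ow er hk' nme') => [[h [p [h1 [q [h2 h2']] h3]]]|[x' [y' [h1 h2 h3]]]].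
    left; exists h, p; split; [by rewrite (fq_e fq)|by exists q|].
    by apply: Rle_trans X _; apply: pz_le => //; rewrite -ew (fq_e fq); lia.
  right; exists x', y'; split=> //; first by rewrite (fq_e fq).
  by apply: Rle_trans X _; apply: pz_le => //; rewrite -ew (fq_e fq); lia.
have pxd := fq_px fq; have pyd := fq_py fq.
have [l|[q|l]] := Rtotal_order k (1/2).
- case: (key c d k (fq_abc fq)) => //; [by rewrite (fq_or fq)|lra|by constructor 2|by constructor 3].
- case: nme'; exists r; split=> //; apply/segpt_set2; split; last first.
    by rewrite e1; apply/(oseg_ab et); lra.
  by have [] := @orient_neq0 n a b c; [rewrite (fq_or fq)|].
- have ud : Z.abs (orient a b d) = 1%Z.
    by rewrite (zcoord_orient (zcoord0 _ _ _) (zcoord1 _ _ _) (fq_d fq)) (fq_or fq).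
  case: (key d c (1 - k) (fq_abd fq) ud) => //.
  + lia.
  + lia.
  + exact: set2C.
  + exact: oseg_sym.
  + by rewrite e2; congr aff; ring.
  + lra.
  + by constructor 2.
  + by constructor 3.
Qed.

End Increase.

(** * Geometric sums over the lattice *)

Section Geometric.
Variable r : R.
Hypothesis r01 : 0 < r < 1.

Lemma geom_right a m : (1 - r) * \big[Rplus/R0]_(i < m) (if (a <= i)%N then r ^ (i - a) else 0) <= 1.
Proof.
suff -> : (1 - r) * \big[Rplus/R0]_(i < m) (if (a <= i)%N then r ^ (i - a) else 0) =
   if (a <= m)%N then 1 - r ^ (m - a) else 0.
  by case: ifP => _; [have := pow_lt r (m - a); lra|lra].
elim: m => [|m IH].
  by rewrite big_ord0; case: ifP => h; rewrite ?sub0n /=; lra.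
rewrite big_ord_recr /= Rmult_plus_distr_l IH; case: (leqP a m) => h.
  by rewrite (leqW h) subSn //=; ring.
case: (leqP a m.+1) => h'; last by ring.
have e : (m.+1 - a = 0)%N by lia.
by rewrite e; rewrite /=; ring.
Qed.

Lemma geom_left a m : (1 - r) * \big[Rplus/R0]_(i < m) (if (i < a)%N then r ^ (a - i) else 0) <= 1.
Proof.
suff h : (1 - r) * \big[Rplus/R0]_(i < m) (if (i < a)%N then r ^ (a - i) else 0) <= r ^ (a - m).
  apply: Rle_trans h _; rewrite -(pow1 (a - m)); apply: pow_incr; lra.
elim: m => [|m IH]; first by rewrite big_ord0 Rmult_0_r; apply: pow_le; lra.
rewrite big_ord_recr /= Rmult_plus_distr_l; case: ltnP => h.
  have e : (a - m = (a - m.+1).+1)%N by lia.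
  rewrite e in IH *; rewrite -tech_pow_Rmult in IH *.
  have hR := pow_lt r (a - m.+1) (proj1 r01).
  have hh : 0 <= r ^ (a - m.+1) * ((1 - r) * (1 - r)) by apply: Rmult_le_pos; nra.
  by apply: Rle_trans (Rplus_le_compat_r _ _ _ IH) _; lra.
have e : (a - m = a - m.+1)%N by lia.
by rewrite -e Rmult_0_r Rplus_0_r.
Qed.

Lemma geom_two_sided a m : \big[Rplus/R0]_(i < m) r ^ ((a - i) + (i - a)) <= 2 / (1 - r).
Proof.
have -> : \big[Rplus/R0]_(i < m) r ^ ((a - i) + (i - a)) =
   \big[Rplus/R0]_(i < m) (if (a <= i)%N then r ^ (i - a) else 0) + \big[Rplus/R0]_(i < m) (if (i < a)%N then r ^ (a - i) else 0).
  rewrite -big_split /=; apply: eq_bigr => i _; case: leqP => h.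
    have e : (a - i + (i - a) = i - a)%N by lia.
    by rewrite e; rewrite Rplus_0_r.
  have e : (a - i + (i - a) = a - i)%N by lia.
  by rewrite e; rewrite Rplus_0_l.
have h1 := geom_right a m; have h2 := geom_left a m.
apply: (Rmult_le_reg_l (1 - r)); first lra.
have -> : (1 - r) * (2 / (1 - r)) = 2 by field; lra.
lra.
Qed.

(** The l1 distance splits by coordinates, so the sum is a product of two two-sided geometric sums,
    bounded uniformly in n and a. *)
Lemma geom_lattice n (a : pt n) : \rsum_(b | true) r ^ dist1 a b <= (2 / (1 - r)) * (2 / (1 - r)).
Proof.
have E (b : pt n) : dist1 a b = ((a.1 - b.1 + (b.1 - a.1)) + (a.2 - b.2 + (b.2 - a.2)))%N.
  by rewrite /dist1 /px /py; lia.
have -> : \rsum_(b | true) r ^ dist1 a b =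
   \big[Rplus/R0]_(i < (2 * n).+1) \big[Rplus/R0]_(j < (2 * n).+1) (r ^ (a.1 - i + (i - a.1)) * r ^ (a.2 - j + (j - a.2))).
  rewrite pair_bigA /=; apply: eq_bigr => b _; by rewrite E pow_add.
have h1 := geom_two_sided a.1 (2 * n).+1; have h2 := geom_two_sided a.2 (2 * n).+1.
have p0 : 0 <= 2 / (1 - r) by apply: Rle_mult_inv_pos; lra.
apply: Rle_trans (_ : \big[Rplus/R0]_(i < (2 * n).+1) (r ^ (a.1 - i + (i - a.1)) * (2 / (1 - r))) <= _).
  apply: rsum_le => i _; rewrite -rsum_mull; apply: Rmult_le_compat_l => //; apply: pow_le; lra.
by rewrite -rsum_mulr; apply: Rmult_le_compat_r.
Qed.
End Geometric.

(** * Adding up the charges *)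

Section Total.
Variable n : nat.
Variables (V : seq (pt n)) (xi : {set edge n}).
Hypothesis bc : boundary_cond V xi.
Variables (alpha lam : R) (g : edge n).
Hypothesis al1 : 1 < alpha.
Hypothesis lam01 : 0 < lam < 1.
Hypothesis al_lam : alpha * alpha * lam <= 1.
Hypothesis ga : admissible V g.
Implicit Types (a b c d z w : pt n) (e f h p : edge n) (T U : {set edge n}).
Local Notation pz := (powerRZ alpha).
Local Notation len e := (Z.of_nat (elen e)).
Local Notation Psig := (Psi V xi g alpha).
Local Notation phig := (phi alpha g).
Local Notation Phig := (Phi V xi alpha g).

(** Bound for the sum of alpha^(1 - |a - b|) over lattice points b, that is, for everything charged
    to one endpoint of g. *)
Definition latC : R := alpha * ((2 / (1 - / alpha)) * (2 / (1 - / alpha))).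

Lemma latC_sum a : \rsum_(b | true) pz (1 - Z.of_nat (dist1 a b)) <= latC.
Proof.
have r01 : 0 < / alpha < 1.
  split; first by apply: Rinv_0_lt_compat; lra.
  by rewrite -Rinv_1; apply: Rinv_lt_contravar; lra.
have -> : \rsum_(b | true) pz (1 - Z.of_nat (dist1 a b)) = alpha * \rsum_(b | true) (/ alpha) ^ dist1 a b.
  rewrite rsum_mull; apply: eq_bigr => b _; rewrite pz_add //.
  by rewrite powerRZ_neg' -pow_powerRZ pow_inv /= Rmult_1_r.
by apply: Rmult_le_compat_l; [lra|exact: geom_lattice].
Qed.

Lemma latC_ge0 : 0 <= latC.
Proof.
have h : 0 < 1 - / alpha.
  suff : / alpha < 1 by lra.
  by rewrite -Rinv_1; apply: Rinv_lt_contravar; lra.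
have h2 : 0 <= 2 / (1 - / alpha) by apply: Rle_mult_inv_pos; lra.
by rewrite /latC; apply: Rmult_le_pos; [lra|apply: Rmult_le_pos].
Qed.

Definition adjE T e h : Prop := exists p, adj V T e h p.

Lemma card_apex T (h1 h2 : pt n) : planar V T -> (#|[set w | pb (tri V T h1 h2 w)]| <= 2)%N.
Proof.
move=> pl.
pose A1 := [set w | pb (tri V T h1 h2 w /\ (0 < orient h1 h2 w)%Z)].
pose A2 := [set w | pb (tri V T h1 h2 w /\ (orient h1 h2 w < 0)%Z)].
have c1 : (#|A1| <= 1)%N.
  apply/card_le1_eqP => x y; rewrite !inE => /pbP [tx ox] /pbP [ty oy].
  by apply: (tri_unique pl ty tx); nia.
have c2 : (#|A2| <= 1)%N.
  apply/card_le1_eqP => x y; rewrite !inE => /pbP [tx ox] /pbP [ty oy].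
  by apply: (tri_unique pl ty tx); nia.
apply: leq_trans (_ : #|A1 :|: A2| <= 2)%N.
  apply: subset_leq_card; apply/subsetP => w; rewrite !inE => /pbP tw.
  have [D0 _ _ _ _] := tri_etri pl tw.
  have [l|l] : (0 < orient h1 h2 w \/ orient h1 h2 w < 0)%Z by lia.
    by apply/orP; left; apply/pbP.
  by apply/orP; right; apply/pbP.
by apply: leq_trans (leq_card_setU _ _) _; lia.
Qed.

(** h is a side of at most two triangles, each with two further sides. This is the 4 in the drift
    bounds. *)
Lemma card_adj T h : planar V T -> (#|[set e | pb (adjE T e h)]| <= 4)%N.
Proof.
move=> pl; have [[h1 [h2 [hE h12]]]|no] := classic (exists h1 h2 : pt n, h = [set h1; h2] /\ h1 != h2); last first.
  rewrite (_ : [set e | _] = set0) ?cards0 //; apply/setP => e; rewrite !inE; apply/negbTE/negP.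
  move=> /pbP [p [a [b [w [_ hE _ tr]]]]]; apply: no; exists b, w; split=> //.
  by have [D0 _ _ _ _] := tri_etri pl tr; have [] := orient_neq0 D0.
pose A := [set w | pb (tri V T h1 h2 w)].
apply: leq_trans (_ : #|[set [set w; h1] | w in A] :|: [set [set w; h2] | w in A]| <= 4)%N.
  apply: subset_leq_card; apply/subsetP => e; rewrite !inE => /pbP [p [a [b [w [eE hE' _ tr]]]]].
  rewrite hE in hE'; apply/orP; case: (set2_eq hE') => [] [q1 q2].
    left; apply/imsetP; exists a; last by rewrite eE q1.
    by rewrite inE; apply/pbP; rewrite q1 q2; apply: tri_rot.
  right; apply/imsetP; exists a; last by rewrite eE q2.
  by rewrite inE; apply/pbP; rewrite q1 q2; apply: tri_swap; apply: tri_rot.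
apply: leq_trans (leq_card_setU _ _) _.
have cA : (#|A| <= 2)%N by apply: card_apex.
have c1 : (#|[set [set w; h1] | w in A]| <= #|A|)%N by apply: leq_imset_card.
have c2 : (#|[set [set w; h2] | w in A]| <= #|A|)%N by apply: leq_imset_card.
lia.
Qed.

(** [beta] is any bound for the charge that a side h can receive. Leaving it free allows a much
    smaller value on a single long edge. *)
Lemma flip_sum_Psi_le T e (beta : edge n -> R) : Omega V xi T -> e \in T ->
  (forall h, 0 <= beta h) ->
  (forall h p, h \in T -> adj V T e h p -> meet h g -> pz (len h - 3 * len p + 4 - len g) <= beta h) ->
  flip_sum V xi lam Psig T e <= phig e + \rsum_(h | (h \in T) && pb (adjE T e h)) beta h +
     \rsum_(a in g) \rsum_(b | e == [set a; b]) pz (1 - Z.of_nat (dist1 a b)).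
Proof.
move=> oT eT b0 hb.
set B := \rsum_(h | (h \in T) && pb (adjE T e h)) beta h.
set C := \rsum_(a in g) _.
have S1 : 0 <= B by apply: rsum_ge0.
have S2 : 0 <= C.
  by apply: rsum_ge0 => a _; apply: rsum_ge0 => b _; apply: Rlt_le; apply: pz_gt0.
have S0 := phi_ge0 g al1 e.
case: (flip_sum_cases bc lam Psig e oT) => [[_ ->]|[U [a [b [c [d [fq ->]]]]]]]; first lra.
rewrite (Psi_flip bc alpha g oT fq).
have q01 := qrate_bounds lam01 (elen [set c; d]) (elen e).
set q := _ / _ in q01 *.
have -> : Psig T - Phig e + Phig [set c; d] - Psig T = Phig [set c; d] - Phig e by ring.
have [lt|le] := ltnP (elen [set c; d]) (elen e).
  have := Phi_down bc g al1 oT fq lt; rewrite -/(Phig e); have := q01; nra.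
have up := Phi_up bc g al1 oT fq le.
have qle : q * (Phig [set c; d] - Phig e) <= q * phig [set c; d] by apply: Rmult_le_compat_l; lra.
apply: Rle_trans qle _; have [m|nm] := classic (meet [set c; d] g); last first.
  by rewrite (phi_nmeet _ nm); lra.
rewrite (phi_meet _ m).
case: (inc_bound al1 lam01 al_lam ga oT fq le m) => [[me x]|[h [p [ad mh x]]]|[a' [b' [ee ag x]]]].
- have xq : q * wt alpha g [set c; d] <= phig e by rewrite (phi_meet _ me).
  lra.
- have hT : h \in T by case: ad => a1 [b1 [w1 [_ -> _ [_ []]]]].
  have t : beta h <= B.
    apply: (rsum_ge_term (F := beta)) => [i _|]; first exact: b0.
    by rewrite hT; apply/pbP; exists p.
  have xq : q * wt alpha g [set c; d] <= pz (len h - 3 * len p + 4 - len g) := x.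
  have := hb h p hT ad mh; lra.
- have t1 : pz (1 - Z.of_nat (dist1 a' b')) <= \rsum_(b | e == [set a'; b]) pz (1 - Z.of_nat (dist1 a' b)).
    apply: (rsum_ge_term (F := fun b => pz (1 - Z.of_nat (dist1 a' b)))) => [i _|]; last by rewrite ee.
    by apply: Rlt_le; apply: pz_gt0.
  have t2 : \rsum_(b | e == [set a'; b]) pz (1 - Z.of_nat (dist1 a' b)) <= C.
    apply: (rsum_ge_term (F := fun a => \rsum_(b | e == [set a; b]) pz (1 - Z.of_nat (dist1 a b)))) => // i _.
    by apply: rsum_ge0 => j _; apply: Rlt_le; apply: pz_gt0.
  have xq : q * wt alpha g [set c; d] <= pz (1 - Z.of_nat (dist1 a' b')) by rewrite -elen_set2 -ee.
  lra.
Qed.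

Lemma card_g : #|g| = 2%N.
Proof. by have [a [b [-> ab]]] := adm_ex ga; rewrite cards2 ab. Qed.

(** [P] serves to leave out the flip of a chosen edge while the charges to all edges are still
    counted. *)
Lemma inc_total T (P : pred (edge n)) (beta : edge n -> R) : Omega V xi T ->
  (forall h, 0 <= beta h) ->
  (forall e h p, h \in T -> adj V T e h p -> meet h g -> pz (len h - 3 * len p + 4 - len g) <= beta h) ->
  \rsum_(e | (e \in T) && P e) flip_sum V xi lam Psig T e <=
  \rsum_(e | (e \in T) && P e) phig e + 4 * (\rsum_(h in T) beta h) + 2 * latC.
Proof.
move=> oT b0 hb; have pl := Omega_planar oT.
apply: Rle_trans (_ : \rsum_(e | (e \in T) && P e) (phig e + \rsum_(h | (h \in T) && pb (adjE T e h)) beta h +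
     \rsum_(a in g) \rsum_(b | e == [set a; b]) pz (1 - Z.of_nat (dist1 a b))) <= _).
  by apply: rsum_le => e /andP[eT _]; apply: flip_sum_Psi_le => // h p; apply: hb.
have -> : \rsum_(e | (e \in T) && P e) (phig e + \rsum_(h | (h \in T) && pb (adjE T e h)) beta h +
     \rsum_(a in g) \rsum_(b | e == [set a; b]) pz (1 - Z.of_nat (dist1 a b))) =
   \rsum_(e | (e \in T) && P e) phig e + \rsum_(e | (e \in T) && P e) \rsum_(h | (h \in T) && pb (adjE T e h)) beta h +
   \rsum_(e | (e \in T) && P e) \rsum_(a in g) \rsum_(b | e == [set a; b]) pz (1 - Z.of_nat (dist1 a b)).
  by rewrite !big_split.
have B : \rsum_(e | (e \in T) && P e) \rsum_(h | (h \in T) && pb (adjE T e h)) beta h <= 4 * \rsum_(h in T) beta h.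
  apply: Rle_trans (_ : \rsum_(e | true) \rsum_(h | (h \in T) && pb (adjE T e h)) beta h <= _).
    by apply: rsum_le_subset => // e _; apply: rsum_ge0.
  rewrite (exchange_big_dep (mem T)) /= => [|e h _ /andP[]//].
  rewrite rsum_mull; apply: rsum_le => h hT.
  have -> : \rsum_(i | (h \in T) && pb (adjE T i h)) beta h = \rsum_(i in [set e | pb (adjE T e h)]) beta h.
    by apply: eq_bigl => i; rewrite inE hT.
  rewrite rsum_const; apply: Rmult_le_compat_r => //.
  by have -> : 4 = INR 4 by [rewrite /=; ring]; apply: le_INR; apply/leP; apply: card_adj.
have C : \rsum_(e | (e \in T) && P e) \rsum_(a in g) \rsum_(b | e == [set a; b]) pz (1 - Z.of_nat (dist1 a b)) <= 2 * latC.
  apply: Rle_trans (_ : \rsum_(e | true) \rsum_(a in g) \rsum_(b | e == [set a; b]) pz (1 - Z.of_nat (dist1 a b)) <= _).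
    apply: rsum_le_subset => // e _; apply: rsum_ge0 => a _; apply: rsum_ge0 => b _; apply: Rlt_le; exact: pz_gt0.
  rewrite exchange_big /=.
  apply: Rle_trans (_ : \rsum_(a in g) latC <= _); last first.
    by rewrite rsum_const card_g /=; lra.
  apply: rsum_le => a _; rewrite (exchange_big_dep xpredT) //=.
  apply: Rle_trans (latC_sum a); apply: Req_le; apply: eq_bigr => b _.
  by rewrite big_pred1_eq.
apply: Rplus_le_compat; last first. exact: C.
by apply: Rplus_le_compat; [apply: Rle_refl|exact: B].
Qed.

End Total.

(** * States dominated by one long edge *)

(** Go to the nearer vertical line, x = 1 if k >= 1/2 and x = 0 otherwise. The slope is below 1 in
    absolute value, so the height changes by less than the distance to that line and stays strictly
    between 0 and 1. The segment cannot stop there because its ends are lattice points. *)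
Lemma unit_square_exit_lr (x1 y1 x2 y2 : Z) (k m : R) : 0 < k < 1 -> 0 < m < 1 -> (x1 < x2)%Z ->
  (Z.abs (y2 - y1) < x2 - x1)%Z ->
  k = IZR x1 + m * (IZR x2 - IZR x1) -> k = IZR y1 + m * (IZR y2 - IZR y1) ->
  exists m' h v, [/\ 0 < m' < 1, 0 < h < 1, v = 0 \/ v = 1, v = IZR x1 + m' * (IZR x2 - IZR x1) &
    h = IZR y1 + m' * (IZR y2 - IZR y1)].
Proof.
move=> hk hm lx ly e1 e2.
have lX : 0 < IZR x2 - IZR x1 by have := IZR_lt _ _ lx; lra.
have [lY1 lY2] : IZR y2 - IZR y1 < IZR x2 - IZR x1 /\ - (IZR x2 - IZR x1) < IZR y2 - IZR y1.
  by split; rewrite -!minus_IZR -?opp_IZR; apply: IZR_lt; lia.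
have x1n : (x1 <= 0)%Z.
  have : IZR x1 < 1 by clear -e1 hm lX hk; nra.
  by move=> /lt_IZR; lia.
have x2p : (1 <= x2)%Z.
  have : IZR x2 > 0 by clear -e1 hm lX hk; nra.
  by move=> /lt_IZR; lia.
have r1 := IZR_le _ _ x1n; have r2 := IZR_le _ _ x2p.
have nint (y : Z) : 0 < IZR y < 1 -> False by move=> [/lt_IZR q1 /lt_IZR q2]; lia.
set X := IZR x2 - IZR x1 in lX lY1 lY2 e1 *; set Y := IZR y2 - IZR y1 in lY1 lY2 e2 *.
have [kh|kh] := Rle_lt_dec (1/2) k.
- pose m' := (1 - IZR x1) / X; have m'X : m' * X = 1 - IZR x1 by rewrite /m'; field; lra.
  have dX : (m' - m) * X = 1 - k by rewrite Rmult_minus_distr_r m'X; lra.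
  have dp : 0 < m' - m by clear -dX lX hk; nra.
  have h1 : (m' - m) * Y < 1 - k by rewrite -dX; apply: Rmult_lt_compat_l.
  have h2 : - (1 - k) < (m' - m) * Y.
    by rewrite -dX -Ropp_mult_distr_r_reverse; apply: Rmult_lt_compat_l.
  have hh : IZR y1 + m' * Y = k + (m' - m) * Y by rewrite Rmult_minus_distr_r; lra.
  have [q|q] : x2 = 1%Z \/ (2 <= x2)%Z by lia.
    exfalso; apply: (nint y2); have m1 : m' = 1.
      by rewrite /m' /X q; field; rewrite -q; rewrite /X in lX; lra.
    by rewrite m1 in h1 h2 hh; have YE : Y = IZR y2 - IZR y1 by []; lra.
  have r3 := IZR_le _ _ q.
  exists m', (IZR y1 + m' * Y), 1; split=> //; [|lra|by right|lra].
  by split; [lra|clear -m'X r3 lX r1; rewrite /X in m'X lX *; nra].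
- pose m' := (- IZR x1) / X; have m'X : m' * X = - IZR x1 by rewrite /m'; field; lra.
  have dX : (m - m') * X = k by rewrite Rmult_minus_distr_r m'X; lra.
  have dp : 0 < m - m' by clear -dX lX hk; nra.
  have h1 : (m - m') * Y < k by rewrite -dX; apply: Rmult_lt_compat_l.
  have h2 : - k < (m - m') * Y.
    by rewrite -dX -Ropp_mult_distr_r_reverse; apply: Rmult_lt_compat_l.
  have hh : IZR y1 + m' * Y = k - (m - m') * Y by rewrite Rmult_minus_distr_r; lra.
  have [q|q] : x1 = 0%Z \/ (x1 <= -1)%Z by lia.
    exfalso; apply: (nint y1); have m1 : m' = 0.
      by rewrite /m' q; field; lra.
    by rewrite m1 in h1 h2 hh; lra.
  have r3 := IZR_le _ _ q.
  exists m', (IZR y1 + m' * Y), 0; split=> //; [|lra|by left|lra].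
  by split; [clear -m'X r3 lX; nra|lra].
Qed.

Lemma unit_square_exit (x1 y1 x2 y2 : Z) (k m : R) : 0 < k < 1 -> 0 < m < 1 ->
  (Z.abs (y2 - y1) < Z.abs (x2 - x1))%Z ->
  k = IZR x1 + m * (IZR x2 - IZR x1) -> k = IZR y1 + m * (IZR y2 - IZR y1) ->
  exists m' h v, [/\ 0 < m' < 1, 0 < h < 1, v = 0 \/ v = 1, v = IZR x1 + m' * (IZR x2 - IZR x1) &
    h = IZR y1 + m' * (IZR y2 - IZR y1)].
Proof.
move=> hk hm l e1 e2; have [lx|lx] := Z_lt_le_dec x1 x2.
  by apply: (@unit_square_exit_lr _ _ _ _ k m) => //; lia.
have [||||||m' [h [v [q1 q2 q3 q4 q5]]]] := @unit_square_exit_lr x2 y2 x1 y1 k (1 - m) => //; try lra; try lia.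
exists (1 - m'), h, v; split=> //; lra.
Qed.

(** * Lattice segments across a parallelogram *)

Section Parallelogram.
Variable n : nat.
Implicit Types (a b c d z : pt n) (g : edge n).
Local Notation len e := (Z.of_nat (elen e)).

(** Let x and y be the components of g along ac and ad. In coordinates where the parallelogram is
    the unit square, |x| > |y| would make g cross ad or bc by [unit_square_exit]. So |y| >= |x|, y
    is nonzero, and |g| >= |y| |ad| - |x| |ac| >= |ad| - |ac|. *)
Lemma para_cross a b c d g : Z.abs (orient a c d) = 1%Z ->
  zcoord a c d b 1 1 -> (exists z1 z2, g = [set z1; z2] /\ z1 != z2) ->
  meet g [set a; b] -> ~ meet g [set b; c] -> ~ meet g [set a; d] ->
  (len [set a; c] <= len [set a; d])%Z -> (len [set a; d] - len [set a; c] <= len g)%Z.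
Proof.
move=> uni zb [z1 [z2 [gE z12]]] [r [gr abr]] nbc nad le.
have D0 : orient a c d <> 0%Z by move=> q; rewrite q in uni.
have [ac cd ad D0'] := orient_neq0 D0.
have [x1 [y1 zc1]] := zcoord_ex z1 uni; have [x2 [y2 zc2]] := zcoord_ex z2 uni.
have E1 := zcoord_aff zc1; have E2 := zcoord_aff zc2; have Eb := zcoord_aff zb.
have E0 := aff00 (rp a) (rp c) (rp d).
have gseg q : segpt g q <-> oseg (rp z1) (rp z2) q.
  by rewrite gE segpt_set2; split=> [[]|].
have [m [hm em]] := proj1 (gseg r) gr; rewrite E1 E2 aff_mix in em.
have /segpt_set2 [ab [k [hk ek]]] := abr.
rewrite Eb {}em in ek; have {}ek := etrans ek (_ : _ = aff (rp a) (rp c) (rp d) k k).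
have {}ek : aff (rp a) (rp c) (rp d) (IZR x1 + m * (IZR x2 - IZR x1)) (IZR y1 + m * (IZR y2 - IZR y1)) = aff (rp a) (rp c) (rp d) k k.
  by apply: ek; rewrite /aff /=; f_equal; ring.
have [k1 k2] := aff_inj D0' ek.
have [l|l] := Z_lt_le_dec (Z.abs (y2 - y1)) (Z.abs (x2 - x1)).
  have e1 : k = IZR x1 + m * (IZR x2 - IZR x1) by lra.
  have e2 : k = IZR y1 + m * (IZR y2 - IZR y1) by lra.
  have [m' [h [v [q1 q2 q3 q4 q5]]]] := unit_square_exit hk hm l e1 e2.
  have gp : segpt g (aff (rp a) (rp c) (rp d) v h).
    by apply/gseg; exists m'; split=> //; rewrite E1 E2 aff_mix -q4 -q5.
  case: q3 => qv; rewrite qv in gp.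
    case: nad; exists (aff (rp a) (rp c) (rp d) 0 h); split=> //; apply/segpt_set2; split=> //.
    exists h; split=> //; rewrite [X in X.1 + h * _]E0 [X in _ + h * (_ - X.1)]E0 (aff01 (rp a) (rp c) (rp d)).
    by rewrite /aff /=; f_equal; ring.
  case: nbc; exists (aff (rp a) (rp c) (rp d) 1 h); split=> //; rewrite set2C; apply/segpt_set2; split.
    by apply/eqP => q; case: zb; rewrite -q => w1 w2; have : rp a = rp d; [rewrite /rp; congr (IZR _, IZR _); lia|move=> /rp_inj q'; move: ad; rewrite q' eqxx].
  exists h; split=> //; rewrite Eb (aff10 (rp a) (rp c) (rp d)).
  by rewrite /aff /=; f_equal; ring.
have Lg : len g = len1 ((x2 - x1) * (px c - px a) + (y2 - y1) * (px d - px a)) ((x2 - x1) * (py c - py a) + (y2 - y1) * (py d - py a)).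
  rewrite gE elen1; case: zc1 zc2 => -> -> [-> ->]; congr len1; ring.
have y0 : (1 <= Z.abs (y2 - y1))%Z.
  have [q|//] : (Z.abs (y2 - y1) = 0 \/ 1 <= Z.abs (y2 - y1))%Z by lia.
  have q1 : y2 = y1 by lia.
  have q2 : x2 = x1 by lia.
  by move: zc2; rewrite q1 q2 => /(zcoord_inj zc1) q3; move: z12; rewrite q3 eqxx.
rewrite Lg; rewrite !elen1 in le *.
move: l y0 le; move: (x2 - x1)%Z (y2 - y1)%Z (px c - px a)%Z (py c - py a)%Z (px d - px a)%Z (py d - py a)%Z.
clear => x y u1 u2 v1 v2; rewrite /len1 => l y0 le.
have tr (p q : Z) : (Z.abs q <= Z.abs (p + q) + Z.abs p)%Z by lia.
have t1 := tr (x * u1)%Z (y * v1)%Z; have t2 := tr (x * u2)%Z (y * v2)%Z.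
rewrite !Z.abs_mul in t1 t2.
have h1 : (Z.abs x * (Z.abs u1 + Z.abs u2) <= Z.abs y * (Z.abs u1 + Z.abs u2))%Z by apply: Z.mul_le_mono_nonneg_r; lia.
have h2 : (1 * (Z.abs v1 + Z.abs v2 - (Z.abs u1 + Z.abs u2)) <= Z.abs y * (Z.abs v1 + Z.abs v2 - (Z.abs u1 + Z.abs u2)))%Z.
  by apply: Z.mul_le_mono_nonneg_r; lia.
move: t1 t2 h1 h2; move: (Z.abs (x * u1 + y * v1)) (Z.abs (x * u2 + y * v2)) => A B.
move: (Z.abs x) (Z.abs y) (Z.abs u1) (Z.abs u2) (Z.abs v1) (Z.abs v2) => *; lia.
Qed.

End Parallelogram.

(** * Drift of the height function and of its non-maximal part *)

Section Drift.
Variable n : nat.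
Variables (V : seq (pt n)) (xi : {set edge n}).
Hypothesis bc : boundary_cond V xi.
Variables (alpha lam : R) (g : edge n).
Hypothesis al1 : 1 < alpha.
Hypothesis lam01 : 0 < lam < 1.
Hypothesis al_lam : alpha * alpha * lam <= 1.
Hypothesis ga : admissible V g.
Implicit Types (a b c d z w : pt n) (e f h p : edge n) (T U : {set edge n}).
Local Notation pz := (powerRZ alpha).
Local Notation len e := (Z.of_nat (elen e)).
Local Notation Psig := (Psi V xi g alpha).
Local Notation phig := (phi alpha g).
Local Notation Phig := (Phi V xi alpha g).

(** The maximum defaults to 0, its value when no edge of [T] meets g. *)
Definition top_weight T : R := rmax T phig.
Definition rest_weight T : R := Psig T - top_weight T.

Lemma top_weight_le T : Omega V xi T -> top_weight T <= Psig T.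
Proof.
move=> oT; rewrite (Psi_E bc alpha g oT); apply: rmax_le.
  by apply: rsum_ge0 => e _; apply: Phi_ge0.
move=> e eT; apply: Rle_trans (Phi_ge_phi g al1 oT eT) _.
by apply: (rsum_ge_term (F := Phig)) => // i _; apply: Phi_ge0.
Qed.

Lemma rest_weight_ge0 T : Omega V xi T -> 0 <= rest_weight T.
Proof. by move=> oT; have := top_weight_le oT; rewrite /rest_weight; lra. Qed.

Lemma rest_weight_others T e : Omega V xi T -> e \in T -> phig e = top_weight T ->
  \rsum_(h | (h \in T) && (h != e)) Phig h <= rest_weight T.
Proof.
move=> oT eT pe; have E : Psig T = Phig e + \rsum_(h | (h \in T) && (h != e)) Phig h.
  by rewrite (Psi_E bc alpha g oT) (bigD1 e).
rewrite /rest_weight E -pe.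
by have := Phi_ge_phi g al1 oT eT; lra.
Qed.

(** The maximum grows by at most the term of the new edge, and this term is part of the new [Phi];
    so the rest loses at most the contribution of the flipped midpoint. *)
Lemma rest_weight_flip T e U a b c d : Omega V xi T -> flip_quad V xi T e U a b c d ->
  rest_weight T - Phig e <= rest_weight U.
Proof.
move=> oT fq; have oU := flip_quad_Omega bc oT fq.
have p1 : phig [set c; d] <= Phig [set c; d].
  by apply: (Phi_ge_phi g al1 oU); rewrite (fq_T' fq) !inE eqxx orbT.
rewrite /rest_weight (Psi_flip bc alpha g oT fq).
suff : top_weight U <= top_weight T + phig [set c; d] by lra.
have m0 : 0 <= top_weight T by apply: rmax_ge0.
have f0 := phi_ge0 g al1 [set c; d].
apply: rmax_le => [|h]; first lra.
rewrite (fq_T' fq) !inE => /orP[/andP[_ hT]|/eqP->]; last lra.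
by have := rmax_ub phig hT; rewrite -/(top_weight T); lra.
Qed.

(** The contributions of all edges but a heaviest one sum to at most Z, so their flips lose at most
    Z together. The flip of the heaviest edge loses at most Z because Z stays nonnegative. *)
Lemma rest_weight_drift T : Omega V xi T ->
  - 2 * rest_weight T <= \rsum_(e in T) flip_sum V xi lam rest_weight T e.
Proof.
move=> oT; have z0 := rest_weight_ge0 oT.
have one e : - Phig e <= flip_sum V xi lam rest_weight T e.
  have P0 := Phi_ge0 V xi g al1 e.
  case: (flip_sum_cases bc lam rest_weight e oT) => [[_ ->]|[U [a [b [c [d [fq ->]]]]]]]; first lra.
  have := rest_weight_flip oT fq; have := qrate_bounds lam01 (elen [set c; d]) (elen e).
  by move: (lam ^ _ / _) => q hq h; nra.
have negsum P : \rsum_(e | P e) (- Phig e) = - (\rsum_(e | P e) Phig e).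
  have -> : - (\rsum_(e | P e) Phig e) = (-1) * (\rsum_(e | P e) Phig e) by ring.
  by rewrite rsum_mull; apply: eq_bigr => e _; ring.
case: (rmax_att T phig) => [m0|[f fT pf]].
  apply: Rle_trans (_ : \rsum_(e in T) (- Phig e) <= _); last by apply: rsum_le.
  have -> : \rsum_(e in T) (- Phig e) = - rest_weight T.
    by rewrite negsum -(Psi_E bc alpha g oT) /rest_weight /top_weight m0; ring.
  lra.
rewrite (bigD1 f) //=.
have h1 : - rest_weight T <= flip_sum V xi lam rest_weight T f.
  case: (flip_sum_cases bc lam rest_weight f oT) => [[_ ->]|[U [a [b [c [d [fq ->]]]]]]]; first lra.
  have := rest_weight_ge0 (flip_quad_Omega bc oT fq); have := qrate_bounds lam01 (elen [set c; d]) (elen f).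
  by move: (lam ^ _ / _) => q hq h; nra.
have h2 : - rest_weight T <= \rsum_(e | (e \in T) && (e != f)) flip_sum V xi lam rest_weight T e.
  apply: Rle_trans (rsum_le (fun e _ => one e)).
  by rewrite negsum; apply: Ropp_le_contravar; apply: rest_weight_others.
apply: Rle_trans (Rplus_le_compat _ _ _ _ h1 h2); lra.
Qed.

Lemma elen_pos a b : a != b -> (1 <= len [set a; b])%Z.
Proof.
move=> ab; rewrite elenZ; have : ~ ((px a - px b = 0 /\ py a - py b = 0)%Z).
  by move=> [q1 q2]; move/eqP: ab; apply; apply: pt_eq; lia.
by clear; lia.
Qed.

Lemma adj_third_pos T e h p : adj V T e h p -> (1 <= len p)%Z.
Proof.
move=> [a [b [w [_ _ -> [_ [_ [_ [o _]]]]]]]]; apply: elen_pos.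
by have [] := orient_neq0 o.
Qed.

(** The third side has length at least 1, which leaves only a factor alpha. *)
Lemma adj_weight T e h p : adj V T e h p -> meet h g ->
  pz (len h - 3 * len p + 4 - len g) <= alpha * phig h.
Proof.
move=> ad m; rewrite (phi_meet _ m) /wt.
have -> : alpha * pz (len h - len g) = pz (1 + (len h - len g)) by rewrite pz_add //= Rmult_1_r.
by apply: pz_le => //; have := adj_third_pos ad; lia.
Qed.

Lemma Psi_drift_le T : Omega V xi T ->
  \rsum_(e in T) flip_sum V xi lam Psig T e <= (1 + 4 * alpha) * Psig T + 2 * latC alpha.
Proof.
move=> oT.
have b0 h : 0 <= alpha * phig h by have := phi_ge0 g al1 h; nra.
have := inc_total bc al1 lam01 al_lam ga xpredT oT b0 (fun e h p _ => @adj_weight T e h p).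
have eP F : \rsum_(e | (e \in T) && true) F e = \rsum_(e in T) F e :> R by apply: eq_bigl => e; rewrite andbT.
rewrite !eP -rsum_mull.
have : \rsum_(h in T) phig h <= Psig T.
  by rewrite (Psi_E bc alpha g oT); apply: rsum_le => h; apply: Phi_ge_phi.
move: (\rsum_(h in T) phig h) => s hs hle; apply: Rle_trans hle _; nra.
Qed.

End Drift.

Lemma qrate_ge lam i j k : 0 < lam < 1 -> (i + k <= j)%N -> 1 - lam ^ k <= lam ^ i / (lam ^ i + lam ^ j).
Proof.
move=> l01 h; have h1 := pow_lt lam i (proj1 l01); have h2 := pow_lt lam j (proj1 l01).
have h3 := pow_lt lam k (proj1 l01).
have E : lam ^ j <= lam ^ k * lam ^ i.
  have p1 : lam ^ (j - (i + k)) <= 1 by rewrite -(pow1 (j - (i + k))); apply: pow_incr; lra.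
  rewrite {1}(_ : j = (j - (i + k) + (k + i))%N); last by lia.
  have hp := Rmult_lt_0_compat _ _ h3 h1.
  by rewrite pow_add (pow_add _ k); nra.
apply: (Rmult_le_reg_r (lam ^ i + lam ^ j)); first lra.
have -> : lam ^ i / (lam ^ i + lam ^ j) * (lam ^ i + lam ^ j) = lam ^ i by field; lra.
by nra.
Qed.

(** F is the length of the dominating edge, A < K and D are the sides of its parallelogram, G is the
    length of g. Edges of length D are then too close to F to meet g, and D - A exceeds G, against
    [para_cross]. *)
Lemma thin_sides F G A D K : (F = A + D -> 1 <= A -> 1 <= G -> G + 2 * K <= F -> A < K ->
  [/\ D < F, F < D + K, A <= D & ~ D - A <= G])%Z.
Proof. by move=> *; split; lia. Qed.

Section Heavy.
Variable n : nat.
Variables (V : seq (pt n)) (xi : {set edge n}).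
Hypothesis bc : boundary_cond V xi.
Variables (alpha lam : R) (g : edge n).
Hypothesis al1 : 1 < alpha.
Hypothesis lam01 : 0 < lam < 1.
Hypothesis al_lam : alpha * alpha * lam <= 1.
Hypothesis ga : admissible V g.
Implicit Types (a b c d z w : pt n) (e f h p : edge n) (T U : {set edge n}).
Local Notation pz := (powerRZ alpha).
Local Notation len e := (Z.of_nat (elen e)).
Local Notation Psig := (Psi V xi g alpha).
Local Notation phig := (phi alpha g).
Local Notation Phig := (Phi V xi alpha g).

(** A lengthening flip cannot lower Psi, by [Phi_down] for the reverse flip, and flips between equal
    lengths occur only at length 2. *)
Lemma long_edge_shrinks T U f a b c d : Omega V xi T -> flip_quad V xi T f U a b c d ->
  (2 < elen f)%N -> Psig U < Psig T ->
  (elen [set c; d] < elen f)%N /\ Psig U <= Psig T - phig f.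
Proof.
move=> oT fq l3; rewrite (Psi_flip bc alpha g oT fq) => lt.
have oU := flip_quad_Omega bc oT fq; have fr := flip_quad_rev bc oT fq.
have [l|l|l] := ltngtP (elen [set c; d]) (elen f).
- by split=> //; have := Phi_down bc g al1 oT fq l; lra.
- have fE := fq_e fq.
  have l' : (elen [set a; b] < elen [set c; d])%N by rewrite -fE.
  have := Phi_down bc g al1 oU fr l'; rewrite -fE; have := phi_ge0 g al1 [set c; d]; lra.
- by have [q _] := equal_no_parent bc oT fq (esym l); rewrite q in l3.
Qed.

Section Isolated.
Variables (T U : {set edge n}) (f : edge n) (a b c d : pt n) (K : nat).
Hypothesis oT : Omega V xi T.
Hypothesis fq : flip_quad V xi T f U a b c d.
Hypothesis fg : meet f g.
Hypothesis shrink : (elen [set c; d] < elen f)%N.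
Hypothesis gap : (elen g + 2 * K <= elen f)%N.
Hypothesis isolated : forall h, h \in T -> h != f -> meet h g -> (elen h + K <= elen f)%N.

(** If one side were shorter than K, the two sides parallel to the other one would be longer than
    |f| - K and could not meet g. Then [para_cross] bounds the difference of the side lengths by
    |g|, against the gap. *)
Lemma isolated_sides : [/\ (Z.of_nat K <= len [set a; c])%Z, (Z.of_nat K <= len [set a; d])%Z &
  len f = (len [set a; c] + len [set a; d])%Z].
Proof.
have uni := quad_uni fq.
have Le := quad_len_e fq; have Lf := quad_len_f a c d.
have qd := quadrant uni (_ : (_ <= _)%Z).
have {}qd : (0 <= qu1 a c * qv1 a d /\ 0 <= qu2 a c * qv2 a d)%Z by apply: qd; rewrite -Le -Lf; lia.
have S := quadrant_add qd; rewrite -Le -quad_len_ac -quad_len_ad in S.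
have [ac bc' ad bd cd] := quad_neq oT fq.
have pac := elen_pos ac; have pad := elen_pos ad.
have pg : (1 <= len g)%Z by have [z1 [z2 [-> z12]]] := adm_ex ga; exact: elen_pos.
have g2 := adm_ex ga.
have eac : len [set b; d] = len [set a; c] by rewrite (quad_len_bd fq) quad_len_ac.
have ead : len [set b; c] = len [set a; d] by rewrite (quad_len_bc fq) quad_len_ad.
have [_ [Tbc [Tac _]]] := fq_abc fq; have [_ [Tbd [Tad _]]] := fq_abd fq.
have gapZ : (len g + 2 * Z.of_nat K <= len f)%Z.
  by move/leP: gap => /inj_le; rewrite Nat2Z.inj_add Nat2Z.inj_mul.
have nomeet h : h \in T -> (len h < len f)%Z -> (len f < len h + Z.of_nat K)%Z -> ~ meet h g.
  move=> hT h1 h2 m; have ne : h != f by apply/eqP => q; rewrite q in h1; apply: Z.lt_irrefl h1.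
  by move/leP: (isolated hT ne m) => /inj_le; rewrite Nat2Z.inj_add => /(Z.lt_le_trans _ _ _ h2) /Z.lt_irrefl.
have sym : forall x y : edge n, meet x y -> meet y x by move=> x y [q [q1 q2]]; exists q.
have uacd : Z.abs (orient a c d) = 1%Z by rewrite -uni /orient /qu1 /qu2 /qv1 /qv2; congr Z.abs; ring.
have uadc : Z.abs (orient a d c) = 1%Z by rewrite -uni -Z.abs_opp /orient /qu1 /qu2 /qv1 /qv2; congr Z.abs; ring.
have px' := fq_px fq; have py' := fq_py fq.
have z1 : zcoord a c d b 1 1 by split; rewrite ?px' ?py'; ring.
have z2 : zcoord a d c b 1 1 by split; rewrite ?px' ?py'; ring.
have mg : meet g [set a; b] by rewrite -(fq_e fq); apply: sym.
split=> //.
- apply: Znot_gt_le => /Z.gt_lt l; have [l1 l2 l3] := thin_sides S pac pg gapZ l; apply.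
  apply: (para_cross uacd z1 g2 mg _ _ l3) => /sym; apply: nomeet => //; rewrite ?ead //.
- apply: Znot_gt_le => /Z.gt_lt l; have [l1 l2 l3] := thin_sides (etrans S (Z.add_comm _ _)) pad pg gapZ l; apply.
  apply: (para_cross uadc z2 g2 mg _ _ l3) => /sym; apply: nomeet => //; rewrite ?eac //.
Qed.

(** The new diagonal is at most the difference of the sides plus 2, and both sides are at least K.
    With [qrate_ge] the flip has rate at least 1 - lam^(2K-2). *)
Lemma isolated_shrink : (elen [set c; d] + (2 * K - 2) <= elen f)%N.
Proof.
have [h1 h2 h3] := isolated_sides.
have uni := quad_uni fq.
have Le := quad_len_e fq; have Lf := quad_len_f a c d.
have qd := quadrant uni (_ : (_ <= _)%Z).
have {}qd : (0 <= qu1 a c * qv1 a d /\ 0 <= qu2 a c * qv2 a d)%Z by apply: qd; rewrite -Le -Lf; lia.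
by have := quadrant_sub uni qd; rewrite -Lf -quad_len_ac -quad_len_ad; lia.
Qed.

(** f lies in only two triangles, those of its parallelogram, and all their other sides are long. So
    what is charged to f, with 4 - 3|p| in the exponent, is negligible. *)
Lemma isolated_adj e p : adj V T e f p -> (Z.of_nat K <= len p)%Z.
Proof.
move=> [a' [b' [w [_ fE -> tr]]]].
have [h1 h2 h3] := isolated_sides.
have [c1 c2] : len [set b; d] = len [set a; c] /\ len [set b; c] = len [set a; d].
  by rewrite (quad_len_bd fq) quad_len_ac (quad_len_bc fq) quad_len_ad.
have pl := Omega_planar oT.
have apex z : tri V T a b z -> z = c \/ z = d.
  move=> tz; have [_ [_ [_ [o _]]]] := tz.
  have oc := fq_or fq.
  have od : orient a b d = (-1)%Z by rewrite (zcoord_orient (zcoord0 _ _ _) (zcoord1 _ _ _) (fq_d fq)) oc.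
  have [l|l] : (0 < orient a b z \/ orient a b z < 0)%Z by lia.
    by left; apply: (tri_unique pl tz (fq_abc fq)); rewrite oc; lia.
  by right; apply: (tri_unique pl tz (fq_abd fq)); rewrite od; lia.
have t2 := tri_rot tr; rewrite (fq_e fq) in fE.
case: (set2_eq fE) => [] [q1 q2]; rewrite -q1 -q2 in t2 *.
  by case: (apex _ t2) => ->; rewrite set2C; lia.
by case: (apex _ (tri_swap t2)) => ->; rewrite set2C; lia.
Qed.

End Isolated.

(** f loses its weight at nearly full rate, the other flips gain at most their charges, and the
    charges that f attracts carry the factor alpha^(4 - 3K). *)
Lemma isolated_drift T f K : Omega V xi T -> f \in T -> phig f = top_weight alpha g T -> meet f g ->
  (1 <= K)%N -> (elen g + 2 * K <= elen f)%N ->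
  (forall h, h \in T -> h != f -> meet h g -> (elen h + K <= elen f)%N) ->
  flip_sum V xi lam Psig T f < 0 ->
  \rsum_(e in T) flip_sum V xi lam Psig T e <=
    - (1 - lam ^ (2 * K - 2)) * top_weight alpha g T + (1 + 4 * alpha) * rest_weight V xi alpha g T +
    4 * pz (4 - 3 * Z.of_nat K) * top_weight alpha g T + 2 * latC alpha.
Proof.
move=> oT fT pf fg K1 gap iso neg.
case: (flip_sum_cases bc lam Psig f oT) => [[_ q]|[U [a [b [c [d [fq FS]]]]]]]; first by lra.
have pg : (1 <= len g)%Z by have [z1 [z2 [-> z12]]] := adm_ex ga; exact: elen_pos.
have qb := qrate_bounds lam01 (elen [set c; d]) (elen f).
have [sh dec] : (elen [set c; d] < elen f)%N /\ Psig U <= Psig T - phig f.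
  apply: (long_edge_shrinks oT fq); first lia.
  by move: neg qb; rewrite FS; move: (lam ^ _ / _) => q; nra.
have q1 := qrate_ge lam01 (isolated_shrink oT fq fg sh gap iso).
have top : flip_sum V xi lam Psig T f <= - (1 - lam ^ (2 * K - 2)) * top_weight alpha g T.
  rewrite FS -pf; move: q1 qb (phi_ge0 g al1 f) dec; move: (lam ^ elen _ / _) (lam ^ (2 * K - 2)) => q r.
  move: (Psig U) (Psig T) (phig f) => u t m hq h01 m0 ht.
  have : q * (u - t) <= q * - m by apply: Rmult_le_compat_l; lra.
  have : (1 - r) * m <= q * m by apply: Rmult_le_compat_r.
  lra.
pose beta h := if h == f then pz (4 - 3 * Z.of_nat K) * phig f else alpha * phig h.
have b0 h : 0 <= beta h.
  rewrite /beta; have := phi_ge0 g al1 h; have := phi_ge0 g al1 f; have := pz_gt0 al1 (4 - 3 * Z.of_nat K).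
  case: ifP => _ h1 h2 h3; last by nra.
  by apply: Rmult_le_pos; lra.
have hb e h p : h \in T -> adj V T e h p -> meet h g -> pz (len h - 3 * len p + 4 - len g) <= beta h.
  rewrite /beta; case: eqP => [->|_] _ ad m; last exact: adj_weight ad m.
  rewrite (phi_meet _ m) /wt -pz_add //; apply: pz_le => //.
  by have := isolated_adj oT fq fg sh gap iso ad; lia.
have tot : \rsum_(e | (e \in T) && (e != f)) flip_sum V xi lam Psig T e <=
    \rsum_(e | (e \in T) && (e != f)) phig e + 4 * (\rsum_(h in T) beta h) + 2 * latC alpha :=
  inc_total bc al1 lam01 al_lam ga (fun e => e != f) oT b0 hb.
have R1 : \rsum_(e | (e \in T) && (e != f)) phig e <= rest_weight V xi alpha g T.
  apply: Rle_trans (rest_weight_others bc al1 oT fT pf).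
  by apply: rsum_le => e /andP[eT _]; apply: Phi_ge_phi oT eT.
have R2 : \rsum_(h in T) beta h <= pz (4 - 3 * Z.of_nat K) * top_weight alpha g T + alpha * rest_weight V xi alpha g T.
  rewrite (bigD1 f) //= {1}/beta eqxx pf; apply: Rplus_le_compat_l.
  apply: Rle_trans (_ : alpha * (\rsum_(e | (e \in T) && (e != f)) phig e) <= _); last by apply: Rmult_le_compat_l; lra.
  rewrite rsum_mull; apply: Req_le; apply: eq_bigr => e /andP[_ /negbTE ne].
  by rewrite /beta ne.
rewrite (bigD1 f fT).
apply: Rle_trans (Rplus_le_compat _ _ _ _ top tot) _.
move: R1 R2; move: (\rsum_(e | (e \in T) && (e != f)) phig e) (\rsum_(h in T) beta h) => s1 s2 r1 r2; lra.

Qed.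

End Heavy.

Lemma pow_small r e : 0 < r < 1 -> 0 < e -> exists k0, forall k, (k0 <= k)%N -> r ^ k < e.
Proof.
move=> r01 e0; have [|k0 hk] := pow_lt_1_zero r _ e e0; first by rewrite Rabs_pos_eq; lra.
exists k0 => k /leP h; have := hk k h; rewrite Rabs_pos_eq //; apply: pow_le; lra.
Qed.

(** With eta = 1 - eps, each of the error terms lam^(2K-2) M, 4 alpha^(4-3K) M, (2 + 4 alpha) Z and
    2 [latC] is made at most eta/8 of M + Z, which leaves eta/2. The extra Z comes from writing -M
    as -(M + Z) + Z. K is chosen before delta and [Psi1]. *)
Lemma drift_constants alpha lam eps psi0 : 1 < alpha -> 0 < lam < 1 -> 0 < eps < 1 ->
  exists (K : nat) delta Psi1,
  [/\ (1 <= K)%N, 0 < delta <= 1/2, delta < eps /\ 2 * delta * alpha ^ K <= 1,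
      [/\ psi0 <= Psi1, 1 <= Psi1 & 2 * alpha ^ (2 * K) <= Psi1] &
   forall M Z, 0 <= M -> 0 <= Z -> Psi1 <= M + Z -> Z <= delta * (M + Z) ->
     - (1 - lam ^ (2 * K - 2)) * M + (1 + 4 * alpha) * Z + 4 * powerRZ alpha (4 - 3 * Z.of_nat K) * M + 2 * latC alpha <=
     - (eps + (1 - eps) / 2) * (M + Z)].
Proof.
move=> al1 lam01 eps01; pose eta := 1 - eps; have eta0 : 0 < eta by rewrite /eta; lra.
have r01 : 0 < / alpha < 1.
  split; first by apply: Rinv_0_lt_compat; lra.
  by rewrite -Rinv_1; apply: Rinv_lt_contravar; lra.
have a4 : 0 < alpha ^ 4 by apply: pow_lt; lra.
have [k1 hk1] := @pow_small lam (eta / 8) lam01 ltac:(lra).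
have [k2 hk2] := @pow_small (/ alpha) (eta / 32 / alpha ^ 4) r01 ltac:(apply: Rdiv_lt_0_compat; lra).
pose K := (k1 + k2 + 2)%N.
have aK : 0 < alpha ^ K by apply: pow_lt; lra.
pose d := Rmin (/ alpha ^ K / 2) (Rmin (eps / 2) (eta / 8 / (2 + 4 * alpha))).
have d1 : d <= / alpha ^ K / 2 by apply: Rmin_l.
have d2 : d <= eps / 2 by apply: Rle_trans (Rmin_r _ _) (Rmin_l _ _).
have d3 : d <= eta / 8 / (2 + 4 * alpha) by apply: Rle_trans (Rmin_r _ _) (Rmin_r _ _).
have d0 : 0 < d.
  apply: Rmin_pos; first by apply: Rdiv_lt_0_compat; [apply: Rinv_0_lt_compat|lra].
  by apply: Rmin_pos; [lra|apply: Rdiv_lt_0_compat; lra].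
have d4 : (2 + 4 * alpha) * d <= eta / 8.
  have -> : eta / 8 = (2 + 4 * alpha) * (eta / 8 / (2 + 4 * alpha)) by field; lra.
  by apply: Rmult_le_compat_l; lra.
have lc := latC_ge0 al1.
pose P1 := Rmax psi0 (Rmax 1 (Rmax (2 * alpha ^ (2 * K)) (16 * latC alpha / eta))).
have p1 : psi0 <= P1 by apply: Rmax_l.
have p2 : 1 <= P1 by apply: Rle_trans (Rmax_l _ _) (Rmax_r _ _).
have p3 : 2 * alpha ^ (2 * K) <= P1 by apply: Rle_trans (Rle_trans _ _ _ (Rmax_l _ _) (Rmax_r _ _)) (Rmax_r _ _).
have p4 : 16 * latC alpha / eta <= P1 by apply: Rle_trans (Rle_trans _ _ _ (Rmax_r _ _) (Rmax_r _ _)) (Rmax_r _ _).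
exists K, d, P1; split=> //.
- by rewrite /K; lia.
- by lra.
- split; first lra.
  have -> : 1 = 2 * (/ alpha ^ K / 2) * alpha ^ K by field; lra.
  by apply: Rmult_le_compat_r; lra.
move=> M Z M0 Z0 hP hZ.
have l1 : lam ^ (2 * K - 2) < eta / 8 by apply: hk1; rewrite /K; lia.
have l2 : 4 * powerRZ alpha (4 - 3 * Z.of_nat K) <= eta / 8.
  have E : powerRZ alpha (4 - 3 * Z.of_nat K) = alpha ^ 4 * (/ alpha) ^ (3 * K).
    rewrite (_ : (4 - 3 * Z.of_nat K = 4 + - Z.of_nat (3 * K))%Z); last by lia.
    by rewrite pz_add // powerRZ_neg' -pow_powerRZ pow_inv.
  rewrite E; have h := hk2 (3 * K)%N (ltac:(rewrite /K; lia)).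
  have h' := Rmult_lt_compat_l _ _ _ a4 h.
  have e32 : alpha ^ 4 * (eta / 32 / alpha ^ 4) = eta / 32 by field; lra.
  rewrite e32 in h'; lra.
have l3 : 2 * latC alpha <= eta / 8 * (M + Z).
  have -> : 2 * latC alpha = eta / 8 * (16 * latC alpha / eta) by field; lra.
  by apply: Rmult_le_compat_l; lra.
have l4 : (2 + 4 * alpha) * Z <= eta / 8 * (M + Z).
  have : (2 + 4 * alpha) * Z <= (2 + 4 * alpha) * (d * (M + Z)) by apply: Rmult_le_compat_l; lra.
  have : (2 + 4 * alpha) * d * (M + Z) <= eta / 8 * (M + Z) by apply: Rmult_le_compat_r; lra.
  lra.
have l5 : lam ^ (2 * K - 2) * M <= eta / 8 * M by apply: Rmult_le_compat_r; lra.
have l6 : 4 * powerRZ alpha (4 - 3 * Z.of_nat K) * M <= eta / 8 * M by apply: Rmult_le_compat_r.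
have l7 : eta * M <= eta * (M + Z) by apply: Rmult_le_compat_l; lra.
have ee : eps = 1 - eta by rewrite /eta; ring.
rewrite ee; move: l5 l6; move: (powerRZ _ _) (lam ^ _) => x y; lra.
Qed.

Section Sides3.
Variable n : nat.
Implicit Types (V : seq (pt n)).

Lemma last_side V0 (x v0 : pt n) : (last x V0, v0) \in zip (x :: V0) (rcons V0 v0).
Proof.
elim: V0 x => [|y s IH] x /=; first by rewrite inE.
by rewrite inE IH orbT.
Qed.

(** Three distinct sides of the polygon lie in [T]. This gives N >= 3, so that rho is
    nonnegative. *)
Lemma card_Omega_ge3 V xi T : lattice_polygon V -> boundary_cond V xi -> Omega V xi T -> (3 <= #|T|)%N.
Proof.
move=> [[sz [un _]] _] [_ [_ sd]] [_ /subsetP sub].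
have {}sd s : s \in sides V -> [set s.1; s.2] \in T by move=> h; apply: sub; apply: sd.
case: V sz un sd => [|v0 [|v1 [|v2 W]]] // _ un sd.
have s1 : [set v0; v1] \in T by apply: (sd (v0, v1)); rewrite /sides rot1_cons /= inE eqxx.
have s2 : [set v1; v2] \in T by apply: (sd (v1, v2)); rewrite /sides rot1_cons /= !inE eqxx orbT.
have s3 : [set last v2 W; v0] \in T.
  apply: (sd (last v2 W, v0)); rewrite /sides rot1_cons.
  have := last_side W v2 v0; rewrite /= !inE => ->; by rewrite !orbT.
have ll : last v2 W \in v2 :: W by apply: mem_last.
move: un => /=; rewrite !inE !negb_or => /andP[/andP[n01 /andP[n02 n0W]] /andP[/andP[n12 n1W] _]].
have n1l : v1 != last v2 W by apply/eqP => q; move: ll; rewrite -q inE (negbTE n12) (negbTE n1W).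
apply: leq_trans (_ : #|[set [set v0; v1]; [set v1; v2]; [set last v2 W; v0]]| <= _)%N; last first.
  by apply: subset_leq_card; apply/subsetP => e; rewrite !inE => /orP[/orP[]|] /eqP->.
have d12 : [set v0; v1] != [set v1; v2].
  by apply/eqP => /setP /(_ v0); rewrite !inE eqxx (negbTE n01) (negbTE n02).
have d13 : [set v0; v1] != [set last v2 W; v0].
  by apply/eqP => /setP /(_ v1); rewrite !inE eqxx orbT (negbTE n1l) eq_sym (negbTE n01).
have d23 : [set v1; v2] != [set last v2 W; v0].
  by apply/eqP => /setP /(_ v1); rewrite !inE eqxx (negbTE n1l) [v1 == v0]eq_sym (negbTE n01).
by rewrite -setUA !cardsU1 cards1 !inE negb_or d12 d13 d23.
Qed.
End Sides3.

(** * The interpolated Lyapunov functions *)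

Section Tail.
Variable n : nat.
Variables (V : seq (pt n)) (xi : {set edge n}).
Hypothesis bc : boundary_cond V xi.
Variables (alpha lam : R) (g : edge n).
Hypothesis al1 : 1 < alpha.
Hypothesis lam01 : 0 < lam < 1.
Hypothesis al_lam : alpha * alpha * lam <= 1.
Hypothesis ga : admissible V g.
Implicit Types (a b c d z w : pt n) (e f h p : edge n) (T U : {set edge n}).
Local Notation pz := (powerRZ alpha).
Local Notation len e := (Z.of_nat (elen e)).
Local Notation Psig := (Psi V xi g alpha).
Local Notation phig := (phi alpha g).
Local Notation Phig := (Phi V xi alpha g).
Local Notation M := (top_weight alpha g).
Local Notation Z := (rest_weight V xi alpha g).
Local Notation N := (INR #|Lambda V|).

Variables (eps psi0 : R).
Hypothesis eps01 : 0 < eps < 1.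
Hypothesis N3 : 3 <= N.
Hypothesis lyap : forall T, Omega V xi T -> psi0 <= Psig T ->
  Pop V xi lam Psig T <= (1 - eps / N) * Psig T.
Variables (K : nat) (delta Psi1 : R).
Hypothesis K1 : (1 <= K)%N.
Hypothesis delta0 : 0 < delta <= 1/2.
Hypothesis delta_eps : delta < eps.
Hypothesis delta_K : 2 * delta * alpha ^ K <= 1.
Hypothesis psi01 : psi0 <= Psi1.
Hypothesis Psi1_1 : 1 <= Psi1.
Hypothesis Psi1_K : 2 * alpha ^ (2 * K) <= Psi1.
Hypothesis consts : forall m z : R, 0 <= m -> 0 <= z -> Psi1 <= m + z -> z <= delta * (m + z) ->
     - (1 - lam ^ (2 * K - 2)) * m + (1 + 4 * alpha) * z + 4 * powerRZ alpha (4 - 3 * Z.of_nat K) * m + 2 * latC alpha <=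
     - (eps + (1 - eps) / 2) * (m + z).

Lemma flip_sum_Psi_ge T e : Omega V xi T -> - Phig e <= flip_sum V xi lam Psig T e.
Proof.
move=> oT; have P0 := Phi_ge0 V xi g al1 e.
case: (flip_sum_cases bc lam Psig e oT) => [[_ ->]|[U [a [b [c [d [fq ->]]]]]]]; first lra.
rewrite (Psi_flip bc alpha g oT fq); have F0 := Phi_ge0 V xi g al1 [set c; d].
have := qrate_bounds lam01 (elen [set c; d]) (elen e); move: (lam ^ _ / _) => q hq.
nra.
Qed.

Lemma pz_lt_inv i j : pz i < pz j -> (i < j)%Z.
Proof. by move=> h; apply: Znot_ge_lt => /Z.ge_le /(pz_le al1); lra. Qed.

(** The other edges lower Psi at most by Z < delta Psi < eps Psi, so the Lyapunov inequality makes
    the drift at the heaviest edge negative, as [isolated_drift] requires. The gap to |g| follows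
    from M >= Psi/2, the gap to other edges meeting g from their weight being at most Z. *)
Lemma top_heavy_drift T : Omega V xi T -> Psi1 <= Psig T -> Z T < delta * Psig T ->
  \rsum_(e in T) flip_sum V xi lam Psig T e <= - (eps + (1 - eps) / 2) * Psig T.
Proof.
move=> oT hP hZ.
have MZ : Psig T = M T + Z T by rewrite /rest_weight; ring.
have Z0 := rest_weight_ge0 bc g al1 oT.
have Mbig : 1 / 2 * Psig T <= M T by nra.
have Mbig' : (1 - delta) * Psig T < M T by lra.
have ly : \rsum_(e in T) flip_sum V xi lam Psig T e <= - eps * Psig T.
  have := lyap oT (Rle_trans _ _ _ psi01 hP); rewrite (Pop_E bc _ _ oT); last lra.
  move: (\rsum_(e in T) _) => s h; have h' : / N * s <= / N * (- eps * Psig T).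
    have -> : / N * (- eps * Psig T) = (1 - eps / N) * Psig T - Psig T by field; lra.
    lra.
  by apply: Rmult_le_reg_l h'; apply: Rinv_0_lt_compat; lra.
have [m0|[f fT pf]] := rmax_att T phig; first by move: Mbig; rewrite /top_weight m0; lra.
have pf0 : phig f = M T := pf.
have fg : meet f g by apply: NNPP => q; move: pf0; rewrite (phi_nmeet _ q); lra.
have pw : M T = pz (len f - len g) by rewrite -pf0 (phi_meet _ fg).
have gap : (elen g + 2 * K <= elen f)%N.
  have : pz (Z.of_nat (2 * K)) < pz (len f - len g) by rewrite -pw pz_nat; nra.
  by move=> /pz_lt_inv; clear; lia.
have iso h : h \in T -> h != f -> meet h g -> (elen h + K <= elen f)%N.
  move=> hT hf m.
  have h1 : phig h <= Z T.
    apply: Rle_trans (Phi_ge_phi g al1 oT hT) _; apply: Rle_trans (rest_weight_others bc al1 oT fT pf0).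
    by apply: (rsum_ge_term (F := Phig)) => [i _|]; [apply: Phi_ge0|rewrite hT].
  have aK : 0 < alpha ^ K by apply: pow_lt; lra.
  have : pz (Z.of_nat K + (len h - len g)) < pz (len f - len g).
    rewrite pz_add // pz_nat -pw; rewrite (phi_meet _ m) /wt in h1.
    have h2 : pz (len h - len g) < 2 * delta * M T by nra.
    have h3 : alpha ^ K * pz (len h - len g) < alpha ^ K * (2 * delta * M T) by apply: Rmult_lt_compat_l.
    have h4 : 2 * delta * alpha ^ K * M T <= 1 * M T by apply: Rmult_le_compat_r; lra.
    lra.
  by move=> /pz_lt_inv; clear; lia.
have neg : flip_sum V xi lam Psig T f < 0.
  have others : - Z T <= \rsum_(e | (e \in T) && (e != f)) flip_sum V xi lam Psig T e.
    apply: Rle_trans (rsum_le (fun e _ => flip_sum_Psi_ge e oT)).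
    apply: Rle_trans (Ropp_le_contravar _ _ (rest_weight_others bc al1 oT fT pf0)) _.
    have -> : - (\rsum_(h | (h \in T) && (h != f)) Phig h) = (-1) * (\rsum_(h | (h \in T) && (h != f)) Phig h) by ring.
    by rewrite rsum_mull; apply: rsum_le => e _; lra.
  rewrite (bigD1 f fT) in ly.
  have hh := Rplus_le_compat_l (flip_sum V xi lam Psig T f) _ _ others.
  have h5 := Rle_trans _ _ _ hh ly.
  by nra.
apply: Rle_trans (isolated_drift bc al1 lam01 al_lam ga oT fT pf0 fg K1 gap iso neg) _.
by rewrite MZ; apply: consts; rewrite -?MZ; lra.
Qed.

Local Notation D := (1 - eps / N).
Local Notation rho := (1 - 3 / N).
(** The division by 3 matches the 3 in rho. The bound by delta pays for the loss of coefficient when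
    Z >= delta Psi; the bound by (1 - eps)/4 pays in the top-heavy case, where [lyap_coef] >= 1/2
    multiplies a surplus (1 - eps)/2. *)
Definition theta : R := Rmin delta ((1 - eps) / 4) / 3.
Definition drift_const : R := (5 + 4 * alpha) * Psi1 + 2 * latC alpha.

Lemma Pop_Psi_light T : Omega V xi T -> Psig T <= Psi1 ->
  Pop V xi lam Psig T <= Psig T + / N * ((1 + 4 * alpha) * Psi1 + 2 * latC alpha).
Proof.
move=> oT h; rewrite (Pop_E bc _ _ oT); last lra.
apply: Rplus_le_compat_l; apply: Rmult_le_compat_l; first by apply: Rlt_le; apply: Rinv_0_lt_compat; lra.
apply: Rle_trans (Psi_drift_le bc al1 lam01 al_lam ga oT) _.
by apply: Rplus_le_compat_r; apply: Rmult_le_compat_l; lra.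
Qed.

Lemma Pop_Psi_le T : Omega V xi T -> Pop V xi lam Psig T <= D * Psig T + drift_const / N.
Proof.
move=> oT; have iN : 0 < / N by apply: Rinv_0_lt_compat; lra.
have lc := latC_ge0 al1.
have [h|h] := Rle_lt_dec Psi1 (Psig T).
  apply: Rle_trans (lyap oT (Rle_trans _ _ _ psi01 h)) _.
  suff : 0 <= drift_const / N by lra.
  by rewrite /drift_const; apply: Rmult_le_pos; [nra|lra].
apply: Rle_trans (Pop_Psi_light oT (Rlt_le _ _ h)) _.
have -> : D * Psig T + drift_const / N = Psig T + / N * (drift_const - eps * Psig T) by field; lra.
apply: Rplus_le_compat_l; apply: Rmult_le_compat_l; first lra.
rewrite /drift_const.
have P0 : 0 <= Psig T by have := rest_weight_ge0 bc g al1 oT; have := rmax_ge0 T phig; rewrite /rest_weight /top_weight; lra.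
have : eps * Psig T <= 1 * Psi1 by apply: Rmult_le_compat; lra.
lra.
Qed.

Lemma Pop_rest_ge T : Omega V xi T -> (1 - 2 / N) * Z T <= Pop V xi lam Z T.
Proof.
move=> oT; rewrite (Pop_E bc _ _ oT); last lra.
have := rest_weight_drift bc g al1 lam01 oT; move: (\rsum_(e in T) _) => s h.
have h' : / N * (-2 * Z T) <= / N * s by apply: Rmult_le_compat_l => //; apply: Rlt_le; apply: Rinv_0_lt_compat; lra.
have -> : (1 - 2 / N) * Z T = Z T + / N * (-2 * Z T) by field; lra.
lra.
Qed.

(* [lyap_fun j] is [rho^j M + (1 - rho^j) (1 - theta) Psi], written in terms of [Psi] and [Z = Psi - M]. *)
Definition lyap_coef (j : nat) : R := 1 - theta + theta * rho ^ j.
Definition lyap_fun (j : nat) T : R := lyap_coef j * Psig T + - rho ^ j * Z T.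

Lemma theta_bounds : [/\ 0 < theta, 3 * theta <= delta & 3 * theta <= (1 - eps) / 4].
Proof.
rewrite /theta; have := Rmin_l delta ((1 - eps) / 4); have := Rmin_r delta ((1 - eps) / 4).
have : 0 < Rmin delta ((1 - eps) / 4) by apply: Rmin_pos; lra.
by move: (Rmin _ _) => m; split; lra.
Qed.

Lemma N_bounds : [/\ 0 < / N, 0 <= 1 - 3 / N & 1 - 3 / N <= 1 - eps / N /\ 1 - eps / N <= 1].
Proof.
have iN : 0 < / N by apply: Rinv_0_lt_compat; lra.
have i3 : / N * N = 1 by field; lra.
split=> //; first by rewrite /Rdiv; nra.
by rewrite /Rdiv; split; nra.
Qed.

(** Passing from j to j + 1 lowers the coefficient of Psi by 3 theta rho^j / N, while replacing 1 -
    2/N by rho in front of Z gains rho^j Z / N. The gain covers the loss if Z >= delta Psi;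
    otherwise the strict drift of [top_heavy_drift] covers it, and below [Psi1] the additive
    constant does. *)
Lemma Pop_lyap_fun j T : Omega V xi T ->
  Pop V xi lam (lyap_fun j) T <= D * lyap_fun j.+1 T + drift_const / N.
Proof.
move=> oT.
have [iN r0 [rD D1]] := N_bounds; have [t0 td te] := theta_bounds.
have E : Pop V xi lam (lyap_fun j) T = lyap_coef j * Pop V xi lam Psig T + - rho ^ j * Pop V xi lam Z T.
  by rewrite /Pop !rsum_mull -big_split; apply: eq_bigr => U _; rewrite /lyap_fun /=; ring.
rewrite {}E.
have rj0 : 0 <= rho ^ j by apply: pow_le.
have r1 : rho <= 1 by apply: Rle_trans rD D1.
have rj1 : rho ^ j <= 1 by have := @pow_incr rho 1 j (conj r0 r1); rewrite pow1.
have tr0 : 0 <= theta * rho ^ j by apply: Rmult_le_pos; lra.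
have tr1 : theta * rho ^ j <= theta by rewrite -{2}(Rmult_1_r theta); apply: Rmult_le_compat_l; lra.
have cj1 : 1 / 2 <= lyap_coef j <= 1 by rewrite /lyap_coef; split; lra.
have PZ := Pop_rest_ge oT; have Z0 := rest_weight_ge0 bc g al1 oT.
have P0 : 0 <= Psig T by have := rmax_ge0 T phig; rewrite /rest_weight /top_weight in Z0 *; lra.
have lc := latC_ge0 al1.
have cS : lyap_coef j.+1 = lyap_coef j - 3 * theta * rho ^ j / N.
  have N0 : N <> 0 by lra.
  by rewrite /lyap_coef -tech_pow_Rmult; field.
have B1 : - rho ^ j * Pop V xi lam Z T <= - rho ^ j * ((1 - 2 / N) * Z T).
  by rewrite !Ropp_mult_distr_l_reverse; apply: Ropp_le_contravar; apply: Rmult_le_compat_l.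
have B2 : - rho ^ j * ((1 - 2 / N) * Z T) <= D * (- rho ^ j.+1 * Z T) - / N * (rho ^ j * Z T).
  have x0 : 0 <= rho ^ j * Z T by apply: Rmult_le_pos.
  have -> : D * (- rho ^ j.+1 * Z T) = - (rho ^ j * Z T * (D * rho)) by rewrite /=; ring.
  have : rho ^ j * Z T * (D * rho) <= rho ^ j * Z T * (1 * rho).
    by apply: Rmult_le_compat_l => //; apply: Rmult_le_compat_r.
  rewrite /Rdiv; lra.
have D0 : 0 <= D by lra.
have key : lyap_coef j * Pop V xi lam Psig T - / N * (rho ^ j * Z T) <=
    D * lyap_coef j * Psig T - / N * (3 * (theta * rho ^ j) * Psig T) + / N * drift_const.
  have C0 : 0 <= drift_const by rewrite /drift_const; nra.
  have NC := Rmult_le_pos _ _ (Rlt_le _ _ iN) C0.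
  have [h|h] := Rle_lt_dec Psi1 (Psig T); last first.
    have cP := Rmult_le_compat_l _ _ _ (proj1 (conj (_ : 0 <= lyap_coef j) I)) (Pop_Psi_light oT (Rlt_le _ _ h)).
    have {}cP := cP ltac:(lra).
    apply: Rle_trans (_ : lyap_coef j * (Psig T + / N * ((1 + 4 * alpha) * Psi1 + 2 * latC alpha)) <= _).
      have : 0 <= / N * (rho ^ j * Z T) by apply: Rmult_le_pos; [lra|apply: Rmult_le_pos].
      lra.
    have -> : D * lyap_coef j * Psig T - / N * (3 * (theta * rho ^ j) * Psig T) + / N * drift_const =
       lyap_coef j * Psig T + / N * (drift_const - lyap_coef j * (eps * Psig T) - 3 * (theta * rho ^ j) * Psig T) by field; lra.
    have -> : lyap_coef j * (Psig T + / N * ((1 + 4 * alpha) * Psi1 + 2 * latC alpha)) =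
      lyap_coef j * Psig T + / N * (lyap_coef j * ((1 + 4 * alpha) * Psi1 + 2 * latC alpha)) by ring.
    apply: Rplus_le_compat_l; apply: Rmult_le_compat_l; first lra.
    have q1 : eps * Psig T <= 1 * Psi1 by apply: Rmult_le_compat; lra.
    have q2 : lyap_coef j * (eps * Psig T) <= 1 * (1 * Psi1).
      by apply: Rmult_le_compat; try lra; apply: Rmult_le_pos; lra.
    have q3 : 3 * (theta * rho ^ j) * Psig T <= 1 * Psi1 by apply: Rmult_le_compat; lra.
    have q4 : lyap_coef j * ((1 + 4 * alpha) * Psi1 + 2 * latC alpha) <= 1 * ((1 + 4 * alpha) * Psi1 + 2 * latC alpha).
      by apply: Rmult_le_compat_r; [nra|lra].
    by rewrite /drift_const; lra.
  suff : lyap_coef j * Pop V xi lam Psig T - / N * (rho ^ j * Z T) <=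
      D * lyap_coef j * Psig T - / N * (3 * (theta * rho ^ j) * Psig T) by lra.
  have [hz|hz] := Rle_lt_dec (delta * Psig T) (Z T).
    have p1 : lyap_coef j * Pop V xi lam Psig T <= lyap_coef j * (D * Psig T).
      by apply: Rmult_le_compat_l; [lra|apply: lyap => //; lra].
    have p2 : 3 * (theta * rho ^ j) * Psig T <= rho ^ j * Z T.
      have -> : 3 * (theta * rho ^ j) * Psig T = rho ^ j * (3 * theta * Psig T) by ring.
      apply: Rmult_le_compat_l => //; apply: Rle_trans hz; apply: Rmult_le_compat_r; lra.
    have p3 := Rmult_le_compat_l _ _ _ (Rlt_le _ _ iN) p2.
    lra.
  have hv := top_heavy_drift oT h hz.
  have PP : Pop V xi lam Psig T <= D * Psig T - / N * ((1 - eps) / 2 * Psig T).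
    rewrite (Pop_E bc _ _ oT); last lra.
    have := Rmult_le_compat_l _ _ _ (Rlt_le _ _ iN) hv; rewrite /Rdiv; lra.
  have p1 := Rmult_le_compat_l (lyap_coef j) _ _ ltac:(lra) PP.
  have p2 : 3 * (theta * rho ^ j) * Psig T <= lyap_coef j * ((1 - eps) / 2 * Psig T).
    have -> : lyap_coef j * ((1 - eps) / 2 * Psig T) = lyap_coef j * ((1 - eps) / 2) * Psig T by ring.
    by apply: Rmult_le_compat_r => //; nra.
  have p3 := Rmult_le_compat_l _ _ _ (Rlt_le _ _ iN) p2.
  have p4 : 0 <= / N * (rho ^ j * Z T) by apply: Rmult_le_pos; [lra|apply: Rmult_le_pos].
  lra.
have key2 : D * (/ N * (3 * (theta * rho ^ j) * Psig T)) <= 1 * (/ N * (3 * (theta * rho ^ j) * Psig T)).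
  apply: Rmult_le_compat_r D1; apply: Rmult_le_pos; first lra.
  by apply: Rmult_le_pos => //; lra.
have -> : D * lyap_fun j.+1 T = D * lyap_coef j * Psig T - D * (/ N * (3 * (theta * rho ^ j) * Psig T)) + D * (- rho ^ j.+1 * Z T).
  by rewrite /lyap_fun cS /Rdiv; ring.
have -> : drift_const / N = / N * drift_const by rewrite /Rdiv; ring.
lra.
Qed.

(** Each step raises the index by one and adds [drift_const] / N, discounted by D for the steps
    still to come; the discounts form a geometric sum. *)
Lemma expect_lyap_fun s t i : Omega V xi s ->
  expect V xi lam s t (lyap_fun i) <= D ^ t * lyap_fun (t + i) s + drift_const / eps * (1 - D ^ t).
Proof.
move=> os; elim: t i => [|t IH] i; first by rewrite expect0 add0n /=; lra.
have [iN r0 [rD D1]] := N_bounds.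
rewrite expectS.
apply: Rle_trans (_ : expect V xi lam s t (fun T => D * lyap_fun i.+1 T + drift_const / N) <= _).
  by apply: (expect_le bc lam01) => // T; apply: Pop_lyap_fun.
rewrite expect_add expect_lin (expect_cst bc lam01 _ _ os); last lra.
have h : D * expect V xi lam s t (lyap_fun i.+1) <= D * (D ^ t * lyap_fun (t + i.+1) s + drift_const / eps * (1 - D ^ t)).
  by apply: Rmult_le_compat_l; [lra|apply: IH].
apply: Rle_trans (Rplus_le_compat_r _ _ _ h) _.
have N0 : N <> 0 by lra.
have e0 : eps <> 0 by lra.
by rewrite addnS addSn -tech_pow_Rmult; apply: Req_le; field.
Qed.

Lemma expect_top s t : Omega V xi s ->
  expect V xi lam s t M <= Rmax (Psig s * D ^ t) (drift_const / eps / theta).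
Proof.
move=> os; have [iN r0 [rD D1]] := N_bounds; have [t0 td te] := theta_bounds.
have lc := latC_ge0 al1.
have E : expect V xi lam s t M <= expect V xi lam s t (lyap_fun 0).
  apply: (expect_le bc lam01) => // T _; rewrite /lyap_fun /lyap_coef /rest_weight /=; lra.
apply: Rle_trans E _; apply: Rle_trans (expect_lyap_fun t 0 os) _; rewrite addn0.
have Z0 := rest_weight_ge0 bc g al1 os.
have P0 : 0 <= Psig s by have := rmax_ge0 s phig; rewrite /rest_weight /top_weight in Z0 *; lra.
have Dt0 : 0 <= D ^ t by apply: pow_le; lra.
have Dt1 : D ^ t <= 1 by have := @pow_incr D 1 t ltac:(lra); rewrite pow1.
have rt : rho ^ t <= D ^ t by apply: pow_incr; lra.
have rt0 : 0 <= rho ^ t by apply: pow_le.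
(* The term in Z is dropped and rho^t is replaced by the larger D^t. *)
have v : lyap_fun t s <= (1 - theta * (1 - D ^ t)) * Psig s.
  rewrite /lyap_fun /lyap_coef.
  have : 0 <= rho ^ t * Z s by apply: Rmult_le_pos.
  have : (1 - theta + theta * rho ^ t) * Psig s <= (1 - theta * (1 - D ^ t)) * Psig s.
    by apply: Rmult_le_compat_r => //; nra.
  lra.
have X1 := Rmax_l (Psig s * D ^ t) (drift_const / eps / theta).
have X2 := Rmax_r (Psig s * D ^ t) (drift_const / eps / theta).
move: X1 X2; set X := Rmax _ _ => X1 X2.
have w1 : D ^ t * lyap_fun t s <= (1 - theta * (1 - D ^ t)) * X.
  apply: Rle_trans (Rmult_le_compat_l _ _ _ Dt0 v) _.
  have -> : D ^ t * ((1 - theta * (1 - D ^ t)) * Psig s) = (1 - theta * (1 - D ^ t)) * (Psig s * D ^ t) by ring.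
  by apply: Rmult_le_compat_l => //; nra.
have w2 : drift_const / eps * (1 - D ^ t) <= theta * (1 - D ^ t) * X.
  have -> : drift_const / eps * (1 - D ^ t) = theta * (1 - D ^ t) * (drift_const / eps / theta) by field; lra.
  by apply: Rmult_le_compat_l => //; apply: Rmult_le_pos; lra.
lra.
Qed.

End Tail.

(** * A parallelogram forcing eps < 1 *)

Section Example.
Variables (n : nat) (a b c d : pt n) (J : Z).
Hypothesis J0 : (0 <= J)%Z.
Hypothesis pa : px a = 0%Z /\ py a = 0%Z.
Hypothesis pc : px c = (J + 1)%Z /\ py c = 1%Z.
Hypothesis pb' : px b = (2 * J + 1)%Z /\ py b = 2%Z.
Hypothesis pd : px d = J /\ py d = 1%Z.
Implicit Types (z x y : pt n) (p : R * R).

(** The parallelogram (0,0), (J+1,1), (2J+1,2), (J,1) has area 1. Its diagonal cd has length 1, and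
    ab has length 2J + 3, as large as desired. *)
Let V := [:: a; c; b; d].
(* Coordinates in which the parallelogram [a c b d] is the unit square. *)
Definition sqx p : R := p.1 - IZR J * p.2.
Definition sqy p : R := (IZR J + 1) * p.2 - p.1.
Local Notation S := sqx.
Local Notation T := sqy.

Definition zsx z : Z := (px z - J * py z)%Z.
Definition zsy z : Z := ((J + 1) * py z - px z)%Z.

Lemma S_rp z : S (rp z) = IZR (zsx z).
Proof. by rewrite /S /zsx /= minus_IZR mult_IZR. Qed.
Lemma T_rp z : T (rp z) = IZR (zsy z).
Proof. by rewrite /T /zsy /= minus_IZR mult_IZR plus_IZR. Qed.

Lemma zs_a : zsx a = 0%Z /\ zsy a = 0%Z.
Proof. by rewrite /zsx /zsy; case: pa => -> ->; split; ring. Qed.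
Lemma zs_c : zsx c = 1%Z /\ zsy c = 0%Z.
Proof. by rewrite /zsx /zsy; case: pc => -> ->; split; ring. Qed.
Lemma zs_b : zsx b = 1%Z /\ zsy b = 1%Z.
Proof. by rewrite /zsx /zsy; case: pb' => -> ->; split; ring. Qed.
Lemma zs_d : zsx d = 0%Z /\ zsy d = 1%Z.
Proof. by rewrite /zsx /zsy; case: pd => -> ->; split; ring. Qed.

Lemma zs_inj x y : zsx x = zsx y -> zsy x = zsy y -> x = y.
Proof.
rewrite /zsx /zsy => h1 h2; have e : py x = py y by lia.
by apply: pt_eq => //; rewrite e in h1; lia.
Qed.

Lemma ST_inj p q : S p = S q -> T p = T q -> p = q.
Proof.
case: p q => [p1 p2] [q1 q2]; rewrite /S /T /= => h1 h2; have e : p2 = q2 by lra.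
by rewrite e in h1 *; f_equal; lra.
Qed.

Lemma corner z : (0 <= zsx z <= 1)%Z -> (0 <= zsy z <= 1)%Z -> [\/ z = a, z = b, z = c | z = d].
Proof.
have [a1 a2] := zs_a; have [b1 b2] := zs_b; have [c1 c2] := zs_c; have [d1 d2] := zs_d.
move=> h1 h2; have [e1|e1] : (zsx z = 0 \/ zsx z = 1)%Z by lia.
  have [e2|e2] : (zsy z = 0 \/ zsy z = 1)%Z by lia.
    by constructor 1; apply: zs_inj; lia.
  by constructor 4; apply: zs_inj; lia.
have [e2|e2] : (zsy z = 0 \/ zsy z = 1)%Z by lia.
  by constructor 3; apply: zs_inj; lia.
by constructor 2; apply: zs_inj; lia.
Qed.

Lemma mix_ST x y p k : p = ((rp x).1 + k * ((rp y).1 - (rp x).1), (rp x).2 + k * ((rp y).2 - (rp x).2)) <->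
  S p = IZR (zsx x) + k * (IZR (zsx y) - IZR (zsx x)) /\ T p = IZR (zsy x) + k * (IZR (zsy y) - IZR (zsy x)).
Proof.
rewrite -!S_rp -!T_rp; split=> [->|[h1 h2]]; first by rewrite /S /T /=; split; ring.
by apply: ST_inj; rewrite ?h1 ?h2 /S /T /=; ring.
Qed.

Lemma sidesV : sides V = [:: (a, c); (c, b); (b, d); (d, a)].
Proof. by []. Qed.

Ltac coords := rewrite ?(proj1 zs_a) ?(proj2 zs_a) ?(proj1 zs_b) ?(proj2 zs_b) ?(proj1 zs_c) ?(proj2 zs_c) ?(proj1 zs_d) ?(proj2 zs_d).

Lemma cseg_ac p : cseg (rp a) (rp c) p <-> 0 <= S p <= 1 /\ T p = 0.
Proof.
split=> [[k [hk /mix_ST]]|[h1 h2]]; first by coords; lra.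
by exists (S p); split=> //; apply/mix_ST; coords; lra.
Qed.
Lemma cseg_cb p : cseg (rp c) (rp b) p <-> 0 <= T p <= 1 /\ S p = 1.
Proof.
split=> [[k [hk /mix_ST]]|[h1 h2]]; first by coords; lra.
by exists (T p); split=> //; apply/mix_ST; coords; lra.
Qed.
Lemma cseg_bd p : cseg (rp b) (rp d) p <-> 0 <= S p <= 1 /\ T p = 1.
Proof.
split=> [[k [hk /mix_ST]]|[h1 h2]]; first by coords; lra.
by exists (1 - S p); split=> //; [lra|apply/mix_ST; coords; lra].
Qed.
Lemma cseg_da p : cseg (rp d) (rp a) p <-> 0 <= T p <= 1 /\ S p = 0.
Proof.
split=> [[k [hk /mix_ST]]|[h1 h2]]; first by coords; lra.
by exists (1 - T p); split=> //; [lra|apply/mix_ST; coords; lra].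
Qed.

Lemma on_boundaryE p : on_boundary V p <->
  (0 <= S p <= 1 /\ (T p = 0 \/ T p = 1)) \/ (0 <= T p <= 1 /\ (S p = 0 \/ S p = 1)).
Proof.
split=> [[s []]|].
  rewrite sidesV !inE => /orP[/eqP->|/orP[/eqP->|/orP[/eqP->|/eqP->]]] /=;
  rewrite ?cseg_ac ?cseg_cb ?cseg_bd ?cseg_da; tauto.
by case=> [[h [q|q]]|[h [q|q]]]; [exists (a, c)|exists (b, d)|exists (d, a)|exists (c, b)];
  rewrite sidesV !inE ?eqxx ?orbT /=; split=> //; apply/cseg_ac || apply/cseg_bd || apply/cseg_da || apply/cseg_cb.
Qed.

Lemma crosses_ac p : crosses p (a, c) = (Rltb p.2 0 != Rltb p.2 1) && Rltb 0 (T p).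
Proof.
rewrite /crosses /rp /= (proj1 pa) (proj2 pa) (proj1 pc) (proj2 pc) plus_IZR.
congr andb; apply: Rltb_iff.
have -> : 0 + (p.2 - 0) * (IZR J + 1 - 0) / (1 - 0) = p.2 * (IZR J + 1) by field.
by rewrite /T; lra.
Qed.
Lemma crosses_cb p : crosses p (c, b) = (Rltb p.2 1 != Rltb p.2 2) && Rltb (S p) 1.
Proof.
rewrite /crosses /rp /= (proj1 pb') (proj2 pb') (proj1 pc) (proj2 pc) !plus_IZR mult_IZR.
congr andb; apply: Rltb_iff.
have -> : IZR J + 1 + (p.2 - 1) * (2 * IZR J + 1 - (IZR J + 1)) / (2 - 1) = p.2 * IZR J + 1 by field.
by rewrite /S; lra.
Qed.
Lemma crosses_bd p : crosses p (b, d) = (Rltb p.2 2 != Rltb p.2 1) && Rltb 1 (T p).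
Proof.
rewrite /crosses /rp /= (proj1 pb') (proj2 pb') (proj1 pd) (proj2 pd) !plus_IZR mult_IZR.
congr andb; apply: Rltb_iff.
have -> : 2 * IZR J + 1 + (p.2 - 2) * (IZR J - (2 * IZR J + 1)) / (1 - 2) = p.2 * (IZR J + 1) - 1 by field.
by rewrite /T; lra.
Qed.
Lemma crosses_da p : crosses p (d, a) = (Rltb p.2 1 != Rltb p.2 0) && Rltb (S p) 0.
Proof.
rewrite /crosses /rp /= (proj1 pa) (proj2 pa) (proj1 pd) (proj2 pd).
congr andb; apply: Rltb_iff.
have -> : IZR J + (p.2 - 1) * (0 - IZR J) / (0 - 1) = p.2 * IZR J by field.
by rewrite /S; lra.
Qed.

(** The height p.2 is S p + T p, so every crossing test depends on these two coordinates alone and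
    the parity is settled by cases. *)
Lemma inP_square p : inP V p <-> 0 <= S p <= 1 /\ 0 <= T p <= 1.
Proof.
have Y : p.2 = S p + T p by rewrite /S /T; ring.
rewrite /inP on_boundaryE sidesV /= crosses_ac crosses_cb crosses_bd crosses_da Y.
move: (S p) (T p) => s t {Y}; split.
  case=> [|]; first by move=> [[h1 [h2|h2]]|[h1 [h2|h2]]]; lra.
  case: (RltbP (s + t) 0) => y0; case: (RltbP (s + t) 1) => y1; case: (RltbP (s + t) 2) => y2 /=;
  case: (RltbP 0 t) => t0; case: (RltbP s 1) => s1; case: (RltbP 1 t) => t1; case: (RltbP s 0) => s0 //= _; lra.
move=> [h1 h2].
have [e|ne1] := Req_dec s 0; first by left; lra.
have [e|ne2] := Req_dec s 1; first by left; lra.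
have [e|ne3] := Req_dec t 0; first by left; lra.
have [e|ne4] := Req_dec t 1; first by left; lra.
right.
case: (RltbP (s + t) 0) => y0; case: (RltbP (s + t) 1) => y1; case: (RltbP (s + t) 2) => y2 /=; try lra;
case: (RltbP 0 t) => t0; try lra; case: (RltbP s 1) => s1; try lra; case: (RltbP 1 t) => t1; try lra; case: (RltbP s 0) => s0 //=; lra.
Qed.

Lemma Lam0_square z : Lam0 V z <-> [\/ z = a, z = b, z = c | z = d].
Proof.
rewrite /Lam0 inP_square S_rp T_rp; split.
  by move=> [[/le_IZR h1 /le_IZR h2] [/le_IZR h3 /le_IZR h4]]; apply: corner.
by case=> ->; coords; lra.
Qed.

Lemma admissible_square x y : x != y -> Lam0 V x -> Lam0 V y -> admissible V [set x; y].
Proof.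
move=> xy lx ly; apply/adm_set2; split; first split=> //.
  move=> p [k [hk /mix_ST [h1 h2]]]; apply/inP_square.
  move: lx ly; rewrite /Lam0 !inP_square !S_rp !T_rp h1 h2.
  move: (IZR _) (IZR _) (IZR _) (IZR _) => s t s' t' [q1 q2] [q3 q4].
  by split; nra.
move=> z lz [k [hk /mix_ST [h1 h2]]].
have q (i j l : Z) (r : R) : (0 <= i <= 1)%Z -> (0 <= j <= 1)%Z -> 0 < r < 1 ->
    IZR l = IZR i + r * (IZR j - IZR i) -> i = j.
  move=> hi hj hr; have [->|->] : (i = 0 \/ i = 1)%Z by lia.
    have [->|->] : (j = 0 \/ j = 1)%Z by lia.
      by [].
    move=> e; have l1 : 0 < IZR l < 1 by lra.
    by case: l1 => /lt_IZR ? /lt_IZR ?; lia.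
  have [->|->] : (j = 0 \/ j = 1)%Z by lia.
    move=> e; have l1 : 0 < IZR l < 1 by lra.
    by case: l1 => /lt_IZR ? /lt_IZR ?; lia.
  by [].
rewrite S_rp in h1; rewrite T_rp in h2.
have zr w : Lam0 V w -> (0 <= zsx w <= 1)%Z /\ (0 <= zsy w <= 1)%Z.
  by rewrite /Lam0 inP_square S_rp T_rp => [[[/le_IZR h3 /le_IZR h4] [/le_IZR h5 /le_IZR h6]]].
have [x1 x2] := zr _ lx; have [y1 y2] := zr _ ly.
by move/eqP: xy; apply; apply: zs_inj; [exact: (q _ _ _ _ x1 y1 hk h1)|exact: (q _ _ _ _ x2 y2 hk h2)].
Qed.

Lemma corners_neq : [/\ a != b, a != c, a != d & b != c] /\ (b != d /\ c != d).
Proof.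
have H x y : (zsx x, zsy x) <> (zsx y, zsy y) -> x != y by move=> h; apply/eqP => q; rewrite q in h.
by split; [split|split]; apply: H; coords.
Qed.

Lemma corners_Lam0 : [/\ Lam0 V a, Lam0 V b, Lam0 V c & Lam0 V d].
Proof. by split; apply/Lam0_square; [constructor 1|constructor 2|constructor 3|constructor 4]. Qed.

Lemma square_polygon : lattice_polygon V.
Proof.
have [[ab ac ad bc] [bd cd]] := corners_neq.
split; last first.
  move=> s sV z1 z2 cs.
  pose s1 := (z1 - J * z2)%Z; pose t1 := ((J + 1) * z2 - z1)%Z.
  have e1 : S (IZR z1, IZR z2) = IZR s1 by rewrite /S /s1 /= minus_IZR mult_IZR.
  have e2 : T (IZR z1, IZR z2) = IZR t1 by rewrite /T /t1 /= minus_IZR mult_IZR plus_IZR.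
  have F w : s1 = zsx w -> t1 = zsy w -> (z1, z2) = (px w, py w).
    rewrite /s1 /t1 /zsx /zsy => h1 h2; have h3 : z2 = py w by lia.
    by rewrite h3 in h1 *; f_equal; lia.
  have R01 (i : Z) : 0 <= IZR i <= 1 -> (i = 0 \/ i = 1)%Z by move=> [/le_IZR ? /le_IZR ?]; lia.
  move: sV cs; rewrite sidesV !inE => /orP[/eqP->|/orP[/eqP->|/orP[/eqP->|/eqP->]]];
    rewrite [_.1]/= [_.2]/= ?cseg_ac ?cseg_cb ?cseg_bd ?cseg_da ?e1 ?e2 => [[/R01 h1 /eq_IZR h2]].
  - by case: h1 => h1; [left|right]; apply: F; coords.
  - by case: h1 => h1; [left|right]; apply: F; coords.
  - by case: h1 => h1; [right|left]; apply: F; coords.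
  - by case: h1 => h1; [right|left]; apply: F; coords.
split=> //; split; first by rewrite /= !inE !negb_or ab ac ad [c == b]eq_sym bc cd bd.
have V1 w p : S p = IZR (zsx w) -> T p = IZR (zsy w) -> p = rp w.
  by move=> h1 h2; apply: ST_inj; rewrite ?S_rp ?T_rp.
move=> i j p; rewrite /side sidesV.
case: i => [|[|[|[|i]]]] // _; case: j => [|[|[|[|j]]]] // _ ne;
  rewrite [_.1]/= [_.2]/= [X in _ -> _ -> (_ /\ _ = rp X) \/ _]/= [X in _ -> _ -> _ \/ (_ /\ _ = rp X)]/=;
  rewrite ?cseg_ac ?cseg_cb ?cseg_bd ?cseg_da => h1 h2; try (by case: ne); try lra;
  first [left; split=> //; apply: V1; coords; lra|right; split=> //; apply: V1; coords; lra].
Qed.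

Let xi0 : {set edge n} := [set [set a; c]; [set c; b]; [set b; d]; [set d; a]].
Local Notation f := [set a; b].
Local Notation g := [set c; d].

Lemma segpt_coords x y p : segpt [set x; y] p -> exists k, [/\ 0 < k < 1,
  S p = IZR (zsx x) + k * (IZR (zsx y) - IZR (zsx x)) & T p = IZR (zsy x) + k * (IZR (zsy y) - IZR (zsy x))].
Proof. by move=> /segpt_set2 [_ [k [hk /mix_ST [h1 h2]]]]; exists k. Qed.

Lemma segpt_ac p : segpt [set a; c] p -> T p = 0 /\ 0 < S p < 1.
Proof. by move=> /segpt_coords [k [hk]]; coords; lra. Qed.
Lemma segpt_cb p : segpt [set c; b] p -> S p = 1 /\ 0 < T p < 1.
Proof. by move=> /segpt_coords [k [hk]]; coords; lra. Qed.
Lemma segpt_bd p : segpt [set b; d] p -> T p = 1 /\ 0 < S p < 1.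
Proof. by move=> /segpt_coords [k [hk]]; coords; lra. Qed.
Lemma segpt_da p : segpt [set d; a] p -> S p = 0 /\ 0 < T p < 1.
Proof. by move=> /segpt_coords [k [hk]]; coords; lra. Qed.
Lemma segpt_inner p : segpt f p \/ segpt g p -> 0 < S p < 1 /\ 0 < T p < 1.
Proof. by case=> /segpt_coords [k [hk]]; coords; lra. Qed.

Lemma diagonals_meet : meet f g.
Proof.
have [[ab ac ad bc] [bd cd]] := corners_neq.
have [p [h1 h2]] : exists p : R * R, S p = 1/2 /\ T p = 1/2.
  by exists (1/2 + IZR J, 1); rewrite /S /T /=; lra.
exists p; split; apply/segpt_set2; split=> //; exists (1/2); (split; first lra);
by apply/mix_ST; coords; lra.
Qed.

Ltac locate H := first [have [? ?] := segpt_ac H|have [? ?] := segpt_cb H|have [? ?] := segpt_bd H|have [? ?] := segpt_da H].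

Lemma sides_disjoint e h : e \in xi0 -> h \in xi0 -> e != h -> ~ meet e h.
Proof.
rewrite !inE -!orbA => /or4P[] /eqP-> /or4P[] /eqP->; rewrite ?eqxx // => _ [p [h1 h2]];
  locate h1; locate h2; lra.
Qed.

Lemma diagonal_side_disjoint e h : e = f \/ e = g -> h \in xi0 -> ~ meet e h.
Proof.
move=> ee; rewrite !inE -!orbA => hh [p [h1 h2]].
have [q1 q2] : 0 < S p < 1 /\ 0 < T p < 1 by apply: segpt_inner; case: ee h1 => ->; [left|right].
by case/or4P: hh h2 => /eqP-> h2; locate h2; lra.
Qed.

Lemma admissible_six e : admissible V e -> [\/ e \in xi0, e = f | e = g].
Proof.
move=> ae; have [x [y [eE xy]]] := adm_ex ae; move: ae; rewrite eE => /adm_set2 [[_ lx ly _] _].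
case/Lam0_square: lx => ex; case/Lam0_square: ly => ey; move: xy; rewrite ex ey ?eqxx // => _;
 first [by constructor 2|by constructor 3|by constructor 2; rewrite set2C|by constructor 3; rewrite set2C
   |by constructor 1; rewrite !inE eqxx ?orbT|by constructor 1; rewrite set2C !inE eqxx ?orbT].
Qed.

Lemma xi0_adm e : e \in xi0 -> admissible V e.
Proof.
have [[ab ac ad bc] [bd cd]] := corners_neq; have [la lb lc ld] := corners_Lam0.
by rewrite !inE -!orbA => /or4P[] /eqP->; apply: admissible_square; rewrite // eq_sym.
Qed.

Lemma diagonals_adm : admissible V f /\ admissible V g.
Proof.
have [[ab ac ad bc] [bd cd]] := corners_neq; have [la lb lc ld] := corners_Lam0.
by split; apply: admissible_square.
Qed.

Lemma square_bc : boundary_cond V xi0.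
Proof.
split; first exact: xi0_adm.
split; first exact: sides_disjoint.
by move=> s; rewrite sidesV !inE => /orP[/eqP->|/orP[/eqP->|/orP[/eqP->|/eqP->]]]; rewrite /= eqxx ?orbT.
Qed.

Lemma square_Omega e e' : (e = f /\ e' = g) \/ (e = g /\ e' = f) -> Omega V xi0 (e |: xi0).
Proof.
move=> ee; have sy (h h' : edge n) : meet h h' -> meet h' h by move=> [p [h1 h2]]; exists p.
have ed : e = f \/ e = g by case: ee => [[-> _]|[-> _]]; [left|right].
have [af ag] := diagonals_adm.
have ae : admissible V e by case: ed => ->.
split; last by apply: subsetUr.
split; first by move=> h; rewrite in_setU1 => /orP[/eqP->|]; [exact: ae|exact: xi0_adm].
split.
  move=> h h'; rewrite !in_setU1 => /orP[/eqP->|hx] /orP[/eqP->|hx'] ne.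
  - by rewrite eqxx in ne.
  - exact: diagonal_side_disjoint.
  - by move=> /sy; apply: diagonal_side_disjoint.
  - exact: sides_disjoint.
move=> h ah; rewrite in_setU1 negb_or => /andP[ne nx].
exists e; split; first by rewrite in_setU1 eqxx.
have m := diagonals_meet.
case: (admissible_six ah) => [q|hE|hE]; first by rewrite q in nx.
  by case: ee => [] [e1 _]; rewrite e1 hE ?eqxx // in ne *; apply: sy.
by case: ee => [] [e1 _]; rewrite e1 hE ?eqxx // in ne *.
Qed.

Lemma square_ground : Gset V xi0 g.
Proof.
have oT : Omega V xi0 (g |: xi0) by apply: (square_Omega (e' := f)); right.
have [[ab ac ad bc] [bd cd]] := corners_neq.
exists (emid g); split; first by exists (g |: xi0); rewrite in_setU1 eqxx.
have -> : elen g = 1%N.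
  apply: Nat2Z.inj; rewrite elenZ (proj1 pc) (proj2 pc) (proj1 pd) (proj2 pd); lia.
move=> e [T0 [[[aT _] _] [eT _]]]; have [x [y [-> xy]]] := adm_ex (aT _ eT).
by have := elen_pos xy; lia.
Qed.

Lemma elen_long : Z.of_nat (elen f) = (2 * J + 3)%Z.
Proof. by rewrite elenZ (proj1 pa) (proj2 pa) (proj1 pb') (proj2 pb'); lia. Qed.

Lemma elen_short : Z.of_nat (elen g) = 1%Z.
Proof. by rewrite elenZ (proj1 pc) (proj2 pc) (proj1 pd) (proj2 pd); lia. Qed.

(** Only the long diagonal can be flipped, at a rate q < 1, and Psi stays nonnegative, so Psi drops
    on average by at most q Psi / N. For large J the Lyapunov inequality applies and demands a drop
    of at least eps Psi / N. *)
Lemma square_lyapunov lam alpha psi0 eps : 0 < lam < 1 -> 1 < alpha ->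
  lyapunov_property lam alpha psi0 eps -> psi0 <= powerRZ alpha (2 * J + 2) -> eps < 1.
Proof.
move=> l01 al1 lyap psi_le; have bc0 := square_bc.
have oT : Omega V xi0 (f |: xi0) by apply: (square_Omega (e' := g)); left.
have fT : f \in f |: xi0 by rewrite in_setU1 eqxx.
have big : powerRZ alpha (2 * J + 2) <= Psi V xi0 g alpha (f |: xi0).
  rewrite (Psi_E bc0 alpha g oT).
  apply: Rle_trans (rsum_ge_term (F := Phi V xi0 alpha g) (fun i _ => Phi_ge0 V xi0 g al1 i) fT).
  apply: Rle_trans (Phi_ge_phi g al1 oT fT); rewrite (phi_meet _ diagonals_meet) /wt elen_long elen_short.
  by apply: Req_le; congr powerRZ; lia.
have := lyap n V xi0 (f |: xi0) g square_polygon bc0 oT square_ground (Rle_trans _ _ _ psi_le big).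
rewrite Exp1_Pop => ly.
have Np : 3 <= INR #|Lambda V|.
  have -> : 3 = INR 3 by rewrite /=; ring.
  by apply: le_INR; apply/leP; rewrite (card_Lambda bc0 oT); apply: (card_Omega_ge3 square_polygon bc0 oT).
move: ly; rewrite (Pop_E bc0 _ _ oT); last lra.
have -> : \rsum_(e in f |: xi0) flip_sum V xi0 lam (Psi V xi0 g alpha) (f |: xi0) e =
    flip_sum V xi0 lam (Psi V xi0 g alpha) (f |: xi0) f.
  rewrite (bigD1 f fT) /= big1 ?Rplus_0_r // => e /andP[eT ne].
  have ex : e \in xi0 by case/setU1P: eT => [q|//]; rewrite q eqxx in ne.
  case: (flip_sum_cases bc0 lam (Psi V xi0 g alpha) e oT) => [[] //|[U [x [y [z [w [fq _]]]]]]].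
  by move: (fq_xi fq); rewrite ex.
have P0 : 0 < Psi V xi0 g alpha (f |: xi0).
  by apply: Rlt_le_trans big; apply: powerRZ_lt; lra.
have ge : exists2 q, q < 1 & - q * Psi V xi0 g alpha (f |: xi0) <= flip_sum V xi0 lam (Psi V xi0 g alpha) (f |: xi0) f.
  case: (flip_sum_cases bc0 lam (Psi V xi0 g alpha) f oT) => [[_ ->]|[U [x [y [z [w [fq ->]]]]]]].
    by exists 0; lra.
  exists (lam ^ elen [set z; w] / (lam ^ elen [set z; w] + lam ^ elen f)).
    by have := qrate_bounds l01 (elen [set z; w]) (elen f); lra.
  have U0 : 0 <= Psi V xi0 g alpha U.
    by rewrite (Psi_E bc0 alpha g (flip_quad_Omega bc0 oT fq)); apply: rsum_ge0 => e _; apply: Phi_ge0.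
  have [q0 _] := qrate_bounds l01 (elen [set z; w]) (elen f).
  by move: q0; move: (lam ^ _ / _) => q q0; nra.
case: ge => q q1 ge ly.
have iN : 0 < / INR #|Lambda V| by apply: Rinv_0_lt_compat; lra.
apply: Rnot_le_lt => e1; move: ge ly P0 iN; rewrite /Rdiv.
move: (flip_sum _ _ _ _ _ _) (Psi _ _ _ _ _) (/ _) => s P i ge ly P0 iN.
have h1 : i * (- q * P) <= i * s by apply: Rmult_le_compat_l; lra.
have h2 : 0 < i * P by apply: Rmult_lt_0_compat.
have h3 : (eps - q) * (i * P) <= 0 by lra.
nra.
Qed.

End Example.

Lemma lyapunov_eps_lt1 lam alpha psi0 eps : 0 < lam < 1 -> 1 < alpha ->
  lyapunov_property lam alpha psi0 eps -> eps < 1.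
Proof.
move=> l01 al1 ly.
have [k0 hk] := Pow_x_infinity alpha ltac:(rewrite Rabs_pos_eq; lra) psi0.
have {hk} := hk k0 (Nat.le_refl _); rewrite Rabs_pos_eq => [hk|]; last by apply: pow_le; lra.
pose J := Z.of_nat k0; pose n := (2 * k0 + 2)%N.
have [a pa] := @pt_ex n 0 0 ltac:(lia) ltac:(lia).
have [c pc] := @pt_ex n (J + 1) 1 ltac:(rewrite /J /n; lia) ltac:(rewrite /n; lia).
have [b pb'] := @pt_ex n (2 * J + 1) 2 ltac:(rewrite /J /n; lia) ltac:(rewrite /n; lia).
have [d pd] := @pt_ex n J 1 ltac:(rewrite /J /n; lia) ltac:(rewrite /n; lia).
have J0 : (0 <= J)%Z by rewrite /J; lia.
apply: (square_lyapunov J0 pa pc pb' pd l01 al1 ly); apply: Rle_trans (Rge_le _ _ hk) _.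
by rewrite -pz_nat; apply: pz_le => //; rewrite /J; lia.
Qed.

(** * Reversibility and conclusion *)

Section Reversible.
Variable n : nat.
Variables (V : seq (pt n)) (xi : {set edge n}).
Hypothesis bc : boundary_cond V xi.
Variable lam : R.
Hypothesis lam01 : 0 < lam < 1.
Implicit Types (e f h : edge n) (T U : {set edge n}).
Local Notation N := (INR #|Lambda V|).
Local Notation w := (weight V lam).

Lemma weightE T : Omega V xi T -> w T = lam ^ (\sum_(e in T) elen e)%N.
Proof.
move=> oT; rewrite /weight; congr (_ ^ _).
rewrite [RHS](partition_big (@emid n) (fun x => x \in Lambda V)) //= => e eT.
by rewrite (Lambda_emid bc oT) imset_f.
Qed.

Lemma weight_gt0 T : 0 < w T.
Proof. by apply: pow_lt; lra. Qed.

Definition total_rate T U : R := \rsum_(e in T) frate V xi lam T e U.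

Lemma flip_edge_unique T U e e' : Omega V xi T -> flip V xi T e U -> flip V xi T e' U -> e = e'.
Proof.
move=> oT fl fl'; have [f [_ fT eT UE _]] := flip_sym bc oT fl; have [f' [_ fT' eT' UE' _]] := flip_sym bc oT fl'.
apply: NNPP => /eqP ne; have : e' \in U by rewrite UE !inE eq_sym ne eT'.
by rewrite UE' !inE eqxx /= => /eqP q; rewrite -q eT' in fT'.
Qed.

Lemma total_rateE T U e : Omega V xi T -> flip V xi T e U -> total_rate T U = qflip lam T e U.
Proof.
move=> oT fl; have [_ [_ _ eT _ _]] := flip_sym bc oT fl.
rewrite /total_rate (bigD1 e eT) /= big1 => [|h /andP[_ ne]].
  by rewrite /frate; case: pbP => // _; rewrite Rplus_0_r.
rewrite /frate; case: pbP => // fh.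
by rewrite (flip_edge_unique oT fl fh) eqxx in ne.
Qed.

Lemma total_rate0 T U : (forall e, ~ flip V xi T e U) -> total_rate T U = 0.
Proof. by move=> h; rewrite /total_rate big1 // => e _; rewrite /frate; case: pbP => // /h. Qed.

(** The two weights differ only in the factor of the flipped edge, and each rate is lam to the new
    length over a sum symmetric in the two lengths. *)
Lemma detailed_balance T U : Omega V xi T -> Omega V xi U -> w T * total_rate T U = w U * total_rate U T.
Proof.
move=> oT oU; have [[e fl]|no] := classic (exists e, flip V xi T e U); last first.
  rewrite !total_rate0 ?Rmult_0_r // => e fl; last by apply: no; exists e.
  by have [f [fl' _ _ _ _]] := flip_sym bc oU fl; apply: no; exists f.
have [a [b [c [d fq]]]] := flip_norm bc oT fl; have fr := flip_quad_rev bc oT fq.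
rewrite (total_rateE oT fl) (total_rateE oU (flip_quad_flip fr)).
rewrite (qflip_quad lam oT fq) (qflip_quad lam oU fr) -(fq_e fq) (weightE oT) (weightE oU).
have UE : U = [set c; d] |: (T :\ e) by rewrite (fq_T' fq) setUC.
have nf : [set c; d] \notin T :\ e by rewrite !inE negb_and (diag_notin oT fq) orbT.
rewrite {1}UE (big_setU1 _ nf) (big_setD1 e (fq_T fq)) /= !pow_add.
have swap (x y r : R) : 0 < x -> 0 < y -> x * r * (y / (y + x)) = y * r * (x / (x + y)) by move=> *; field; lra.
by apply: swap; apply: pow_lt; case: lam01.
Qed.

(** By detailed balance, exchanging T and U changes the sign of the double sum. This is the
    stationarity of the weights. *)
Lemma weighted_flip_sum F : \rsum_(T | pb (Omega V xi T)) (w T * \rsum_(e in T) flip_sum V xi lam F T e) = 0.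
Proof.
have E T : Omega V xi T -> w T * (\rsum_(e in T) flip_sum V xi lam F T e) =
    \rsum_(U | pb (Omega V xi U)) (w T * total_rate T U * (F U - F T)).
  move=> oT; rewrite /flip_sum exchange_big /= rsum_mull [RHS]big_mkcond /=; apply: eq_bigr => U _.
  rewrite -rsum_mulr -/(total_rate T U); case: pbP => oU; first by ring.
  by rewrite total_rate0 => [|e /(flip_Omega bc oT) //]; ring.
have -> : \rsum_(T | pb (Omega V xi T)) (w T * \rsum_(e in T) flip_sum V xi lam F T e) =
   \rsum_(T | pb (Omega V xi T)) \rsum_(U | pb (Omega V xi U)) (w T * total_rate T U * (F U - F T)).
  by apply: eq_bigr => T /pbP oT; apply: E.
set X := LHS; suff : X = - X by lra.
rewrite {1}/X exchange_big /=.
have -> : - X = (-1) * X by ring.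
rewrite /X rsum_mull; apply: eq_bigr => T /pbP oT; rewrite rsum_mull; apply: eq_bigr => U /pbP oU.
by rewrite (detailed_balance oU oT); ring.
Qed.

(** Averaging the drift inequality against the weights, which a step leaves invariant, gives eps X
    <= C W. *)
Lemma stationary_mean F eps C : 0 < N -> 0 < eps ->
  (forall T, Omega V xi T -> Pop V xi lam F T <= (1 - eps / N) * F T + C / N) ->
  \rsum_(T | pb (Omega V xi T)) (w T * F T) <= C / eps * (\rsum_(T | pb (Omega V xi T)) w T).
Proof.
move=> N0 e0 h; set W := (\rsum_(T | _) w T); set X := (X in X <= _).
have i0 : 0 < / N by apply: Rinv_0_lt_compat.
have : X <= (1 - eps / N) * X + C / N * W.
  have XE : X = \rsum_(T | pb (Omega V xi T)) (w T * Pop V xi lam F T).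
    transitivity (X + / N * (\rsum_(T | pb (Omega V xi T)) (w T * \rsum_(e in T) flip_sum V xi lam F T e))).
      by rewrite weighted_flip_sum; ring.
    rewrite /X rsum_mull -big_split /=; apply: eq_bigr => T /pbP oT; by rewrite (Pop_E bc lam F oT N0) Rmult_plus_distr_l -!Rmult_assoc (Rmult_comm (/ N)).
  apply: Rle_trans (Req_le _ _ XE) _.
  have -> : (1 - eps / N) * X + C / N * W = \rsum_(T | pb (Omega V xi T)) (w T * ((1 - eps / N) * F T + C / N)).
    rewrite /X /W (rsum_mull _ _ (1 - eps / N)) (rsum_mull _ _ (C / N)) -big_split /=.
    by apply: eq_bigr => T _; ring.
  apply: rsum_le => T /pbP oT; apply: Rmult_le_compat_l (h T oT); apply: Rlt_le; exact: weight_gt0.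
move=> hX; have h2 : / N * (eps * X) <= / N * (C * W) by rewrite /Rdiv in hX; lra.
have {}h2 := Rmult_le_reg_l _ _ _ i0 h2.
apply: (Rmult_le_reg_l eps) => //.
by have -> : eps * (C / eps * W) = C * W by field; lra.
Qed.

End Reversible.

(** * From expectations to tail events by Markov's inequality *)

Section Events.
Variable n : nat.
Variables (V : seq (pt n)) (xi : {set edge n}).
Hypothesis bc : boundary_cond V xi.
Variables (alpha lam : R) (g : edge n).
Hypothesis al1 : 1 < alpha.
Hypothesis lam01 : 0 < lam < 1.
Implicit Types (e f h : edge n) (T U : {set edge n}).

Lemma wt_long e l : INR (elen g) + l <= INR (elen e) -> Rpower alpha l <= wt alpha g e.
Proof.
move=> h; rewrite /wt powerRZ_Rpower; last lra.
by apply: Rle_Rpower; [lra|rewrite minus_IZR -!INR_IZR_INZ; lra].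
Qed.

Lemma Prob_top s t l (A : {set edge n} -> Prop) : Omega V xi s ->
  (forall T, Omega V xi T -> A T -> Rpower alpha l <= top_weight alpha g T) ->
  Prob V xi lam s t A <= expect V xi lam s t (top_weight alpha g) * Rpower alpha (- l).
Proof.
move=> os hA; rewrite /Prob /expect rsum_mulr.
have Rp : 0 < Rpower alpha (- l) by apply: exp_pos.
have inv : Rpower alpha l * Rpower alpha (- l) = 1 by rewrite -Rpower_plus Rplus_opp_r Rpower_O; lra.
apply: Rle_trans (rsum_le_subset (Q := fun=> true) (F := fun T => law V xi lam s t T * top_weight alpha g T * Rpower alpha (- l)) _ _) => //.
  apply: rsum_le => T /pbP aT; have [oT|nT] := classic (Omega V xi T); last first.
    by rewrite (law_support bc lam t os nT); lra.
  have L0 := law_ge0 bc lam01 t T os; rewrite Rmult_assoc -[X in X <= _]Rmult_1_r.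
  by apply: Rmult_le_compat_l => //; rewrite -inv; apply: Rmult_le_compat_r; [lra|apply: hA].
move=> T _; apply: Rmult_le_pos; last lra.
by apply: Rmult_le_pos; [apply: law_ge0|apply: rmax_ge0].
Qed.

Lemma piProb_Psi l c (A : {set edge n} -> Prop) : (exists T, Omega V xi T) ->
  \rsum_(T | pb (Omega V xi T)) (weight V lam T * Psi V xi g alpha T) <= c * (\rsum_(T | pb (Omega V xi T)) weight V lam T) ->
  (forall T, Omega V xi T -> A T -> Rpower alpha l <= Psi V xi g alpha T) ->
  piProb V xi lam A <= c * Rpower alpha (- l).
Proof.
move=> [T0 o0] mean hA; rewrite /piProb; set W := (\rsum_(T | pb (Omega V xi T)) weight V lam T) in mean *.
have W0 : 0 < W.
  apply: Rlt_le_trans (weight_gt0 V lam01 T0) _.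
  apply: (rsum_ge_term (F := weight V lam)) => [T _|]; last by apply/pbP.
  by apply: Rlt_le; apply: weight_gt0.
have inv : Rpower alpha l * Rpower alpha (- l) = 1 by rewrite -Rpower_plus Rplus_opp_r Rpower_O; lra.
have Rp : 0 < Rpower alpha (- l) by apply: exp_pos.
apply: (Rmult_le_reg_r W) => //.
rewrite {1}/Rdiv Rmult_assoc Rinv_l ?Rmult_1_r; last lra.
have -> : c * Rpower alpha (- l) * W = c * W * Rpower alpha (- l) by ring.
apply: Rle_trans (Rmult_le_compat_r _ _ _ (Rlt_le _ _ Rp) mean).
rewrite rsum_mulr.
have P0 T : Omega V xi T -> 0 <= Psi V xi g alpha T.
  by move=> oT; rewrite (Psi_E bc alpha g oT); apply: rsum_ge0 => e _; apply: Phi_ge0.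
apply: Rle_trans (rsum_le_subset (P := fun T => pb (Omega V xi T /\ A T)) (F := fun T => weight V lam T * Psi V xi g alpha T * Rpower alpha (- l)) _ _) => //.
- apply: rsum_le => T /pbP [oT aT]; rewrite Rmult_assoc -[X in X <= _]Rmult_1_r.
  apply: Rmult_le_compat_l; first by apply: Rlt_le; apply: weight_gt0.
  by rewrite -inv; apply: Rmult_le_compat_r; [lra|apply: hA].
- move=> T /pbP oT; apply: Rmult_le_pos; last lra.
  by apply: Rmult_le_pos; [apply: Rlt_le; apply: weight_gt0|apply: P0].
- by move=> T /pbP [oT _]; apply/pbP.
Qed.

(** Both edges contain their common midpoint. So the edge at the midpoint of g meets g, and its
    weight is counted in Psi. *)
Lemma same_midpoint_meet e : admissible V e -> admissible V g -> emid e = emid g -> meet e g.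
Proof.
move=> /adm_ex [a [b [-> ab]]] /adm_ex [c [d [-> cd]]] /(emid_rmid ab cd) q.
by exists (rmid a b); split; apply/segpt_set2; split=> //; [|rewrite q]; apply: rmid_oseg.
Qed.

End Events.

Lemma Gset_Omega n (V : seq (pt n)) xi g : Gset V xi g -> exists T, Omega V xi T /\ g \in T.
Proof. by move=> [x [[T [oT [gT _]]] _]]; exists T. Qed.

Theorem mainTheorem16 :
  forall lam alpha psi0 eps : R,
    (0 < lam < 1) ->
    (1 < alpha < / sqrt lam) -> (1 < psi0) -> (0 < eps) ->
    lyapunov_property lam alpha psi0 eps ->
    exists c : R, (0 < c) /\
      (forall (n : nat) (V : seq (pt n)) (xi : {set edge n}) (g : edge n)
              (s : {set edge n}) (t : nat) (l : R),
         lattice_polygon V -> boundary_cond V xi -> Gset V xi g -> Omega V xi s ->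
         (1 <= t)%N -> (0 <= l) ->
         (Prob V xi lam s t
            (fun T => exists y, y \in Lambda V /\ exists e, e \in T /\ emid e = y /\
                        meet e g /\ (INR (elen g) + l <= INR (elen e)))
          <= Rmax (Psi V xi g alpha s * (1 - eps / INR #|Lambda V|) ^ t) c
             * Rpower alpha (- l))) /\
      (forall (n : nat) (V : seq (pt n)) (xi : {set edge n}) (g : edge n)
              (x : mpt n) (l : R),
         lattice_polygon V -> boundary_cond V xi -> Gset V xi g -> x = emid g ->
         (0 <= l) ->
         (piProb V xi lam
            (fun T => exists e, e \in T /\ emid e = x /\
                        (INR (elen g) + l <= INR (elen e)))
          <= c * Rpower alpha (- l))).
Proof.
move=> lam alpha psi0 eps lam01 [al1 al2] _ eps0 ly.
have eps1 := lyapunov_eps_lt1 lam01 al1 ly.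
have eps01 : 0 < eps < 1 by [].
(* The bound alpha < lam^(-1/2) in the form used for the flip rates. *)
have al_lam : alpha * alpha * lam <= 1.
  have s0 : 0 < sqrt lam by apply: sqrt_lt_R0; lra.
  have h : alpha * sqrt lam < 1.
    by have := Rmult_lt_compat_r _ _ _ s0 al2; rewrite Rinv_l; lra.
  have h0 : 0 < alpha * sqrt lam by apply: Rmult_lt_0_compat; lra.
  have -> : alpha * alpha * lam = (alpha * sqrt lam) * (alpha * sqrt lam).
    by rewrite -{1}(sqrt_sqrt lam); [ring|lra].
  nra.
have [K [delta [Psi1 [K1 d0 [de dK] [p1 p2 p3] cst]]]] := drift_constants psi0 al1 lam01 eps01.
have [th0 th1 _] := theta_bounds eps01 d0.
have C0 : 0 < drift_const alpha Psi1.
  by rewrite /drift_const; have := latC_ge0 al1; nra.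
have Ce : 0 < drift_const alpha Psi1 / eps by apply: Rdiv_lt_0_compat.
exists (drift_const alpha Psi1 / eps / theta eps delta); split; first by apply: Rdiv_lt_0_compat.
have N3 n (V : seq (pt n)) xi T : lattice_polygon V -> boundary_cond V xi -> Omega V xi T -> 3 <= INR #|Lambda V|.
  move=> lp bc oT; have -> : 3 = INR 3 by rewrite /=; ring.
  by apply: le_INR; apply/leP; rewrite (card_Lambda bc oT); apply: (card_Omega_ge3 lp bc oT).
have Pl n (V : seq (pt n)) xi g : lattice_polygon V -> boundary_cond V xi -> Gset V xi g ->
    forall T, Omega V xi T -> psi0 <= Psi V xi g alpha T ->
    Pop V xi lam (Psi V xi g alpha) T <= (1 - eps / INR #|Lambda V|) * Psi V xi g alpha T.
  by move=> lp bc gg T oT h; rewrite -Exp1_Pop; apply: ly.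
split.
- move=> n V xi g s t l lp bc gg os _ _.
  have [Tg [oTg gT]] := Gset_Omega gg; have ga : admissible V g by case: oTg => [[h _] _]; apply: h.
  have N0 := N3 _ _ _ _ lp bc os.
  refine (Rle_trans _ _ _ (@Prob_top _ _ _ bc alpha lam g al1 lam01 s t l _ os _) _).
    move=> T oT [y [_ [e [eT [_ [m h]]]]]].
    apply: Rle_trans (wt_long al1 h) _; rewrite -(phi_meet _ m); exact: (rmax_ub (phi alpha g) eT).
  apply: Rmult_le_compat_r; first by apply: Rlt_le; apply: exp_pos.
  exact: (expect_top bc al1 lam01 al_lam ga eps01 N0 (Pl _ _ _ _ lp bc gg) K1 d0 de dK p1 p2 p3 cst t os).
- move=> n V xi g x l lp bc gg -> _.
  have [Tg [oTg gT]] := Gset_Omega gg; have ga : admissible V g by case: oTg => [[h _] _]; apply: h.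
  have N0 := N3 _ _ _ _ lp bc oTg.
  apply: Rle_trans (_ : drift_const alpha Psi1 / eps * Rpower alpha (- l) <= _).
    apply: (piProb_Psi bc (alpha := alpha) (g := g) al1 lam01 (l := l)); first by exists Tg.
      apply: (stationary_mean bc lam01 _ eps0); first lra.
      move=> T oT; exact: (Pop_Psi_le bc al1 lam01 al_lam ga eps01 N0 (Pl _ _ _ _ lp bc gg) d0 de p1 p2 oT).
    move=> T oT [e [eT [em h]]].
    have ea : admissible V e by case: oT => [[h' _] _]; apply: h'.
    have m := same_midpoint_meet ea ga em.
    apply: Rle_trans (wt_long al1 h) _; rewrite -(phi_meet _ m).
    apply: Rle_trans (rmax_ub (phi alpha g) eT) _; exact: (top_weight_le bc g al1 oT).
  apply: Rmult_le_compat_r; first by apply: Rlt_le; apply: exp_pos.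
  (* Since theta <= 1, the equilibrium constant [drift_const] / eps is at most c. *)
  apply: (Rmult_le_reg_r (theta eps delta)) => //.
  have -> : drift_const alpha Psi1 / eps / theta eps delta * theta eps delta = drift_const alpha Psi1 / eps by field; lra.
  nra.
Qed.
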